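(* Let $\mathcal{M}=\{m_n\}_{n=1}^{n_{\max}}$ be an admissible collection of functions on $\mathbb{R}^d\setminus\{\mathbf 0\}$, with associated multiplier transform $T_{\mathcal M}$. Suppose $\{\phi_k : k\in\mathbb{Z}\}$ is a Parseval frame for $L_2(\mathbb{R}^d)$; i.e., for every $f\in L_2(\mathbb{R}^d)$, $$f=\sum_{k}\langle f,\phi_k\rangle\,\phi_k \qquad\text{and}\qquad \sum_k |\langle f,\phi_k\rangle|^2=\|f\|_{L_2(\mathbb{R}^d)}^2 .$$ Then the family $$\{\psi_{k,n}=[T_{\mathcal M}(\phi_k)]_n : k\in\mathbb{Z},\ n=1,\dots,n_{\max}\}$$ is also a Parseval frame for $L_2(\mathbb{R}^d)$, that is, $\sum_{n=1}^{n_{\max}}\sum_k|\langle f,\psi_{k,n}\rangle|^2=\|f\|_{L_2(\mathbb{R}^d)}^2$ for every $f\in L_2(\mathbb{R}^d)$, and $$f=\sum_{n=1}^{n_{\max}}\sum_k\langle f,\psi_{k,n}\rangle\,\psi_{k,n}\qquad\text{for every } f\in L_2(\mathbb{R}^d).$$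
   Context: The Fourier transform is $\widehat f(\boldsymbol\omega)=\mathcal F\{f\}(\boldsymbol\omega)=\int_{\mathbb{R}^d}f(\mathbf x)e^{-2\pi i\,\mathbf x\cdot\boldsymbol\omega}\,d\mathbf x$ (extended to $L_2(\mathbb{R}^d)$), with inverse $\mathcal F^{-1}$. Series converge in $L_2(\mathbb{R}^d)$; $\langle\cdot,\cdot\rangle$ is the $L_2(\mathbb{R}^d)$ inner product. A finite collection of complex-valued functions $\mathcal M=\{m_n\}_{n=1}^{n_{\max}}$ is called admissible if (1) each $m_n$ is Lebesgue measurable and homogeneous of degree $0$, i.e. $m_n(a\boldsymbol\omega)=m_n(\boldsymbol\omega)$ for all $a>0$ and $\boldsymbol\omega\neq\mathbf 0$; and (2) $\sum_{n=1}^{n_{\max}}|m_n(\boldsymbol\omega)|^2=1$ for every $\boldsymbol\omega\in\mathbb{R}^d\setminus\{\mathbf 0\}$. For an admissible $\mathcal M$, the multiplier transform $T_{\mathcal M}:L_2(\mathbb{R}^d)\to L_2^{n_{\max}}(\mathbb{R}^d)$ (vector-valued functions with $n_{\max}$ components in $L_2(\mathbb{R}^d)$) is defined componentwise by $[T_{\mathcal M}(f)]_n=\mathcal F^{-1}\{m_n\widehat f\}$. *)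

(* Defs.v *)
From HB Require Import structures.
From mathcomp Require Import all_boot all_order all_algebra finmap.
From mathcomp Require Import all_classical all_reals all_analysis.
From mathcomp Require Import complex.
From mathcomp Require summability.

Set Implicit Arguments.
Unset Strict Implicit.
Unset Printing Implicit Defensive.

Import Order.TTheory GRing.Theory Num.Theory.
Import ComplexField.Normc.
Import numFieldNormedType.Exports.

Local Open Scope classical_set_scope.
Local Open Scope ring_scope.

(* The product sigma-algebra on row vectors, that is, the Borel one. *)
Section measurable_row.
Context {R : realType} (n : nat).

Let coord (i : 'I_n) (x : 'rV[R]_n) : measurableTypeR R := x ord0 i.

Let row_set0 : g_sigma_preimage coord set0.
Proof. exact: sigma_algebra0. Qed.

Let row_setC A : g_sigma_preimage coord A -> g_sigma_preimage coord (~` A).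
Proof. exact: sigma_algebraC. Qed.

Let row_bigcup (F : _^nat) : (forall i, g_sigma_preimage coord (F i)) ->
  g_sigma_preimage coord (\bigcup_i (F i)).
Proof. exact: sigma_algebra_bigcup. Qed.

HB.instance Definition _ := @isMeasurable.Build default_measure_display
  'rV[R]_n (g_sigma_preimage coord) row_set0 row_setC row_bigcup.

End measurable_row.

Section product_lebesgue.
Context {R : realType}.

Lemma measurable_coord n (i : 'I_n) :
  measurable_fun [set: 'rV[R]_n] (fun x => x ord0 i).
Proof.
move=> _ Y mY; rewrite setTI; apply: sub_sigma_algebra => /=.
rewrite -bigcup_seq/=; exists i => /=; first by rewrite mem_index_enum.
by exists Y => //; rewrite setTI.
Qed.

Lemma measurable_rowP d (T : measurableType d) n (f : T -> 'rV[R]_n) :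
  (forall i, measurable_fun [set: T] (fun t => f t ord0 i)) ->
  measurable_fun [set: T] f.
Proof.
move=> mf; apply: measurability => //.
move=> _ [B + <-]; rewrite -bigcup_seq => -[i /= _ [C mC <-]].
by rewrite setTI; exact: mf.
Qed.

Definition cons_row n (p : measurableTypeR R * 'rV[R]_n) : 'rV[R]_n.+1 :=
  row_mx (const_mx p.1 : 'rV_1) p.2.

Let cons_row0 n p (j : 'I_1) : @cons_row n p ord0 (lshift n j) = p.1.
Proof. by rewrite [LHS]row_mxEl mxE. Qed.

Let cons_rowS n p (j : 'I_n) : @cons_row n p ord0 (rshift 1 j) = p.2 ord0 j.
Proof. by rewrite [LHS]row_mxEr. Qed.

Lemma measurable_cons_row n : measurable_fun setT (@cons_row n).
Proof.
apply: measurable_rowP => i; case: (split_ordP (i : 'I_(1 + n))) => j ->.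
- rewrite (_ : (fun _ => _) = fst)//.
  by apply/funext => p; rewrite cons_row0.
- rewrite (_ : (fun _ => _) = (fun x : 'rV[R]_n => x ord0 j) \o snd).
    by apply: measurableT_comp => //; exact: measurable_coord.
  by apply/funext => p; rewrite cons_rowS.
Qed.

Definition uncons_row n (x : 'rV[R]_n.+1) : measurableTypeR R * 'rV[R]_n :=
  (x ord0 ord0, \row_i x ord0 (rshift 1 i)).

Lemma measurable_uncons_row n : measurable_fun setT (@uncons_row n).
Proof.
apply/measurable_fun_pairP; split; first exact: measurable_coord.
apply: measurable_rowP => i /=.
by under eq_fun do rewrite mxE; exact: measurable_coord.
Qed.

Lemma cons_rowK n : cancel (@cons_row n) (@uncons_row n).
Proof.
case=> a x; congr pair => /=.
  have -> : ord0 = lshift n (ord0 : 'I_1) :> 'I_(1 + n) by exact/val_inj.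
  exact: cons_row0.
by apply/rowP => i; rewrite mxE cons_rowS.
Qed.

Section step.
Context n (mu : {sigma_finite_measure set 'rV[R]_n -> \bar R}).

Definition cons_measure : set 'rV[R]_n.+1 -> \bar R :=
  pushforward (@lebesgue_measure R \x mu)%E (@cons_row n).


Let cons_measure0 : cons_measure set0 = 0%E.
Proof. by rewrite /cons_measure /pushforward preimage_set0 measure0. Qed.

Let cons_measure_ge0 A : (0 <= cons_measure A)%E.
Proof. exact: (measure_ge0 (lebesgue_measure \x mu)%E). Qed.

Let cons_measure_sigma_additive : semi_sigma_additive cons_measure.
Proof.
exact: (@measure_semi_sigma_additive _ _ _
  (measure_function_pushforward__canonical__measure_function_Measure _
    (@measurable_cons_row n))).
Qed.

HB.instance Definition _ := isMeasure.Build _ _ _ cons_measure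
  cons_measure0 cons_measure_ge0 cons_measure_sigma_additive.

Let cons_measure_sigma_finite : sigma_finite setT cons_measure.
Proof.
have /sigma_finiteP[F [TF ndF Foo]] := sigma_finiteT (@lebesgue_measure R).
have /sigma_finiteP[G [TG ndG Goo]] := sigma_finiteT mu.
exists (fun i => @uncons_row n @^-1` (F i `*` G i)).
  apply/esym/seteqP; split => // x _.
  have [i _ Fi] : (\bigcup_i F i) (uncons_row x).1 by rewrite -TF.
  have [j _ Gj] : (\bigcup_i G i) (uncons_row x).2 by rewrite -TG.
  exists (maxn i j) => //; split.
  - by move: Fi; exact/subsetPset/ndF/leq_maxl.
  - by move: Gj; exact/subsetPset/ndG/leq_maxr.
move=> i; have [mFi Fioo] := Foo i; have [mGi Gioo] := Goo i; split.
  rewrite -[X in measurable X]setTI; apply: measurable_uncons_row => //.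
  exact: measurableX.
rewrite /cons_measure /pushforward -comp_preimage.
rewrite (_ : _ \o _ = id); last by apply/funext => p; exact: cons_rowK.
by rewrite preimage_id product_measure1E// lte_mul_pinfty// ge0_fin_numE.
Qed.

HB.instance Definition _ := @Measure_isSigmaFinite.Build _ _ _
  cons_measure cons_measure_sigma_finite.

End step.

Fixpoint borel_lebesgue n : {sigma_finite_measure set 'rV[R]_n -> \bar R} :=
  if n is n'.+1 then cons_measure (borel_lebesgue n') else dirac (0 : 'rV[R]_0).

End product_lebesgue.

(* R^n with the Lebesgue measurable sets: the Caratheodory sigma-algebra of the
   outer measure generated by the Borel measure, i.e. its completion. *)
Definition euclid (R : realType) (n : nat) : measurableType _ :=
  caratheodory_type (@borel_lebesgue R n)^*%mu.

Definition Leb (R : realType) (n : nat) :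
    {measure set (euclid R n) -> \bar R} :=
  @completed_measure_extension _ _ _ (@borel_lebesgue R n).

Section complexL2.
Context {d : measure_display} {T : measurableType d} {R : realType}.

Definition cmeasurable (D : set T) (f : T -> R[i]) : Prop :=
  measurable_fun D (fun x => complex.Re (f x)) /\
  measurable_fun D (fun x => complex.Im (f x)).

Variable mu : {measure set T -> \bar R}.

Definition cintegrable (f : T -> R[i]) : Prop :=
  mu.-integrable setT (EFin \o (fun x => complex.Re (f x))) /\
  mu.-integrable setT (EFin \o (fun x => complex.Im (f x))).

Definition cintegral (f : T -> R[i]) : R[i] :=
  Complex (\int[mu]_x complex.Re (f x)) (\int[mu]_x complex.Im (f x)).

Definition L2norm (f : T -> R[i]) : \bar R :=
  'N[mu]_2%:E[EFin \o @normc R \o f]%E.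

(* Elements of L_2 are represented by functions; equality in L_2 is equality
   almost everywhere. *)
Definition L2 (f : T -> R[i]) : Prop :=
  cmeasurable setT f /\ (L2norm f < +oo)%E.

Definition inner (f g : T -> R[i]) : R[i] :=
  cintegral (fun x => f x * conjc (g x)).

Definition L2cvg (u : nat -> T -> R[i]) (f : T -> R[i]) : Prop :=
  (fun j => L2norm (u j \- f)) @ \oo --> 0%E.

(* f is the L_2 sum of the family u: the partial sums over finite sets of
   indices converge to f along the directed set of these finite sets. *)
Definition has_L2sum (I : choiceType) (u : I -> T -> R[i]) (f : T -> R[i]) :
    Prop :=
  (fun A : {fset I} => L2norm ((fun x => \sum_(i <- A) u i x) \- f))
    @ summability.totally --> 0%E.

Definition parseval_frame (I : choiceType) (phi : I -> T -> R[i]) : Prop :=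
  (forall i, L2 (phi i)) /\
  forall f, L2 f ->
    has_L2sum (fun i x => inner f (phi i) * phi i x) f /\
    (\esum_(i in [set: I]) ((normc (inner f (phi i))) ^+ 2)%:E
      = L2norm f ^+ 2)%E.

End complexL2.

Section fourier.
Context {R : realType} {n : nat}.
Implicit Types f g : euclid R n -> R[i].

Definition dot (x y : 'rV[R]_n) : R := \sum_(i < n) x ord0 i * y ord0 i.

(* expi t = e^(it) *)
Definition expi (t : R) : R[i] := Complex (cos t) (sin t).

Definition fourier1 f : euclid R n -> R[i] :=
  fun w => cintegral (Leb R n) (fun x => f x * expi (- (2 * pi * dot x w))).

(* The graph of the continuous extension of fourier1 from L_1 `&` L_2 to L_2. *)
Definition is_fourier f g : Prop :=
  [/\ L2 (Leb R n) f, L2 (Leb R n) g &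
    exists u : nat -> euclid R n -> R[i],
      [/\ forall j, cintegrable (Leb R n) (u j) /\ L2 (Leb R n) (u j),
          L2cvg (Leb R n) u f &
          L2cvg (Leb R n) (fun j => fourier1 (u j)) g]].

(* xget chooses a representative of the class in L_2. *)
Definition fourier f : euclid R n -> R[i] :=
  xget (fun=> 0) [set g | is_fourier f g].

Definition inv_fourier g : euclid R n -> R[i] :=
  xget (fun=> 0) [set f | is_fourier f g].

(* The multipliers live on R^n minus the origin: they are total functions here,
   but their values at 0 are left unconstrained. *)
Definition admissible N (m : 'I_N -> euclid R n -> R[i]) : Prop :=
  (forall k, @cmeasurable _ (euclid R n) R [set~ (0 : 'rV[R]_n)] (m k) /\
     forall (a : R) (w : 'rV[R]_n), 0 < a -> w != 0 -> m k (a *: w) = m k w) /\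
  forall w : 'rV[R]_n, w != 0 -> \sum_(k < N) normc (m k w) ^+ 2 = 1.

Definition multiplier_transform N (m : 'I_N -> euclid R n -> R[i]) f :
    'I_N -> euclid R n -> R[i] :=
  fun k => inv_fourier (fun w => m k w * fourier f w).

End fourier.

(* Main.v *)
Require Import Defs.
From HB Require Import structures.
From mathcomp Require Import all_boot all_order all_algebra finmap.
From mathcomp Require Import all_classical all_reals all_analysis.
From mathcomp Require Import measurable_realfun complex ring lra.

Set Implicit Arguments.
Unset Strict Implicit.
Unset Printing Implicit Defensive.

Import Order.TTheory GRing.Theory Num.Theory.
Import ComplexField.Normc.
Import numFieldNormedType.Exports.

Local Open Scope classical_set_scope.
Local Open Scope ring_scope.

(* Plancherel: damping by the weights exp(-2 pi e |w_i|), whose transform is the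
   Poisson kernel, a positive kernel of mass 1, shows that the Fourier integral
   is an L_2 contraction on L_1 and L_2 (let e tend to 0 and use Fatou).  It
   therefore extends to L_2.  The functions f having a transform g such that
   conj g has transform conj f form a closed subspace; it contains the
   indicators of boxes, hence is all of L_2, so the extension is isometric and
   onto.

   Frames: let F, Phi_k be the transforms of f, phi_k, and let h_n have transform
   conj(m_n) F.  Then <f, psi_kn> = <F, m_n Phi_k> = <h_n, phi_k>, so by the frame
   property of phi the sum over k of <f, psi_kn> psi_kn has transform
   m_n conj(m_n) F, and the coefficients have square sum ||h_n||^2.  Summing over
   n with sum |m_n|^2 = 1 gives F and ||F||^2 = ||f||^2. *)

(** * Complex-valued measurable and integrable functions *)

(** The transform of an integrable function is bounded but need not be integrable, so inversion can
    only be computed by Fubini after damping. The Poisson weights serve because the one-dimensional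
    integrals they produce have elementary antiderivatives (a damped cosine, an arctangent), and
    because weight, kernel and phase all factor over the coordinates. Only an inequality is proved
    directly. The inverse transform is the transform conjugated before and after, so the same
    inequality applied to it gives the reverse one once inversion is known, and inversion is checked
    on boxes alone, where the smoothed box is an explicit product of arctangents. Two obstacles
    shape the rest. [Leb] lives on a completed sigma-algebra, so coordinatewise integrals are
    computed for the Borel measure and transferred, and density passes from boxes to Borel sets and
    then to Lebesgue measurable sets. Elements of L_2 are functions, so the transform is handled as
    a relation stable under equality almost everywhere. *)

Section complex_numbers.
Context {R : realType}.
Implicit Types z w : R[i].
Local Notation Re := complex.Re.
Local Notation Im := complex.Im.

Lemma cReD z w : Re (z + w) = Re z + Re w. Proof. by case: z; case: w. Qed.
Lemma cImD z w : Im (z + w) = Im z + Im w. Proof. by case: z; case: w. Qed.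
Lemma cReN z : Re (- z) = - Re z. Proof. by case: z. Qed.
Lemma cImN z : Im (- z) = - Im z. Proof. by case: z. Qed.
Lemma cReM z w : Re (z * w) = Re z * Re w - Im z * Im w.
Proof. by case: z; case: w. Qed.
Lemma cImM z w : Im (z * w) = Re z * Im w + Im z * Re w.
Proof. by case: z => a b; case: w => c d /=. Qed.
Lemma cReJ z : Re (conjc z) = Re z. Proof. by case: z. Qed.
Lemma cImJ z : Im (conjc z) = - Im z. Proof. by case: z. Qed.
Lemma cJM z w : conjc (z * w) = conjc z * conjc w. Proof. exact: rmorphM. Qed.
Lemma complex_eqP z w : Re z = Re w -> Im z = Im w -> z = w.
Proof. by case: z => a b; case: w => c d /= -> ->. Qed.
Lemma normc_sqrE z : normc z ^+ 2 = Re z ^+ 2 + Im z ^+ 2.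
Proof. by case: z => a b /=; rewrite sqr_sqrtr// addr_ge0 ?sqr_ge0. Qed.
Lemma normc_ge0 z : 0 <= normc z. Proof. by case: z => a b /=; rewrite sqrtr_ge0. Qed.
Lemma normc_conj z : normc (conjc z) = normc z.
Proof. by case: z => a b /=; rewrite sqrrN. Qed.
Lemma normcR (r : R) : normc (Complex r 0) = `|r|.
Proof. by rewrite /= expr0n addr0 sqrtr_sqr. Qed.
Lemma normr_Re_le z : `|Re z| <= normc z.
Proof.
by case: z => a b /=; rewrite -sqrtr_sqr ler_sqrt ?lerDl ?sqr_ge0// addr_ge0 ?sqr_ge0.
Qed.
Lemma normr_Im_le z : `|Im z| <= normc z.
Proof.
by case: z => a b /=; rewrite -sqrtr_sqr ler_sqrt ?lerDr ?sqr_ge0// addr_ge0 ?sqr_ge0.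
Qed.
Lemma normc_le_ReD z : normc z <= `|Re z| + `|Im z|.
Proof.
have h := addr_ge0 (normr_ge0 (Re z)) (normr_ge0 (Im z)).
rewrite -(ler_pXn2r (n:=2)) ?nnegrE ?normc_ge0// normc_sqrE sqrrD !real_normK ?num_real//.
by rewrite -addrA lerD2l lerDr mulrn_wge0// mulr_ge0.
Qed.
Lemma normc_eq0 z : (normc z == 0) = (z == 0).
Proof. by apply/eqP/eqP => [/eq0_normc//|->]; rewrite normc0. Qed.
Lemma normc_distC z w : normc (z - w) = normc (w - z).
Proof. by rewrite -(normcN (z - w)) opprB. Qed.

Lemma expiD (s t : R) : expi (s + t) = expi s * expi t.
Proof. by rewrite /expi cosD sinD; apply: complex_eqP => //=; rewrite addrC. Qed.
Lemma conj_expi (t : R) : conjc (expi t) = expi (- t).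
Proof. by rewrite /expi /= cosN sinN. Qed.
Lemma expi0 : expi (0 : R) = 1.
Proof. by rewrite /expi cos0 sin0. Qed.
Lemma normc_expi (t : R) : normc (expi t) = 1.
Proof. by rewrite /expi/= cos2Dsin2 sqrtr1. Qed.

End complex_numbers.

Section cmeasurable_theory.
Context {d : measure_display} {T : measurableType d} {R : realType}.
Implicit Types (f g : T -> R[i]) (D : set T).
Local Notation Re := complex.Re.
Local Notation Im := complex.Im.

Lemma cmeasurable_cst D (z : R[i]) : cmeasurable D (fun=> z).
Proof. by split; exact: measurable_cst. Qed.

Lemma cmeasurableD D f g : cmeasurable D f -> cmeasurable D g ->
  cmeasurable D (fun x => f x + g x).
Proof.
move=> [a b] [a' b']; split.
  by under eq_fun do rewrite cReD; exact: measurable_funD.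
by under eq_fun do rewrite cImD; exact: measurable_funD.
Qed.

Lemma cmeasurableN D f : cmeasurable D f -> cmeasurable D (fun x => - f x).
Proof.
move=> [a b]; split.
  by under eq_fun do rewrite cReN; exact: measurableT_comp.
by under eq_fun do rewrite cImN; exact: measurableT_comp.
Qed.

Lemma cmeasurableB D f g : cmeasurable D f -> cmeasurable D g ->
  cmeasurable D (fun x => f x - g x).
Proof. by move=> mf mg; apply: cmeasurableD => //; exact: cmeasurableN. Qed.

Lemma cmeasurableJ D f : cmeasurable D f -> cmeasurable D (fun x => conjc (f x)).
Proof.
move=> [a b]; split; first by under eq_fun do rewrite cReJ.
by under eq_fun do rewrite cImJ; exact: measurableT_comp.
Qed.

Lemma cmeasurableM D f g : cmeasurable D f -> cmeasurable D g ->
  cmeasurable D (fun x => f x * g x).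
Proof.
move=> [a b] [a' b']; split.
  by under eq_fun do rewrite cReM; apply: measurable_funB; exact: measurable_funM.
by under eq_fun do rewrite cImM; apply: measurable_funD; exact: measurable_funM.
Qed.

Lemma cmeasurable_real D (f : T -> R) : measurable_fun D f ->
  cmeasurable D (fun x => Complex (f x) 0).
Proof. by move=> mf; split => //=; exact: measurable_cst. Qed.

Lemma cmeasurable_expi (f : T -> R) : measurable_fun setT f ->
  cmeasurable setT (fun x => expi (f x)).
Proof.
move=> mf; split => /=.
  apply: (@measurableT_comp _ _ _ _ _ _ (@cos R)) => //.
  by apply: continuous_measurable_fun; exact: continuous_cos.
apply: (@measurableT_comp _ _ _ _ _ _ (@sin R)) => //.
by apply: continuous_measurable_fun; exact: continuous_sin.
Qed.

Lemma measurable_sqr_normc f : cmeasurable setT f ->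
  measurable_fun setT (fun x => normc (f x) ^+ 2).
Proof.
by move=> [a b]; under eq_fun do rewrite normc_sqrE;
  apply: measurable_funD; exact: measurable_funX.
Qed.

Lemma measurable_normc f : cmeasurable setT f ->
  measurable_fun setT (fun x => normc (f x)).
Proof.
move=> mf.
rewrite (_ : (fun x => _) = (@Num.sqrt R) \o (fun x => normc (f x) ^+ 2)); last first.
  by apply/funext => x /=; rewrite sqrtr_sqr ger0_norm// normc_ge0.
apply: measurableT_comp; last exact: measurable_sqr_normc.
by apply: continuous_measurable_fun; exact: sqrt_continuous.
Qed.

End cmeasurable_theory.

Lemma cmeasurable_comp d1 d2 (T1 : measurableType d1) (T2 : measurableType d2)
    (R : realType) (f : T2 -> R[i]) (h : T1 -> T2) :
  cmeasurable setT f -> measurable_fun setT h -> cmeasurable setT (f \o h).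
Proof.
by move=> [a b] mh; split; [exact: (measurableT_comp a)|exact: (measurableT_comp b)].
Qed.

Section cintegrable_theory.
Context {d : measure_display} {T : measurableType d} {R : realType}.
Variable mu : {measure set T -> \bar R}.
Implicit Types f g : T -> R[i].
Local Notation Re := complex.Re.
Local Notation Im := complex.Im.

Lemma cintegrable_cmeasurable f : cintegrable mu f -> cmeasurable setT f.
Proof. by move=> [/measurable_int/measurable_EFinP ? /measurable_int/measurable_EFinP ?]. Qed.

Lemma le_cintegrable f (g : T -> R) : cmeasurable setT f ->
  mu.-integrable setT (EFin \o g) -> (forall x, normc (f x) <= g x) ->
  cintegrable mu f.
Proof.
move=> [mr mi] ig fg; split; apply: (le_integrable _ _ _ ig) => //;
  [exact/measurable_EFinP| |exact/measurable_EFinP|] => x _ /=;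
  rewrite lee_fin (le_trans _ (ler_norm _))// (le_trans _ (fg x))//.
- exact: normr_Re_le.
- exact: normr_Im_le.
Qed.

Lemma cintegrable_normc f : cintegrable mu f ->
  mu.-integrable setT (EFin \o (fun x => normc (f x))).
Proof.
move=> fi; have mf := cintegrable_cmeasurable fi; case: fi => fr fi.
have := integrableD measurableT (integrable_norm fr) (integrable_norm fi).
apply: le_integrable => //; first exact/measurable_EFinP/measurable_normc.
move=> x _ /=; rewrite lee_fin ger0_norm ?normc_ge0// ger0_norm ?addr_ge0//.
exact: normc_le_ReD.
Qed.

Lemma cintegrableP f : cmeasurable setT f ->
  (\int[mu]_x (normc (f x))%:E < +oo)%E -> cintegrable mu f.
Proof.
move=> mf foo; apply: (@le_cintegrable _ (fun x => normc (f x))) => //.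
apply/integrableP; split; first exact/measurable_EFinP/measurable_normc.
by under eq_integral do rewrite /= ger0_norm ?normc_ge0//.
Qed.

Lemma cintegrableD f g : cintegrable mu f -> cintegrable mu g ->
  cintegrable mu (fun x => f x + g x).
Proof.
move=> [fr fi] [gr gi]; split.
  apply: eq_integrable (integrableD _ fr gr) => // x _.
  by rewrite /= cReD EFinD.
apply: eq_integrable (integrableD _ fi gi) => // x _.
by rewrite /= cImD EFinD.
Qed.

Lemma cintegrableZl (c : R[i]) f : cintegrable mu f ->
  cintegrable mu (fun x => c * f x).
Proof.
move=> fi; apply: (@le_cintegrable _ (fun x => normc c * normc (f x))).
- apply: cmeasurableM; first exact: cmeasurable_cst.
  exact: cintegrable_cmeasurable.
- apply: eq_integrable (integrableZl _ (normc c) (cintegrable_normc fi)) => //.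
- by move=> x; rewrite normcM.
Qed.

Lemma cintegrableJ f : cintegrable mu f -> cintegrable mu (fun x => conjc (f x)).
Proof.
move=> fi; apply: (le_cintegrable _ (cintegrable_normc fi)).
  exact/cmeasurableJ/cintegrable_cmeasurable.
by move=> x; rewrite normc_conj.
Qed.

Lemma cintegralD f g : cintegrable mu f -> cintegrable mu g ->
  cintegral mu (fun x => f x + g x) = cintegral mu f + cintegral mu g.
Proof.
move=> [fr fi] [gr gi]; apply: complex_eqP => /=.
  by rewrite -RintegralD//; apply: eq_Rintegral => x _; rewrite cReD.
by rewrite -RintegralD//; apply: eq_Rintegral => x _; rewrite cImD.
Qed.

Lemma cintegralZl (c : R[i]) f : cintegrable mu f ->
  cintegral mu (fun x => c * f x) = c * cintegral mu f.
Proof.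
move=> [fr fi].
have Z (a : R) (h : T -> R) : mu.-integrable setT (EFin \o h) ->
    mu.-integrable setT (EFin \o (fun x => a * h x)).
  by move=> hi; apply: eq_integrable (integrableZl _ a hi).
apply: complex_eqP.
  rewrite [RHS]cReM /= -!RintegralZl//.
  by rewrite -RintegralB//; [apply: eq_Rintegral => x _; rewrite cReM|exact: Z|exact: Z].
rewrite [RHS]cImM /= -!RintegralZl//.
by rewrite -RintegralD//; [apply: eq_Rintegral => x _; rewrite cImM|exact: Z|exact: Z].
Qed.

Lemma cintegralJ f : cintegrable mu f ->
  cintegral mu (fun x => conjc (f x)) = conjc (cintegral mu f).
Proof.
move=> [fr fi]; apply: complex_eqP => /=.
  by apply: eq_Rintegral => x _; rewrite cReJ.
rewrite -mulN1r -RintegralZl//.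
by apply: eq_Rintegral => x _; rewrite cImJ mulN1r.
Qed.

Lemma eq_cintegral f g : f =1 g -> cintegral mu f = cintegral mu g.
Proof. by move=> /funext ->. Qed.

(** Shaped for the Fourier integral, where [p] is the phase. *)
Lemma cintegralMDl (u v p : T -> R[i]) :
  cintegrable mu (fun x => u x * p x) -> cintegrable mu (fun x => v x * p x) ->
  cintegral mu (fun x => (u x + v x) * p x) =
  cintegral mu (fun x => u x * p x) + cintegral mu (fun x => v x * p x).
Proof. by move=> up vp; rewrite -cintegralD//; apply: eq_cintegral => x; rewrite mulrDl. Qed.

Lemma cintegralMZl (c : R[i]) (u p : T -> R[i]) : cintegrable mu (fun x => u x * p x) ->
  cintegral mu (fun x => c * u x * p x) = c * cintegral mu (fun x => u x * p x).
Proof. by move=> up; rewrite -cintegralZl//; apply: eq_cintegral => x; rewrite mulrA. Qed.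

Lemma Re_cintegral_le f : cintegrable mu f ->
  Re (cintegral mu f) <= \int[mu]_x normc (f x).
Proof.
move=> fi; apply: le_Rintegral => //; first by case: fi.
  exact: cintegrable_normc.
by move=> x _; apply: le_trans (normr_Re_le _); exact: ler_norm.
Qed.

End cintegrable_theory.

(** * The space L_2 *)

Section ereal_cvg0.
Context {R : realType} {I : Type} (F : set_system I) {FF : Filter F}.
Local Open Scope ereal_scope.

(** The norms below are extended reals and may be infinite at first. This turns their convergence to
    0 into an epsilon statement, along sequences and along the directed set of finite sets alike. *)
Lemma cvge0P (u : I -> \bar R) : (forall i, 0 <= u i) ->
  (u @ F --> 0) <-> (forall e : R, (0 < e)%R -> \forall i \near F, u i < e%:E).
Proof.
move=> u0; split=> [/fine_cvgP[ufin /cvgr0Pnorm_lt uc] e e0|h].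
  have := uc _ e0; apply: filterS2 ufin => i ui; rewrite /= ger0_norm ?fine_ge0//.
  by rewrite -lte_fin fineK.
apply/fine_cvgP; split.
  by apply: filterS (h _ ltr01) => i ui; rewrite ge0_fin_numE// (lt_trans ui) ?ltry.
apply/cvgr0Pnorm_lt => e e0; apply: filterS (h _ e0) => i ui /=.
rewrite ger0_norm ?fine_ge0// -lte_fin fineK// ge0_fin_numE//.
by rewrite (lt_trans ui) ?ltry.
Qed.

Lemma cvge0_le (u v : I -> \bar R) : (forall i, 0 <= u i) ->
  (forall i, u i <= v i) -> v @ F --> 0 -> u @ F --> 0.
Proof.
move=> u0 uv v0; apply: (squeeze_cvge _ _ v0); last exact: cvg_cst.
by apply: filterE => i; rewrite u0 uv.
Qed.

End ereal_cvg0.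

Section L2norm_theory.
Context {d : measure_display} {T : measurableType d} {R : realType}.
Variable mu : {measure set T -> \bar R}.
Implicit Types f g h : T -> R[i].
Local Open Scope ereal_scope.

(** The squared norm as a bare integral, so that Fatou, Tonelli and dominated convergence apply with
    no square root in the way. *)
Definition sqn f : \bar R := \int[mu]_x ((normc (f x)) ^+ 2)%:E.

Lemma sqn_ge0 f : 0 <= sqn f.
Proof. by apply: integral_ge0 => x _; rewrite lee_fin sqr_ge0. Qed.

Lemma L2normE f : L2norm mu f = sqrte (sqn f).
Proof.
rewrite /L2norm unlock poweR12_sqrt; last first.
  by apply: integral_ge0 => x _; exact: poweR_ge0.
congr sqrte; apply: eq_integral => x _ /=.
by rewrite powR_mulrn// ger0_norm ?normc_ge0.
Qed.

Lemma L2norm_ge0 f : 0 <= L2norm mu f.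
Proof. by rewrite L2normE sqrte_ge0. Qed.

Lemma L2norm_sqr f : L2norm mu f ^+ 2 = sqn f.
Proof. by rewrite L2normE sqr_sqrte ?sqn_ge0. Qed.

Lemma L2norm_lty f : (L2norm mu f < +oo) = (sqn f < +oo).
Proof.
by rewrite -!ge0_fin_numE ?L2norm_ge0 ?sqn_ge0// L2normE sqrte_fin_num ?sqn_ge0.
Qed.

Lemma L2norm_lt f (e : R) : (0 < e)%R ->
  (L2norm mu f < e%:E) = (sqn f < (e ^+ 2)%:E).
Proof.
move=> e0; rewrite !ltNge; congr negb.
rewrite L2normE -[RHS]lee_sqrt ?sqn_ge0//.
by rewrite EFin_expe sqrte_sqr gee0_abs// lee_fin ltW.
Qed.

Lemma L2norm_le f g : (L2norm mu f <= L2norm mu g) = (sqn f <= sqn g).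
Proof. by rewrite !L2normE lee_sqrt ?sqn_ge0. Qed.

Lemma L2norm_cvg0P I (F : set_system I) {FF : Filter F} (u : I -> T -> R[i]) :
  ((fun i => L2norm mu (u i)) @ F --> 0) <-> ((fun i => sqn (u i)) @ F --> 0).
Proof.
rewrite !cvge0P; [|by move=> ?; exact: sqn_ge0|by move=> ?; exact: L2norm_ge0].
split=> h e e0.
  have := h (Num.sqrt e); rewrite sqrtr_gt0 => /(_ e0); apply: filterS => i.
  by rewrite L2norm_lt ?sqrtr_gt0// sqr_sqrtr// ltW.
by have := h (e ^+ 2)%R (exprn_gt0 _ e0); apply: filterS => i; rewrite L2norm_lt.
Qed.

Lemma L2P f : L2 mu f <-> cmeasurable setT f /\ sqn f < +oo.
Proof. by rewrite /L2 L2norm_lty. Qed.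

Lemma sqnP f : L2 mu f -> mu.-integrable setT (EFin \o (fun x => normc (f x) ^+ 2))%R.
Proof.
move=> /L2P[mf foo]; apply/integrableP; split.
  exact/measurable_EFinP/measurable_sqr_normc.
by under eq_integral do rewrite /= ger0_norm ?sqr_ge0//.
Qed.

Lemma L2_cmeasurable f : L2 mu f -> cmeasurable setT f.
Proof. by case. Qed.

Lemma le_sqn f g : cmeasurable setT f -> cmeasurable setT g ->
  (forall x, normc (f x) <= normc (g x))%R -> sqn f <= sqn g.
Proof.
move=> mf mg fg; apply: ge0_le_integral => //.
- by move=> x _; rewrite lee_fin sqr_ge0.
- exact/measurable_EFinP/measurable_sqr_normc.
- exact/measurable_EFinP/measurable_sqr_normc.
by move=> x _; rewrite lee_fin lerXn2r ?nnegrE ?normc_ge0.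
Qed.

Lemma le_L2 f g : cmeasurable setT f -> L2 mu g ->
  (forall x, normc (f x) <= normc (g x))%R -> L2 mu f.
Proof.
move=> mf /L2P[mg goo] fg; apply/L2P; split=> //.
by apply: le_lt_trans goo; exact: le_sqn.
Qed.

Lemma eq_sqn f g : (forall x, normc (f x) = normc (g x)) -> sqn f = sqn g.
Proof. by move=> fg; apply: eq_integral => x _; rewrite fg. Qed.

Lemma sqnJ f : sqn (fun x => conjc (f x)) = sqn f.
Proof. by apply: eq_sqn => x; rewrite normc_conj. Qed.

Lemma sqnN f : sqn (fun x => - f x)%R = sqn f.
Proof. by apply: eq_sqn => x; rewrite normcN. Qed.

Lemma sqnB f g : sqn (fun x => f x - g x)%R = sqn (fun x => g x - f x)%R.
Proof. by apply: eq_sqn => x; rewrite normc_distC. Qed.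

Lemma sqnZl (c : R[i]) f : cmeasurable setT f ->
  sqn (fun x => c * f x)%R = (normc c ^+ 2)%:E * sqn f.
Proof.
move=> mf; rewrite /sqn -ge0_integralZl//.
- by apply: eq_integral => x _; rewrite normcM exprMn EFinM.
- exact/measurable_EFinP/measurable_sqr_normc.
- by move=> x _; rewrite lee_fin sqr_ge0.
- by rewrite lee_fin sqr_ge0.
Qed.

Lemma L2J f : L2 mu f -> L2 mu (fun x => conjc (f x)).
Proof. by move=> /L2P[mf ?]; apply/L2P; rewrite sqnJ; split=> //; exact: cmeasurableJ. Qed.

Lemma L2Zl (c : R[i]) f : L2 mu f -> L2 mu (fun x => c * f x)%R.
Proof.
move=> /L2P[mf foo]; apply/L2P; split.
  by apply: cmeasurableM => //; exact: cmeasurable_cst.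
by rewrite sqnZl// lte_mul_pinfty// lee_fin sqr_ge0.
Qed.

Lemma L2_0 : L2 mu (fun=> 0)%R.
Proof.
apply/L2P; split; first exact: cmeasurable_cst.
rewrite /sqn; under eq_integral do rewrite normc0 expr0n /=.
by rewrite integral0.
Qed.

Lemma L2norm_D f g : cmeasurable setT f -> cmeasurable setT g ->
  L2norm mu (fun x => f x + g x)%R <= L2norm mu f + L2norm mu g.
Proof.
move=> mf mg.
have mf' := measurable_normc mf; have mg' := measurable_normc mg.
apply: le_trans (minkowski_EFin mu mf' mg' _); last by rewrite ler1n.
(* Minkowski is applied to the real functions given by the moduli; their sum, seen as a complex
   function, dominates the modulus of [f + g]. *)
pose h x := Complex (normc (f x) + normc (g x))%R 0%R.
rewrite (_ : Lnorm _ _ _ = L2norm mu h).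
  rewrite L2norm_le; apply: le_sqn.
  - exact: cmeasurableD.
  - by apply: cmeasurable_real; exact: measurable_funD.
  - move=> x; rewrite normcR ger0_norm ?addr_ge0 ?normc_ge0//.
    exact: le_normcD.
rewrite /L2norm -[in RHS]Lnorm_abse -[LHS]Lnorm_abse; congr Lnorm.
apply/funext => x.
by rewrite /= expr0n addr0 sqrtr_sqr normr_id.
Qed.

Lemma L2norm_B f g : L2norm mu (fun x => f x - g x)%R = L2norm mu (fun x => g x - f x)%R.
Proof. by rewrite !L2normE sqnB. Qed.

Lemma L2norm_triangle f g h : cmeasurable setT f -> cmeasurable setT g ->
  cmeasurable setT h -> L2norm mu (fun x => f x - h x)%R <=
  L2norm mu (fun x => f x - g x)%R + L2norm mu (fun x => g x - h x)%R.
Proof.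
move=> mf mg mh.
rewrite (_ : (fun x => f x - h x)%R = (fun x => (f x - g x) + (g x - h x))%R); last first.
  by apply/funext => x; rewrite addrA subrK.
by apply: L2norm_D; exact: cmeasurableB.
Qed.

Lemma L2D f g : L2 mu f -> L2 mu g -> L2 mu (fun x => f x + g x)%R.
Proof.
move=> [mf foo] [mg goo]; split; first exact: cmeasurableD.
by apply: le_lt_trans (L2norm_D mf mg) _; rewrite lte_add_pinfty.
Qed.

Lemma L2N f : L2 mu f -> L2 mu (fun x => - f x)%R.
Proof. by move=> /L2P[mf foo]; apply/L2P; rewrite sqnN; split=> //; exact: cmeasurableN. Qed.

Lemma L2B f g : L2 mu f -> L2 mu g -> L2 mu (fun x => f x - g x)%R.
Proof. by move=> fL gL; apply: L2D => //; exact: L2N. Qed.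

Lemma L2_sum (I : Type) (s : seq I) (u : I -> T -> R[i]) :
  (forall i, L2 mu (u i)) -> L2 mu (fun x => \sum_(i <- s) u i x)%R.
Proof.
move=> mu'; elim: s => [|i s ih].
  by rewrite (_ : (fun _ => _) = (fun=> 0%R)) ?funeqE; [exact: L2_0|move=> x; rewrite big_nil].
rewrite (_ : (fun _ => _) = (fun x => u i x + \sum_(i <- s) u i x)%R); first exact: L2D.
by apply/funext => x; rewrite big_cons.
Qed.

Lemma sqn_eq0 f : cmeasurable setT f -> sqn f = 0 -> {ae mu, forall x, f x = 0%R}.
Proof.
move=> mf f0.
have mf2 : measurable_fun setT (fun x => (normc (f x) ^+ 2)%:E).
  exact/measurable_EFinP/measurable_sqr_normc.
have : \int[mu]_x `|(normc (f x) ^+ 2)%:E| = 0.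
  by rewrite -[RHS]f0; apply: eq_integral => x _; rewrite gee0_abs// lee_fin sqr_ge0.
move=> /(ae_eq_integral_abs mu measurableT mf2); apply: filterS => x /(_ I) /= [].
by move=> /eqP; rewrite sqrf_eq0 normc_eq0 => /eqP.
Qed.

Lemma ae_eq_sqn f g : cmeasurable setT f -> cmeasurable setT g ->
  {ae mu, forall x, f x = g x} -> sqn f = sqn g.
Proof.
move=> mf mg fg; apply: ae_eq_integral => //.
- exact/measurable_EFinP/measurable_sqr_normc.
- exact/measurable_EFinP/measurable_sqr_normc.
by apply: filterS fg => x /= -> _.
Qed.

Lemma ae_sqn_eq0 f : cmeasurable setT f -> {ae mu, forall x, f x = 0%R} -> sqn f = 0.
Proof.
move=> mf f0; rewrite (ae_eq_sqn mf (cmeasurable_cst setT 0%R) f0).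
by rewrite /sqn; under eq_integral do rewrite normc0 expr0n /=; rewrite integral0.
Qed.

Lemma ae_eq_L2 f g : L2 mu f -> cmeasurable setT g ->
  {ae mu, forall x, f x = g x} -> L2 mu g.
Proof.
move=> /L2P[mf foo] mg fg; apply/L2P; split=> //.
by rewrite -(ae_eq_sqn mf mg fg).
Qed.

End L2norm_theory.

Section inner_theory.
Context {d : measure_display} {T : measurableType d} {R : realType}.
Variable mu : {measure set T -> \bar R}.
Implicit Types f g : T -> R[i].
Local Notation Re := complex.Re.
Local Notation Im := complex.Im.

Lemma L2_cintegrable_mul f g : L2 mu f -> L2 mu g ->
  cintegrable mu (fun x => f x * conjc (g x)).
Proof.
move=> fL gL.
apply: (@le_cintegrable _ _ _ _ _ (fun x => normc (f x) ^+ 2 + normc (g x) ^+ 2)).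
- by apply: cmeasurableM; [case: fL|apply: cmeasurableJ; case: gL].
- exact: (integrableD _ (sqnP fL) (sqnP gL)).
- move=> x; rewrite normcM normc_conj.
  have := sqr_ge0 (normc (f x) - normc (g x)).
  by have := sqr_ge0 (normc (f x) + normc (g x)); lra.
Qed.

Lemma sqn_fine f : L2 mu f -> fine (sqn mu f) = \int[mu]_x (normc (f x) ^+ 2).
Proof. by []. Qed.

Lemma fine_sqnD f g : L2 mu f -> L2 mu g ->
  fine (sqn mu (fun x => f x + g x)) =
  fine (sqn mu f) + fine (sqn mu g) + 2 * Re (inner mu f g).
Proof.
move=> fL gL; rewrite !sqn_fine//; last exact: L2D.
have [ri _] := L2_cintegrable_mul fL gL.
rewrite -RintegralD//; [|exact: sqnP|exact: sqnP].
rewrite /inner /= -RintegralZl// -RintegralD//.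
- apply: eq_Rintegral => x _; rewrite !normc_sqrE cReM cReJ cImJ cReD cImD; ring.
- exact: (integrableD _ (sqnP fL) (sqnP gL)).
- exact: (integrableZl measurableT 2 ri).
Qed.

Lemma inner_conj_linear (c : R[i]) f g : L2 mu f -> L2 mu g ->
  inner mu f (fun x => c * g x) = conjc c * inner mu f g.
Proof.
move=> fL gL; rewrite /inner -cintegralZl; last exact: L2_cintegrable_mul.
by apply: eq_cintegral => x; rewrite rmorphM mulrCA.
Qed.

(** Expanding the squared norm of [f + c * g] leaves the real part of [conjc c * inner mu f g] as
    the only unknown; [c = 1] gives the real part of the inner product and [c = i] the imaginary
    part. The two pairs are a pair and its image under an isometry. *)
Lemma polarization f g f' g' : L2 mu f -> L2 mu g -> L2 mu f' -> L2 mu g' ->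
  sqn mu f = sqn mu f' -> sqn mu g = sqn mu g' ->
  (forall c, sqn mu (fun x => f x + c * g x) = sqn mu (fun x => f' x + c * g' x)) ->
  inner mu f g = inner mu f' g'.
Proof.
move=> fL gL fL' gL' ff gg h.
have key (c : R[i]) : Re (conjc c * inner mu f g) = Re (conjc c * inner mu f' g').
  have := congr1 fine (h c); rewrite fine_sqnD// ?fine_sqnD//; [|exact: L2Zl|exact: L2Zl].
  rewrite !inner_conj_linear// ff !sqnZl ?gg; [|by case: gL'|by case: gL].
  by move=> e; lra.
apply: complex_eqP.
  by have := key 1; rewrite conjc1 !mul1r.
have := key (Complex 0 1).
by rewrite !cReM /= !mul0r !sub0r !mulN1r !opprK.
Qed.

End inner_theory.

Section L2_convergence.
Context {d : measure_display} {T : measurableType d} {R : realType}.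
Variable mu : {measure set T -> \bar R}.
Implicit Types f g : T -> R[i].

Lemma L2cvgP (u : nat -> T -> R[i]) f :
  L2cvg mu u f <-> (fun j => sqn mu (fun x => u j x - f x)) @ \oo --> 0%E.
Proof. exact: L2norm_cvg0P. Qed.

Lemma L2_dominated_cvg (u : nat -> T -> R[i]) f g :
  (forall j, cmeasurable setT (u j)) -> cmeasurable setT f -> L2 mu g ->
  (forall j x, normc (u j x) <= normc (g x)) ->
  (forall x, normc (f x) <= normc (g x)) ->
  {ae mu, forall x, normc (u j x - f x) @[j --> \oo] --> (0 : R)} ->
  L2cvg mu u f.
Proof.
move=> mu' mf gL ug fg uf; apply/L2cvgP.
have mD j : measurable_fun setT (fun x => (normc (u j x - f x) ^+ 2)%:E).
  exact/measurable_EFinP/measurable_sqr_normc/cmeasurableB.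
(* The factor 4 comes from squaring [|u - f| <= 2 |g|]. *)
have ig := integrableZl measurableT 4 (sqnP gL).
have h1 : {ae mu, forall x, setT x ->
    (normc (u j x - f x) ^+ 2)%:E @[j --> \oo] --> (cst 0%E x : \bar R)}.
  apply: filterS uf => x ux _ /=.
  apply: cvg_EFin; first by near=> j.
  by have h0 := cvgM ux ux; rewrite mulr0 in h0; exact: h0.
have h2 : {ae mu, forall x n, setT x -> (`|(normc (u n x - f x) ^+ 2)%:E| <=
    4 * (EFin \o (fun x0 : T => (normc (g x0) ^+ 2)%R)) x)%E}.
  apply: filterE => x j _ /=.
  rewrite lee_fin ger0_norm ?sqr_ge0//.
  rewrite (_ : 4 * _ = (2 * normc (g x)) ^+ 2); last by ring.
  rewrite lerXn2r ?nnegrE ?normc_ge0 ?mulr_ge0 ?normc_ge0//.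
  by rewrite (le_trans (le_normcD _ _))// normcN mulr2n mulrDl mul1r lerD.
have [_ _] := dominated_convergence measurableT mD (measurable_cst (0%E : \bar R))
  h1 ig h2.
by rewrite integral0.
Unshelve. all: by end_near. Qed.

End L2_convergence.

(** The telescoping series of [r] is dominated by a geometric one. *)
Lemma cvg_geometric_step {R : realType} (C : R) (r : nat -> R) :
  (forall k, `|r k.+1 - r k| <= C / 2 ^+ k) -> cvgn r.
Proof.
move=> h.
have C0 : 0 <= C by have := le_trans (normr_ge0 _) (h 0%N); rewrite expr0 divr1.
have : cvgn [normed series (telescope r)].
  apply: (series_le_cvg (v_ := geometric C (2^-1))).
  - by move=> n /=.
  - by move=> n; apply: geometric_ge0; rewrite // invr_ge0.
  - by move=> n /=; rewrite exprVn; exact: h.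
  - by apply: is_cvg_geometric_series; rewrite ger0_norm ?invr_ge0// invf_lt1// ltr1n.
move=> /normed_cvg; rewrite telescopeK => c.
move/cvg_ex : c => [l hl]; apply/cvg_ex; exists (l + r 0%N).
rewrite [X in X @ _](_ : r = (fun n => (r n - r 0%N) + r 0%N)); last first.
  by apply/funext => n; rewrite subrK.
by apply: cvgD => //; exact: cvg_cst.
Qed.

Section fatou_cvg.
Context {d : measure_display} {T : measurableType d} {R : realType}.
Variable mu : {measure set T -> \bar R}.
Local Open Scope ereal_scope.

(** Fatou in the form used below: the limit holds almost everywhere and the integrals are bounded
    only eventually. [g] is replaced by the lower limit of [h], with which it agrees almost
    everywhere. *)
Lemma fatou_cvg (h : nat -> T -> \bar R) (g : T -> \bar R) (c : \bar R) :
  (forall k, measurable_fun setT (h k)) -> measurable_fun setT g ->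
  (forall k x, 0 <= h k x) -> (forall x, 0 <= g x) ->
  {ae mu, forall x, h k x @[k --> \oo] --> g x} ->
  (\forall k \near \oo, \int[mu]_x h k x <= c) -> \int[mu]_x g x <= c.
Proof.
move=> mh mg h0 g0 hg hc.
have mli : measurable_fun setT (fun x => limn_einf (h^~ x)).
  (* The lower limit is minus the upper limit of the opposites. *)
  apply: (measurableT_comp (f := -%E)) => //.
  apply: (@measurable_fun_limn_esup _ _ _ _ (fun k => \- (h k))) => k.
  exact: measurableT_comp.
have li0 x : 0 <= limn_einf (h^~ x).
  rewrite limn_einf_lim; apply: lime_ge; first exact: is_cvg_einfs.
  by apply: nearW => k; apply: le_ereal_inf_tmp => _ [p /= pk] <-.
rewrite (_ : \int[mu]_x g x = \int[mu]_x limn_einf (h^~ x)); last first.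
  apply: ge0_ae_eq_integral => //; apply: filterS hg => x hx _.
  by rewrite (cvg_limn_einf_sup hx).
apply: (le_trans (fatou _ measurableT mh _)) => //.
rewrite limn_einf_lim; apply: lime_le; first exact: is_cvg_einfs.
apply: filterS hc => k; apply: le_trans.
by apply: ereal_inf_lbound; exists k => /=.
Qed.

End fatou_cvg.

Section L2_complete.
Context {d : measure_display} {T : measurableType d} {R : realType}.
Variable mu : {measure set T -> \bar R}.
Implicit Types f g : T -> R[i].

(** The series [S] with terms [4^k |v_{k+1} - v_k|^2] has integral at most 1, hence is finite almost
    everywhere. Where it is finite, the k-th increment is at most [sqrt S / 2^k], and the values
    converge geometrically. *)
Lemma L2_fast_cauchy (v : nat -> T -> R[i]) :
  (forall k, cmeasurable setT (v k)) ->
  (forall k, (sqn mu (fun x => v k.+1 x - v k x)%R <=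
     ((4 ^+ k)^-1 / 2 ^+ k.+1)%:E)%E) ->
  exists f, cmeasurable setT f /\
    {ae mu, forall x, normc (v k x - f x) @[k --> \oo] --> (0 : R)}.
Proof.
move=> mv hv.
pose s (k : nat) (x : T) : \bar R := (4 ^+ k * normc (v k.+1 x - v k x) ^+ 2)%R%:E.
have s0 k x : (0 <= s k x)%E by rewrite lee_fin mulr_ge0 ?sqr_ge0 ?exprn_ge0.
have ms k : measurable_fun setT (s k).
  apply/measurable_EFinP; apply: measurable_funM => //.
  exact/measurable_sqr_normc/cmeasurableB.
pose S x := (\sum_(k <oo) s k x)%E.
have mS : measurable_fun setT S by apply: ge0_emeasurable_sum.
have S0 x : (0 <= S x)%E by apply: nneseries_ge0.
have Soo : (\int[mu]_x S x < +oo)%E.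
  rewrite /S integral_nneseries//.
  apply: (@le_lt_trans _ _ (\sum_(k <oo) (1 / (2 ^ (k + 1))%:R)%:E)%E).
    apply: lee_nneseries; first by move=> *; apply: integral_ge0.
    move=> k _; rewrite /s; under eq_integral do rewrite EFinM.
    rewrite ge0_integralZl//; last 2 first.
    - exact/measurable_EFinP/measurable_sqr_normc/cmeasurableB.
    - by move=> x _; rewrite lee_fin sqr_ge0.
    apply: (le_trans (lee_wpmul2l _ (hv k))); first by rewrite lee_fin exprn_ge0.
    rewrite -EFinM lee_fin mulrA divff ?expf_neq0 ?pnatr_eq0//.
    by rewrite natrX addn1.
  by rewrite (cvg_lim _ (@cvg_geometric_eseries_half _ 1 0))// ltry.
pose E := [set x | (S x < +oo)%E].
have mE : measurable E by rewrite -[E]setTI; exact: emeasurable_fun_infty_o.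
have aeE : {ae mu, forall x, E x}.
  have iS : mu.-integrable setT S.
    by apply/integrableP; split => //; under eq_integral do rewrite gee0_abs//.
  apply: filterS (integrable_ae measurableT iS) => x /(_ I).
  by rewrite ge0_fin_numE.
have step x : E x -> exists C, forall k, normc (v k.+1 x - v k x) <= C / 2 ^+ k.
  move=> Ex; exists (Num.sqrt (fine (S x))) => k.
  have : (s k x <= S x)%E.
    apply: le_trans (nneseries_lim_ge k.+1 (m := 0) (P := xpredT) _); last by [].
    by rewrite big_nat_recr//= leeDr// sume_ge0.
  rewrite -{1}(@fineK _ (S x)) ?ge0_fin_numE// lee_fin => h.
  rewrite ler_pdivlMr ?exprn_gt0//.
  rewrite -(@ler_pXn2r _ 2) ?nnegrE ?mulr_ge0 ?normc_ge0 ?sqrtr_ge0 ?exprn_ge0//.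
  rewrite sqr_sqrtr ?fine_ge0// exprMn -exprM mulnC exprM mulrC.
  by rewrite (_ : 2 ^+ 2 = 4 :> R)// -natrX.
have cR (p : R[i] -> R) x : E x -> (forall z w, p (z - w) = p z - p w) ->
    (forall z, `|p z| <= normc z) -> cvgn (fun k => p (v k x)).
  move=> Ex pB pn; have [C hC] := step x Ex; apply: (@cvg_geometric_step _ C) => k.
  by rewrite -pB (le_trans (pn _)).
(* Cutting off by the indicator of [E] makes the limit exist at every point, which gives its
   measurability. *)
pose lm (p : R[i] -> R) x := limn (fun k => \1_E x * p (v k x)).
have lmP (p : R[i] -> R) : (forall z w, p (z - w) = p z - p w) ->
    (forall z, `|p z| <= normc z) ->
    forall x, (fun k => \1_E x * p (v k x)) @ \oo --> lm p x.
  move=> pB pn x; rewrite /lm; have [Ex|nEx] := pselect (E x).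
    by apply: is_cvgM; [exact: is_cvg_cst|exact: cR].
  by rewrite indicE memNset//; under eq_fun do rewrite mul0r; exact: is_cvg_cst.
have ReB z w : complex.Re (z - w) = complex.Re z - complex.Re w :> R.
  by rewrite cReD cReN.
have ImB z w : complex.Im (z - w) = complex.Im z - complex.Im w :> R.
  by rewrite cImD cImN.
exists (fun x => Complex (lm (@complex.Re R) x) (lm (@complex.Im R) x)); split.
  split=> /=.
    apply: (@measurable_fun_cvg _ _ _ _ (fun k x => \1_E x * complex.Re (v k x))).
      by move=> k; apply: measurable_funM => //; case: (mv k).
    by move=> x _; apply: lmP => // z; exact: normr_Re_le.
  apply: (@measurable_fun_cvg _ _ _ _ (fun k x => \1_E x * complex.Im (v k x))).
    by move=> k; apply: measurable_funM => //; case: (mv k).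
  by move=> x _; apply: lmP => // z; exact: normr_Im_le.
apply: filterS aeE => x Ex.
have c0 (p : R[i] -> R) : (forall z w, p (z - w) = p z - p w) ->
    (forall z, `|p z| <= normc z) ->
    `|p (v k x) - lm p x| @[k --> \oo] --> (0 : R).
  move=> pB pn; have := lmP p pB pn x.
  rewrite indicE mem_set//; under eq_fun do rewrite mul1r.
  move=> h; rewrite -(@normr0 R R); apply: cvg_norm.
  by rewrite -(subrr (lm p x)); apply: cvgB => //; exact: cvg_cst.
have a := c0 _ ReB (@normr_Re_le R); have b := c0 _ ImB (@normr_Im_le R).
have ab := cvgD a b; rewrite addr0 in ab.
apply: (squeeze_cvgr (f := fun=> 0) _ _ (ab _)); last exact: cvg_cst.
apply: nearW => k; rewrite normc_ge0 /=.
by rewrite (le_trans (normc_le_ReD _))// ReB ImB.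
Qed.

Lemma L2_complete (u : nat -> T -> R[i]) : (forall j, L2 mu (u j)) ->
  (forall e : R, 0 < e -> exists N, forall i j, (N <= i)%N -> (N <= j)%N ->
     (L2norm mu (fun x => u i x - u j x)%R < e%:E)%E) ->
  exists f, L2 mu f /\ L2cvg mu u f.
Proof.
move=> uL uc.
(* The tolerance whose square is the bound required by [L2_fast_cauchy]. *)
pose e k : R := Num.sqrt ((4 ^+ k)^-1 / 2 ^+ k.+1).
have e0 k : 0 < e k by rewrite sqrtr_gt0 divr_gt0 ?invr_gt0 ?exprn_gt0.
have [N hN] := choice (fun k => uc (e k) (e0 k)).
(* An index past every [N i] with [i <= k], so that both [n k] and [n k.+1] lie beyond [N k]; the
   summand [k] makes [n] tend to infinity. *)
pose n k := (k + \max_(i < k.+1) N i)%N.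
have nN k : (N k <= n k)%N.
  apply: leq_trans (leq_addl _ _).
  exact: (leq_bigmax (F := fun i : 'I_k.+1 => N i) ord_max).
have nN1 k : (N k <= n k.+1)%N.
  apply: leq_trans (leq_addl _ _).
  have := leq_bigmax (F := fun i : 'I_k.+2 => N i) (inord k).
  by rewrite inordK.
have [|k|f [mf vf]] := @L2_fast_cauchy (fun k => u (n k)).
- by move=> k; case: (uL (n k)).
- have := hN k _ _ (nN1 k) (nN k); rewrite L2norm_lt// sqr_sqrtr => [/ltW//|].
  by rewrite divr_ge0 ?invr_ge0 ?exprn_ge0.
(* Fatou along the subsequence carries the Cauchy bound over to the limit, for the terms of the
   original sequence. *)
have key (a : R) M j : 0 < a -> (forall i, (M <= i)%N ->
    (L2norm mu (fun x => u j x - u i x)%R < a%:E)%E) ->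
    (sqn mu (fun x => u j x - f x)%R <= (a ^+ 2)%:E)%E.
  move=> a0 hM.
  apply: (@fatou_cvg _ _ _ mu (fun k x => (normc (u j x - u (n k) x) ^+ 2)%R%:E)).
  - move=> k; apply/measurable_EFinP/measurable_sqr_normc/cmeasurableB.
      by case: (uL j).
    by case: (uL (n k)).
  - apply/measurable_EFinP/measurable_sqr_normc/cmeasurableB => //.
    by case: (uL j).
  - by move=> k x; rewrite lee_fin sqr_ge0.
  - by move=> x; rewrite lee_fin sqr_ge0.
  - apply: filterS vf => x vx; apply: cvg_EFin; first by apply: nearW.
    have nc : normc (u j x - u (n k) x) @[k --> \oo] --> normc (u j x - f x).
      apply/cvgrPdist_le => eps eps0; move/cvgr0Pnorm_le : vx => /(_ _ eps0).
      apply: filterS => k; rewrite ger0_norm ?normc_ge0// => h.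
      have h1 : normc (u j x - f x) <= normc (u j x - u (n k) x) + normc (u (n k) x - f x).
        by rewrite -{1}(subrK (u (n k) x) (u j x)) -addrA le_normcD.
      have h2 : normc (u j x - u (n k) x) <= normc (u j x - f x) + normc (u (n k) x - f x).
        by rewrite -{1}(subrK (f x) (u j x)) -addrA (normc_distC (u (n k) x)) le_normcD.
      by rewrite ler_norml; apply/andP; split; lra.
    have := cvgM nc nc; apply.
  - exists M => // k /= Mk; rewrite ltW// -L2norm_lt//.
    by apply: hM; rewrite (leq_trans Mk)// leq_addr.
have fcvg : L2cvg mu u f.
  apply/L2cvgP/cvge0P; first by move=> j; exact: sqn_ge0.
  move=> a a0; pose b : R := Num.sqrt (a / 2).
  have b0 : 0 < b by rewrite sqrtr_gt0 divr_gt0.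
  have [M hM] := uc b b0; exists M => // j /= Mj.
  apply: (@le_lt_trans _ _ (b ^+ 2)%:E).
    by apply: (key _ M) => // i Mi; exact: hM.
  by rewrite lte_fin sqr_sqrtr ?divr_ge0 ?ltW//; lra.
have [M hM] := uc 1 ltr01.
have fM : L2 mu (fun x => u M x - f x).
  apply/L2P; split; first by apply: cmeasurableB => //; case: (uL M).
  by apply: (le_lt_trans (key 1 M _ _ _)); rewrite ?ltr01 ?ltry// => i Mi; exact: hM.
exists f; split => //.
rewrite (_ : f = (fun x => u M x - (u M x - f x))); first exact: L2B.
by apply/funext => x; rewrite opprB addrC subrK.
Qed.

End L2_complete.

(** * Fubini for complex-valued functions *)

Section complex_fubini.
Context {d1 d2 : measure_display} {T1 : measurableType d1} {T2 : measurableType d2}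
  {R : realType}.
Variables (m1 : {sigma_finite_measure set T1 -> \bar R})
  (m2 : {sigma_finite_measure set T2 -> \bar R}).
Local Notation Re := complex.Re.
Local Notation Im := complex.Im.

Lemma measurable_Rintegral_section (f : T1 * T2 -> R) :
  measurable_fun setT f ->
  measurable_fun setT (fun x => \int[m2]_y f (x, y)).
Proof.
move=> mf; apply: (measurableT_comp (f := fine)) => //.
have mf' : measurable_fun setT (EFin \o f) by exact/measurable_EFinP.
rewrite (_ : (fun x => _) = (fun x => \int[m2]_y (EFin \o f)^\+ (x, y)
    - \int[m2]_y (EFin \o f)^\- (x, y))%E); last first.
  by apply/funext => x; rewrite [LHS]integralE !unlock.
apply: emeasurable_funB.
  by apply: measurable_fun_fubini_tonelli_F => //; exact: measurable_funepos.
by apply: measurable_fun_fubini_tonelli_F => //; exact: measurable_funeneg.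
Qed.

Lemma cmeasurable_cintegral_section (F : T1 * T2 -> R[i]) : cmeasurable setT F ->
  cmeasurable setT (fun x => cintegral m2 (fun y => F (x, y))).
Proof.
move=> [mr mi]; split; first exact: (measurable_Rintegral_section mr).
exact: (measurable_Rintegral_section mi).
Qed.

Lemma integral_fine_section (f : T1 * T2 -> R) :
  (forall x, m2.-integrable setT (fun y => (f (x, y))%:E)) ->
  (\int[m1]_x (\int[m2]_y f (x, y))%R%:E = \int[m1]_x \int[m2]_y (f (x, y))%:E)%E.
Proof.
by move=> fi; apply: eq_integral => x _; rewrite fineK//; exact: integrable_fin_num.
Qed.

(** [cintegral] takes finite parts of extended integrals, which loses nothing when the sections are
    integrable; hence the hypothesis at every [x]. *)
Lemma cFubini_prod (F : T1 * T2 -> R[i]) :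
  cintegrable (m1 \x m2)%E F ->
  (forall x, cintegrable m2 (fun y => F (x, y))) ->
  cintegral m1 (fun x => cintegral m2 (fun y => F (x, y))) =
  cintegral (m1 \x m2)%E F.
Proof.
move=> [fr fi] si; apply: complex_eqP => /=; congr fine.
  rewrite (@integral_fine_section (fun p => Re (F p))); last by move=> x; case: (si x).
  exact: (integral12_prod_meas1 fr).
rewrite (@integral_fine_section (fun p => Im (F p))); last by move=> x; case: (si x).
exact: (integral12_prod_meas1 fi).
Qed.

Lemma cFubini (F : T1 * T2 -> R[i]) :
  cintegrable (m1 \x m2)%E F ->
  (forall x, cintegrable m2 (fun y => F (x, y))) ->
  (forall y, cintegrable m1 (fun x => F (x, y))) ->
  cintegral m1 (fun x => cintegral m2 (fun y => F (x, y))) =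
  cintegral m2 (fun y => cintegral m1 (fun x => F (x, y))).
Proof.
move=> Fi s1 s2; rewrite cFubini_prod//; case: Fi => fr fi.
apply: complex_eqP => /=; congr fine.
  rewrite -(integral21_prod_meas1 fr); apply: eq_integral => y _.
  by rewrite /fubini_G fineK//; apply: integrable_fin_num => //; case: (s2 y).
rewrite -(integral21_prod_meas1 fi); apply: eq_integral => y _.
by rewrite /fubini_G fineK//; apply: integrable_fin_num => //; case: (s2 y).
Qed.

Section kernel.
Variables (a : T1 -> R[i]) (b : T2 -> R[i]) (c : T1 * T2 -> R[i]).
Hypotheses (ia : cintegrable m1 a) (ib : cintegrable m2 b).
Hypotheses (mc : cmeasurable setT c) (c1 : forall p, normc (c p) <= 1).

Let mF : cmeasurable setT (fun p : T1 * T2 => a p.1 * (b p.2 * c p)).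
Proof.
apply: cmeasurableM; last apply: cmeasurableM => //.
  exact: (cmeasurable_comp (cintegrable_cmeasurable ia) measurable_fst).
exact: (cmeasurable_comp (cintegrable_cmeasurable ib) measurable_snd).
Qed.

Let nF x y : normc (a x * (b y * c (x, y))) <= normc (a x) * normc (b y).
Proof.
by rewrite !normcM ler_wpM2l ?normc_ge0// ler_piMr ?normc_ge0.
Qed.

Lemma cintegrable_kernel :
  cintegrable (m1 \x m2)%E (fun p : T1 * T2 => a p.1 * (b p.2 * c p)).
Proof.
have na := integrable_fin_num measurableT (cintegrable_normc ia).
apply: (le_cintegrable (g := fun p => normc (a p.1) * normc (b p.2))) => //; last first.
  by move=> [x y]; exact: nF.
have ma := measurable_normc (cintegrable_cmeasurable ia).
have mb := measurable_normc (cintegrable_cmeasurable ib).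
have mab : measurable_fun setT (fun p : T1 * T2 => (normc (a p.1) * normc (b p.2))%:E).
  apply/measurable_EFinP; apply: measurable_funM.
    exact: (measurableT_comp ma measurable_fst).
  exact: (measurableT_comp mb measurable_snd).
apply/(integrable12ltyP _ _ mab).
rewrite (eq_integral (fun x => (normc (a x))%:E * \int[m2]_y (normc (b y))%:E)%E).
  rewrite ge0_integralZr//; last 3 first.
  - exact/measurable_EFinP.
  - by move=> x _; rewrite lee_fin normc_ge0.
  - by apply: integral_ge0 => y _; rewrite lee_fin normc_ge0.
  rewrite lte_mul_pinfty//.
  - by apply: integral_ge0 => y _; rewrite lee_fin normc_ge0.
  - exact: (integrable_lty measurableT (cintegrable_normc ib)).
move=> x _; rewrite -ge0_integralZl//; last 3 first.
- exact/measurable_EFinP.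
- by move=> y _; rewrite lee_fin normc_ge0.
- by rewrite lee_fin normc_ge0.
by apply: eq_integral => y _; rewrite /= ger0_norm ?mulr_ge0 ?normc_ge0.
Qed.

Lemma cintegrable_kernel_section x : cintegrable m2 (fun y => b y * c (x, y)).
Proof.
apply: (le_cintegrable _ (cintegrable_normc ib)).
  apply: cmeasurableM; first exact: (cintegrable_cmeasurable ib).
  exact: (cmeasurable_comp mc (measurable_pair1 x)).
by move=> y; rewrite normcM ler_piMr ?normc_ge0.
Qed.

Let s1 x : cintegrable m2 (fun y => a x * (b y * c (x, y))).
Proof. exact/cintegrableZl/cintegrable_kernel_section. Qed.

End kernel.

(** Since [c] is bounded by 1, the product of the moduli of [a] and [b] is an integrable majorant on
    the product space. The exchanges of integrals in the Fourier computations have this shape, with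
    [c] a complex exponential. *)
Lemma cFubini_kernel (a : T1 -> R[i]) (b : T2 -> R[i]) (c : T1 * T2 -> R[i]) :
  cintegrable m1 a -> cintegrable m2 b -> cmeasurable setT c ->
  (forall p, normc (c p) <= 1) ->
  cintegral m1 (fun x => a x * cintegral m2 (fun y => b y * c (x, y))) =
  cintegral m2 (fun y => b y * cintegral m1 (fun x => a x * c (x, y))).
Proof.
move=> ia ib mc c1.
have s1 x := cintegrable_kernel_section ib mc c1 x.
have s2 y : cintegrable m1 (fun x => a x * c (x, y)).
  apply: (le_cintegrable _ (cintegrable_normc ia)).
    apply: cmeasurableM; first exact: (cintegrable_cmeasurable ia).
    exact: (cmeasurable_comp mc (pair2_measurable y)).
  by move=> x; rewrite normcM ler_piMr ?normc_ge0.
transitivity (cintegral m1 (fun x => cintegral m2 (fun y => a x * (b y * c (x, y))))).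
  by apply: eq_cintegral => x; rewrite cintegralZl.
rewrite (cFubini (F := fun p => a p.1 * (b p.2 * c p)))/=.
- apply: eq_cintegral => y; rewrite -cintegralZl//.
  by apply: eq_cintegral => x; rewrite mulrCA.
- exact: cintegrable_kernel.
- by move=> x; exact: cintegrableZl.
- move=> y; have := cintegrableZl (b y) (s2 y).
  by rewrite (_ : (fun x => b y * _) = (fun x => a x * (b y * c (x, y))))//;
    apply/funext => x; rewrite mulrCA.
Qed.

End complex_fubini.

(** * The Poisson kernel *)

Section real_line_integrals.
Context {R : realType}.
Notation mu := (@lebesgue_measure R).
Notation symitv n := ([set` `[(- n%:R)%R, n%:R%R]] : set R).

Lemma FTC2_derive (f F : R -> R) (a b : R) : a < b ->
  (forall x : R, is_derive x 1 F (f x)) -> continuous f ->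
  (\int[mu]_(x in `[a, b]) (f x)%:E = (F b - F a)%:E)%E.
Proof.
move=> ab dF cf.
have cF x : F @ x --> F x.
  by apply/differentiable_continuous/derivable1_diffP; exact: ex_derive.
rewrite EFinB; apply: continuous_FTC2 => //.
- exact: continuous_subspaceT.
- split; first by move=> x _; exact: ex_derive.
    by apply: cvg_at_right_filter; exact: cF.
  by apply: cvg_at_left_filter; exact: cF.
- by move=> x _; rewrite derive1E derive_val.
Qed.

Let bigcup_sym (x : R) : \forall n \near \oo, x \in `[(- n%:R : R), n%:R].
Proof.
near=> n; rewrite in_itv/= -ler_norml; near: n.
exact: nbhs_infty_ger.
Unshelve. all: by end_near. Qed.

Lemma cvg_patch_sym (f : R -> \bar R) (x : R) :
  (f \_ (symitv n)) x @[n --> \oo] --> f x.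
Proof.
apply: cvg_near_cst; apply: filterS (bigcup_sym x) => n xn.
by rewrite patchE mem_set.
Qed.

Lemma cvg_integral_sym (f : R -> R) : mu.-integrable setT (EFin \o f) ->
  (\int[mu]_(x in (symitv n)) (f x)%:E)%E @[n --> \oo] -->
  (\int[mu]_x (f x)%:E)%E.
Proof.
move=> fi.
have mf := measurable_int _ fi.
have [] := @dominated_convergence _ _ _ mu setT measurableT
  (fun n => (EFin \o f) \_ (symitv n)) (EFin \o f) (abse \o (EFin \o f)).
- move=> n; apply/(measurable_restrictT _ _).1 => //; exact: measurable_funTS.
- by [].
- by apply: filterE => x _; exact: cvg_patch_sym.
- exact: integrable_abse.
- apply: filterE => x n _; rewrite patchE; case: ifPn => // _.
  by rewrite abse0 /= lee_fin.
move=> _ _; rewrite (_ : (fun n => _) = (fun n : nat =>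
  (\int[mu]_(x in (symitv n)) (f x)%:E)%E))//.
by apply/funext => n; rewrite [RHS]integral_mkcond.
Qed.

(** Fatou on growing intervals, used to get integrability from closed formulas. The radius starts at
    1 because those formulas assume a nondegenerate interval. *)
Lemma ge0_integral_sym_le (f : R -> R) (c : \bar R) : measurable_fun setT f ->
  (forall x, 0 <= f x) ->
  (forall n : nat, \int[mu]_(x in (symitv n.+1)) (f x)%:E <= c)%E ->
  (\int[mu]_x (f x)%:E <= c)%E.
Proof.
move=> mf f0 fc.
apply: (@fatou_cvg _ _ _ mu (fun n => (EFin \o f) \_ (symitv n))).
- move=> n; apply/(measurable_restrictT _ _).1 => //.
  exact/measurable_funTS/measurable_EFinP.
- exact/measurable_EFinP.
- by move=> n x; rewrite patchE; case: ifPn => //= _; rewrite lee_fin.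
- by move=> x; rewrite lee_fin.
- by apply: filterE => x; exact: cvg_patch_sym.
- exists 1%N => // -[//|n] _ /=; rewrite -integral_mkcond.
  exact: fc.
Qed.

Lemma integral_sym_split (g : R -> R) (n : R) : 0 < n -> continuous g ->
  (\int[mu]_(x in `[(- n)%R, n : R]) (g x)%:E =
   \int[mu]_(x in `[0%R, n : R]) (g x)%:E + \int[mu]_(x in `[0%R, n : R]) (g (- x)%R)%:E)%E.
Proof.
move=> n0 cg.
have mg : measurable_fun setT (EFin \o g).
  by apply/measurable_EFinP; exact: continuous_measurable_fun.
rewrite (@itv_bndbnd_setU _ _ _ (BRight 0)) ?bnd_simp ?oppr_le0 ?ltW//.
rewrite integral_setU//=; last 2 first.
- exact: measurable_funTS.
- by apply/disj_setPS => y [/=]; rewrite 2!in_itv/= => /andP[_ yx] /andP[]; rewrite ltNge yx.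
rewrite addeC; congr (_ + _)%E.
  by rewrite integral_itv_obnd_cbnd//; exact: measurable_funTS.
rewrite -[X in `[_, X]]oppr0 integration_by_substitution_oppr ?ltW//.
exact: continuous_subspaceT.
Qed.

End real_line_integrals.

Section damped_oscillation.
Context {R : realType}.
Notation mu := (@lebesgue_measure R).
Variables (a b : R).
Hypothesis a0 : 0 < a.

Let D_neq0 : a ^+ 2 + b ^+ 2 != 0.
Proof. by rewrite gt_eqF// ltr_wpDr ?sqr_ge0// exprn_gt0. Qed.

(** The real part of [exp ((- a + i b) x) / (- a + i b)]. *)
Let F x : R := expR (- a * x) * (b * sin (b * x) - a * cos (b * x)) / (a ^+ 2 + b ^+ 2).

Let dF (x : R) : is_derive x 1 F (expR (- a * x) * cos (b * x)).
Proof.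
apply: is_derive_eq; rewrite /GRing.scale /= !mulr1.
by field.
Qed.

Let cf : continuous (fun x : R => expR (- a * x) * cos (b * x)).
Proof.
by move=> x; apply/differentiable_continuous/derivable1_diffP; exact: ex_derive.
Qed.

Lemma integral_damped_cos (n : R) : 0 < n ->
  (\int[mu]_(x in `[0%R, n]) (expR (- a * x) * cos (b * x))%:E =
  (expR (- a * n) * (b * sin (b * n) - a * cos (b * n)) / (a ^+ 2 + b ^+ 2)
   + a / (a ^+ 2 + b ^+ 2))%:E)%E.
Proof.
move=> n0; rewrite (FTC2_derive n0 dF cf) /F !mulr0 expR0 cos0 sin0.
by congr EFin; field.
Qed.

End damped_oscillation.

Section poisson.
Context {R : realType}.
Notation mu := (@lebesgue_measure R).
Notation symitv n := ([set` `[(- n%:R)%R, n%:R%R]] : set R).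
Implicit Types e x w : R.

Definition poisson_weight e w : R := expR (- (2 * pi * e) * `|w|).

Definition poisson_kernel e x : R := e / (pi * (e ^+ 2 + x ^+ 2)).

Lemma poisson_weight_gt0 e w : 0 < poisson_weight e w.
Proof. exact: expR_gt0. Qed.

Lemma poisson_weight_le1 e w : 0 <= e -> poisson_weight e w <= 1.
Proof.
move=> e0; rewrite -[leRHS]expR0 ler_expR mulNr oppr_le0 mulr_ge0// mulr_ge0//.
by rewrite mulr_ge0// pi_ge0.
Qed.

Lemma poisson_kernel_ge0 e x : 0 <= e -> 0 <= poisson_kernel e x.
Proof. by move=> e0; rewrite divr_ge0// mulr_ge0 ?pi_ge0// addr_ge0 ?sqr_ge0. Qed.

Lemma poisson_kernelN e x : poisson_kernel e (- x) = poisson_kernel e x.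
Proof. by rewrite /poisson_kernel sqrrN. Qed.

Lemma continuous_poisson_weight e : continuous (poisson_weight e).
Proof.
move=> x; apply: (@continuous_comp _ _ _ (fun w : R => - (2 * pi * e) * `|w|) expR);
  last exact: continuous_expR.
have c1 := @cst_continuous R R (- (2 * pi * e)) x.
exact: (continuousM c1 (@norm_continuous _ R x)).
Qed.

Lemma continuous_poisson_kernel e : 0 < e -> continuous (poisson_kernel e).
Proof.
move=> e0 x; apply/differentiable_continuous/derivable1_diffP.
have e2 : pi * (e ^+ 2 + x ^+ 2) != 0.
  by rewrite mulf_neq0 ?gt_eqF ?pi_gt0// ltr_wpDr ?sqr_ge0// exprn_gt0.
by apply: derivableM => //; apply: derivableV.
Qed.

Let pi2e e : 0 < e -> 0 < 2 * pi * e.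
Proof. by move=> e0; rewrite mulr_gt0// mulr_gt0// pi_gt0. Qed.

Let weight_cos (e b n a : R) : 0 < e -> 0 < n -> a = 2 * pi * e ->
  (\int[mu]_(x in `[(- n)%R, n]) (poisson_weight e x * cos (b * x))%:E =
  2%:E * (expR (- a * n) * (b * sin (b * n) - a * cos (b * n)) / (a ^+ 2 + b ^+ 2)
   + a / (a ^+ 2 + b ^+ 2))%:E)%E.
Proof.
move=> e0 n0 ->; rewrite integral_sym_split//; last first.
  move=> x; apply: continuousM; first exact: continuous_poisson_weight.
  by apply/differentiable_continuous/derivable1_diffP; exact: ex_derive.
rewrite (_ : 2%:E = 1 + 1)%E// ge0_muleDl// !mul1e; congr (_ + _)%E;
  rewrite -(integral_damped_cos _ (pi2e e0) n0); apply: eq_integral => x;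
  rewrite inE/= in_itv/= => /andP[x0 _]; rewrite /poisson_weight ?normrN ger0_norm//.
by rewrite mulrN cosN.
Qed.

Lemma poisson_weight_integrable e : 0 < e ->
  mu.-integrable setT (EFin \o poisson_weight e).
Proof.
move=> e0; have mw := continuous_measurable_fun (@continuous_poisson_weight e).
apply/integrableP; split; first exact/measurable_EFinP.
(* Twice [a / a^2] with [a = 2 pi e], the mass of the weight on each half-line. *)
apply: (@le_lt_trans _ _ (2%:E * ((2 * pi * e) / (2 * pi * e) ^+ 2)%:E)%E); last first.
  by rewrite -EFinM ltry.
under eq_integral do rewrite /= ger0_norm ?ltW ?poisson_weight_gt0//.
apply: ge0_integral_sym_le => // [x|n]; first by rewrite ltW ?poisson_weight_gt0.
(* At frequency 0 the damped cosine is the weight itself. *)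
have := @weight_cos e 0 n.+1%:R _ e0 (ltr0Sn _ _) erefl.
under eq_integral do rewrite mul0r cos0 mulr1.
move=> -> /=; rewrite !mul0r cos0 mulr1 sub0r expr0n /= addr0.
rewrite -!EFinM lee_fin ler_pM2l// gerDr mulrN mulNr oppr_le0.
by rewrite divr_ge0 ?sqr_ge0// mulr_ge0 ?expR_ge0// ltW// pi2e.
Qed.

Let weight_expi_integrable e x : 0 < e ->
  cintegrable mu (fun w => Complex (poisson_weight e w) 0 * expi (2 * pi * (w * x))).
Proof.
move=> e0; have mw := continuous_measurable_fun (@continuous_poisson_weight e).
apply: (le_cintegrable _ (poisson_weight_integrable e0)).
  apply: cmeasurableM; first exact: cmeasurable_real.
  apply: cmeasurable_expi; apply: measurable_funM => //.
  exact: measurable_funM.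
by move=> w; rewrite normcM normcR normc_expi mulr1 gtr0_norm ?poisson_weight_gt0.
Qed.

(** For the real part, the closed formula on [[-n, n]] has a boundary term that decays like
    [exp (- a n)]. The imaginary part has an odd integrand, whose integral over each symmetric
    interval is 0. *)
Lemma cintegral_poisson_weight e x : 0 < e ->
  cintegral mu (fun w => Complex (poisson_weight e w) 0 * expi (2 * pi * (w * x))) =
  Complex (poisson_kernel e x) 0.
Proof.
move=> e0; have [ir ii] := weight_expi_integrable x e0.
apply: complex_eqP.
  have fE w : complex.Re (Complex (poisson_weight e w) 0 * expi (2 * pi * (w * x))) =
      poisson_weight e w * cos (2 * pi * x * w).
    by rewrite cReM /= mul0r subr0; congr (_ * cos _); ring.
  have ir' : mu.-integrable setT (EFin \o (fun w => poisson_weight e w * cos (2 * pi * x * w))).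
    by apply: eq_integrable ir => // w _; rewrite /= -fE.
  transitivity (\int[mu]_w (poisson_weight e w * cos (2 * pi * x * w))).
    by apply: eq_Rintegral => w _; exact: fE.
  rewrite /Rintegral.
  have cv := cvg_integral_sym ir'.
  suff : (\int[mu]_(w in symitv n)
      (poisson_weight e w * cos (2 * pi * x * w))%:E)%E @[n --> \oo] -->
      (poisson_kernel e x)%:E.
    by move=> /(cvg_unique (@ereal_hausdorff R) cv) ->.
  pose a := 2 * pi * e; pose b := 2 * pi * x.
  have a0 : 0 < a by exact: pi2e.
  have D0 : 0 < a ^+ 2 + b ^+ 2 by rewrite ltr_wpDr ?sqr_ge0// exprn_gt0.
  have alg (p s t : R) : p != 0 -> s ^+ 2 + t ^+ 2 != 0 ->
      s / (p * (s ^+ 2 + t ^+ 2)) =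
      2 * (0 + 2 * p * s / ((2 * p * s) ^+ 2 + (2 * p * t) ^+ 2)).
    move=> p0 p1.
    rewrite (_ : (2 * p * s) ^+ 2 + (2 * p * t) ^+ 2 = 4 * p ^+ 2 * (s ^+ 2 + t ^+ 2)).
      by field; rewrite p1.
    ring.
  have kE : poisson_kernel e x = 2 * (0 + a / (a ^+ 2 + b ^+ 2)).
    by apply: alg; rewrite gt_eqF// ?pi_gt0// ltr_wpDr ?sqr_ge0// exprn_gt0.
  pose u (n : R) := expR (- a * n) * (b * sin (b * n) - a * cos (b * n)) / (a ^+ 2 + b ^+ 2).
  have hu (n : nat) : (0 < n)%N ->
      (\int[mu]_(w in symitv n) (poisson_weight e w * cos (2 * pi * x * w))%:E)%E =
      (2 * (u n%:R + a / (a ^+ 2 + b ^+ 2)))%:E.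
    by move=> n0; rewrite (weight_cos b e0 _ (erefl a)) ?ltr0n.
  apply: (@cvg_trans _ ((2 * (u n%:R + a / (a ^+ 2 + b ^+ 2)))%:E @[n --> \oo])).
    by apply: near_eq_cvg; exists 1%N => // n /= n0; rewrite hu.
  apply: cvg_EFin; first exact: nearW.
  rewrite kE; apply: cvgMl_tmp; apply: cvgD; last exact: cvg_cst.
  have v0 : expR (- a * n%:R) * ((`|b| + a) / (a ^+ 2 + b ^+ 2)) @[n --> \oo] --> (0 : R).
    rewrite -[X in _ --> X](mul0r ((`|b| + a) / (a ^+ 2 + b ^+ 2))); apply: cvgMr_tmp.
    have : (expR (- (a * n%:R)) : R) @[n --> \oo] --> (0 : R).
      have an : (a * n%:R : R) @[n --> \oo] --> +oo.
        apply/cvgryPge => M; near=> n; rewrite -ler_pdivrMl//; near: n.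
        exact: nbhs_infty_ger.
      exact: (cvg_comp (fun n : nat => a * n%:R) (fun z : R => expR (- z)) an (@cvgr_expR R)).
    by under [in X in X -> _]eq_fun do rewrite -mulNr.
  apply: norm_cvg0; apply: (squeeze_cvgr (f := fun=> 0) _ _ v0); last exact: cvg_cst.
  apply: nearW => n; rewrite normr_ge0 /=.
  rewrite /u 2!normrM (ger0_norm (expR_ge0 _)) -mulrA ler_wpM2l ?expR_ge0//.
  rewrite (gtr0_norm (x := _^-1)) ?invr_gt0// ler_wpM2r ?invr_ge0 ?(ltW D0)//.
  apply: (le_trans (ler_normB _ _)); rewrite (normrM b) (normrM a) (gtr0_norm a0).
  rewrite lerD//.
    by rewrite ler_piMr// ler_norml sin_geN1 sin_le1.
  by rewrite ler_piMr ?(ltW a0)// ler_norml cos_geN1 cos_le1.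
pose g w := poisson_weight e w * sin (2 * pi * x * w).
have fE w : complex.Im (Complex (poisson_weight e w) 0 * expi (2 * pi * (w * x))) = g w.
  by rewrite cImM /= mul0r addr0; congr (_ * sin _); ring.
have ii' : mu.-integrable setT (EFin \o g).
  by apply: eq_integrable ii => // w _; rewrite /= -fE.
transitivity (\int[mu]_w g w); first by apply: eq_Rintegral => w _; exact: fE.
rewrite /Rintegral.
have cv := cvg_integral_sym ii'.
suff : (\int[mu]_(w in symitv n) (g w)%:E)%E @[n --> \oo] --> (0 : R)%:E.
  by move=> /(cvg_unique (@ereal_hausdorff R) cv) ->.
apply: cvg_near_cst; exists 1%N => // n /= n0.
have cg : continuous g.
  move=> y; apply: continuousM; first exact: continuous_poisson_weight.
  by apply/differentiable_continuous/derivable1_diffP; exact: ex_derive.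
rewrite integral_sym_split ?ltr0n//.
have gN w : g (- w) = -1 * g w.
  by rewrite /g /poisson_weight normrN mulrN sinN mulN1r mulrN.
under [X in (_ + X)%E]eq_integral do rewrite gN EFinM.
have ig : mu.-integrable `[0%R, n%:R : R] (EFin \o g).
  apply: continuous_compact_integrable; first exact: segment_compact.
  exact: continuous_subspaceT.
rewrite (integralZl _ ig)// mulN1e subee//.
exact: integrable_fin_num.
Unshelve. all: by end_near. Qed.

End poisson.

Section poisson_mass.
Context {R : realType}.
Notation mu := (@lebesgue_measure R).
Notation symitv n := ([set` `[(- n%:R)%R, n%:R%R]] : set R).
Implicit Types e x : R.

Lemma measurable_poisson_kernel e x : 0 < e ->
  measurable_fun setT (fun t : R => poisson_kernel e (x - t)).
Proof.
move=> e0; apply: (measurableT_comp (f := poisson_kernel e)).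
  by apply: continuous_measurable_fun; exact: continuous_poisson_kernel.
exact: measurable_funB.
Qed.

Lemma integral_poisson_kernel_cc e x (a b : R) : 0 < e -> a < b ->
  (\int[mu]_(t in `[a, b]) (poisson_kernel e (x - t))%:E =
   ((atan ((b - x) / e) - atan ((a - x) / e)) / pi)%:E)%E.
Proof.
move=> e0 ab.
have dF (t : R) : is_derive t 1 (fun t : R => atan ((t - x) / e) / pi)
    (poisson_kernel e (x - t)).
  apply: is_derive_eq; rewrite /GRing.scale /= ?mulr1 /poisson_kernel.
  have : 0 < 1 + ((t - x) / e) ^+ 2 by rewrite ltr_wpDr ?sqr_ge0.
  rewrite (_ : e ^+ 2 + (x - t) ^+ 2 = e ^+ 2 * (1 + ((t - x) / e) ^+ 2)); last first.
    by field; rewrite gt_eqF.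
  move: (1 + _) => D D0; have := pi_gt0 R; move: (pi : R) (atan _) => p y p0.
  by field; rewrite !gt_eqF.
rewrite (FTC2_derive ab dF); first by rewrite -mulrBl.
move=> t; apply: (@continuous_comp _ _ _ (fun t : R => x - t) (poisson_kernel e)).
  by apply/differentiable_continuous/derivable1_diffP; exact: ex_derive.
exact: continuous_poisson_kernel.
Qed.

Lemma cvg_atan_pinfty (u : nat -> R) : u @ \oo --> +oo ->
  atan (u n) @[n --> \oo] --> (pi / 2 : R).
Proof. by move=> h; exact: (cvg_comp u (@atan R) h (@cvgy_atan R)). Qed.

Lemma cvg_atan_ninfty (u : nat -> R) : (fun n => - u n) @ \oo --> +oo ->
  atan (u n) @[n --> \oo] --> (- (pi / 2) : R).
Proof.
move=> h; rewrite [X in X @ _](_ : _ = (fun n => - atan (- u n))).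
  by apply: (@cvgN R R^o); exact: cvg_atan_pinfty.
by apply/funext => n; rewrite atanN opprK.
Qed.

Lemma integral_poisson_kernel e x : 0 < e ->
  (\int[mu]_t (poisson_kernel e (x - t))%:E = 1)%E.
Proof.
move=> e0; have mk := measurable_poisson_kernel x e0.
have k0 t : 0 <= poisson_kernel e (x - t) by rewrite poisson_kernel_ge0// ltW.
(* Integrability comes first: a difference of arctangents stays below [pi], so the mass of each
   interval is below 1. The symmetric integrals then converge to the full one. *)
have ki : mu.-integrable setT (EFin \o (fun t : R => poisson_kernel e (x - t))).
  apply/integrableP; split; first exact/measurable_EFinP.
  apply: (@le_lt_trans _ _ 1%E); last exact: ltry.
  under eq_integral do rewrite /= ger0_norm//.
  apply: ge0_integral_sym_le => // n; rewrite integral_poisson_kernel_cc//.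
    rewrite lee_fin ler_pdivrMr ?pi_gt0// mul1r.
    have := atan_ltpi2 ((n.+1%:R - x) / e).
    have := atan_gtNpi2 ((- n.+1%:R - x) / e).
    by move: (pi : R) => p; lra.
  by rewrite -subr_gt0 opprK addr_gt0.
have cv := cvg_integral_sym ki.
suff : (\int[mu]_(t in symitv n) (poisson_kernel e (x - t))%:E)%E @[n --> \oo]
    --> (1 : R)%:E.
  by move=> /(cvg_unique (@ereal_hausdorff R) cv).
apply: (@cvg_trans _ ((((atan ((n%:R - x) / e) - atan ((- n%:R - x) / e)) / pi)%:E
   : \bar R) @[n --> \oo])).
  apply: near_eq_cvg; exists 1%N => // n /= n0; rewrite integral_poisson_kernel_cc//.
  by rewrite -subr_gt0 opprK addr_gt0 ?ltr0n.
apply: cvg_EFin; first exact: nearW.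
have p0 : (pi : R) != 0 by rewrite gt_eqF// pi_gt0.
rewrite [X in _ --> X](_ : (1 : R) = (pi / 2 - - (pi / 2)) / pi);
  last by move: (pi : R) p0 => p p0; field.
apply: cvgMr_tmp; apply: cvgB.
  apply: cvg_atan_pinfty; apply/cvgryPge => M; near=> n.
  rewrite ler_pdivlMr// lerBrDr; near: n; exact: nbhs_infty_ger.
apply: cvg_atan_ninfty; apply/cvgryPge => M; near=> n.
rewrite -mulNr opprB opprK ler_pdivlMr// -lerBlDl; near: n; exact: nbhs_infty_ger.
Unshelve. all: by end_near. Qed.

Lemma integral_poisson_kernel_swap e x : 0 < e ->
  (\int[mu]_t (poisson_kernel e (t - x))%:E = 1)%E.
Proof.
move=> e0; rewrite -(integral_poisson_kernel x e0); apply: eq_integral => t _.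
by rewrite -poisson_kernelN opprB.
Qed.

Definition poisson_mass e (a b x : R) : \bar R :=
  (\int[mu]_(t in `]a, b]) (poisson_kernel e (x - t))%:E)%E.

Lemma poisson_massE e (a b x : R) : 0 < e -> a < b ->
  poisson_mass e a b x = ((atan ((b - x) / e) - atan ((a - x) / e)) / pi)%:E.
Proof.
move=> e0 ab; rewrite /poisson_mass integral_itv_obnd_cbnd; last first.
  by apply/measurable_EFinP; apply: measurable_funTS; exact: measurable_poisson_kernel.
exact: integral_poisson_kernel_cc.
Qed.

(** Inside the interval the smoothed indicator tends to 1 and is dominated by 1. At an end point it
    tends to 1/2, so dominated convergence is run on the open interval, which has the same
    integrals. *)
Lemma cvg_poisson_mass (a b : R) : a < b ->
  (\int[mu]_(x in `]a, b]) poisson_mass j.+1%:R^-1 a b x)%E @[j --> \oo] --> (b - a)%:E.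
Proof.
move=> ab.
have e0 (j : nat) : 0 < j.+1%:R^-1 :> R by rewrite invr_gt0.
pose h (j : nat) x := (atan ((b - x) * j.+1%:R) - atan ((a - x) * j.+1%:R)) / pi.
have hE j x : poisson_mass j.+1%:R^-1 a b x = (h j x)%:E.
  by rewrite poisson_massE// invrK.
have mh j : measurable_fun setT (h j).
  apply: continuous_measurable_fun => x.
  by apply/differentiable_continuous/derivable1_diffP; exact: ex_derive.
have [_ _] : [/\ mu.-integrable `]a, b[ (cst 1%E),
  [sequence \int[mu]_(x in `]a, b[) `|(h j x)%:E - cst 1%E x|]_j @ \oo --> 0%E &
  [sequence \int[mu]_(x in `]a, b[) (h j x)%:E]_j @ \oo --> \int[mu]_(x in `]a, b[) (cst 1%E x)]%E.
  apply: (@dominated_convergence _ _ _ mu _ _ _ _ (cst 1%E)).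
  - by [].
  - by move=> n; apply/measurable_EFinP; apply: measurable_funTS; exact: mh.
  - exact: measurable_cst.
  - apply: filterE => x; rewrite /= in_itv/= => /andP[ax xb].
    apply: cvg_EFin; first exact: nearW.
    have p0 : (pi : R) != 0 by rewrite gt_eqF// pi_gt0.
    rewrite [X in _ --> X](_ : (1 : R) = (pi / 2 - - (pi / 2)) / pi);
  last by move: (pi : R) p0 => p p0; field.
    apply: cvgMr_tmp; apply: cvgB.
      apply: cvg_atan_pinfty; apply/cvgryPge => M; near=> n.
      rewrite -ler_pdivrMl ?subr_gt0//.
      apply: (@le_trans _ _ n%:R); last by rewrite ler_nat.
      near: n; exact: nbhs_infty_ger.
    apply: cvg_atan_ninfty; apply/cvgryPge => M; near=> n.
    rewrite -mulNr opprB -ler_pdivrMl ?subr_gt0//.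
    apply: (@le_trans _ _ n%:R); last by rewrite ler_nat.
    near: n; exact: nbhs_infty_ger.
  - apply/integrableP; split; first exact: measurable_cst.
    rewrite /= normr1 integral_cst//= lebesgue_measure_itv /= lte_fin ab.
    by rewrite mul1e -EFinB ltry.
  - apply: filterE => x n _; rewrite /= lee_fin /h.
    rewrite normrM (gtr0_norm (x := _^-1)) ?invr_gt0 ?pi_gt0//.
    rewrite ler_pdivrMr ?pi_gt0// mul1r ler_norml.
    have := atan_ltpi2 ((b - x) * n.+1%:R).
    have := atan_gtNpi2 ((b - x) * n.+1%:R).
    have := atan_ltpi2 ((a - x) * n.+1%:R).
    have := atan_gtNpi2 ((a - x) * n.+1%:R).
    by move: (pi : R) => p; lra.
rewrite integral_cst//= lebesgue_measure_itv /= lte_fin ab mul1e -EFinB.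
rewrite (_ : (fun j => _) = (fun j => \int[mu]_(x in `]a, b]) poisson_mass j.+1%:R^-1 a b x)%E)//.
apply/funext => j; rewrite integral_itv_bndo_bndc; last first.
  by apply/measurable_EFinP; apply: measurable_funTS; exact: mh.
by apply: eq_integral => x _; rewrite hE.
Unshelve. all: by end_near. Qed.

End poisson_mass.

(** * Lebesgue measure on the Euclidean space *)

Section lebesgue_transfer.
Context {R : realType} (n : nat).
Local Notation bl := (@borel_lebesgue R n).

Lemma Leb_sigma_finite : sigma_finite setT (Leb R n).
Proof. exact/completed_measure_extension_sigma_finite/sigma_finiteT. Qed.

Definition Leb_fun : set (euclid R n) -> \bar R := Leb R n.

HB.instance Definition _ := Measure.copy Leb_fun (Leb R n).
HB.instance Definition _ := @Measure_isSigmaFinite.Build _ _ _ Leb_fun Leb_sigma_finite.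

(* A copy of [Leb] that carries the sigma-finite structure needed by Fubini. *)
Definition sLeb : {sigma_finite_measure set (euclid R n) -> \bar R} := Leb_fun.

Lemma measurable_euclid (A : set 'rV[R]_n) : measurable A ->
  measurable (A : set (euclid R n)).
Proof. exact: caratheodory_measurable_mu_ext. Qed.

Lemma LebE (A : set 'rV[R]_n) : measurable A -> Leb R n A = bl A.
Proof. by move=> mA; rewrite /= /completed_measure_extension measurable_mu_extE. Qed.

(* The completed sigma-algebra is finer than the Borel one, so this identity is
   measurable in one direction only. *)
Definition to_borel (x : euclid R n) : 'rV[R]_n := x.

Lemma measurable_to_borel : measurable_fun setT to_borel.
Proof. by move=> _ Y mY; rewrite setTI; exact: measurable_euclid. Qed.

Lemma measurable_fun_euclid d (T : measurableType d) (f : 'rV[R]_n -> T) :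
  measurable_fun setT f -> measurable_fun setT (f : euclid R n -> T).
Proof. by move=> mf; exact: (measurableT_comp mf measurable_to_borel). Qed.

(** The Borel measure is the pushforward of [Leb] along [to_borel]. *)
Lemma ge0_integral_Leb (f : 'rV[R]_n -> \bar R) : measurable_fun setT f ->
  (forall x, 0 <= f x)%E -> (\int[Leb R n]_x f x = \int[bl]_x f x)%E.
Proof.
move=> mf f0.
pose pm := measure_function_pushforward__canonical__measure_function_Measure
  (Leb R n) measurable_to_borel.
rewrite [RHS](eq_measure_integral pm); last first.
  by move=> A mA _; rewrite /= /pushforward -LebE.
rewrite /= ge0_integral_pushforward//; exact: measurable_to_borel.
Qed.

Lemma integrable_Leb (f : 'rV[R]_n -> \bar R) : bl.-integrable setT f ->
  (Leb R n).-integrable setT f.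
Proof.
move=> /integrableP[mf foo]; apply/integrableP; split; first exact: measurable_fun_euclid.
by rewrite ge0_integral_Leb//; exact: measurableT_comp.
Qed.

Lemma integral_Leb (f : 'rV[R]_n -> \bar R) : measurable_fun setT f ->
  (\int[Leb R n]_x f x = \int[bl]_x f x)%E.
Proof.
move=> mf; rewrite integralE [in RHS]integralE.
by congr (_ - _)%E; apply: ge0_integral_Leb => //;
  [exact: measurable_funepos|exact: measurable_funeneg].
Qed.

Lemma cintegrable_Leb (f : 'rV[R]_n -> R[i]) : cintegrable bl f ->
  cintegrable (Leb R n) f.
Proof. by move=> [fr fi]; split; exact: integrable_Leb. Qed.

Lemma cintegral_Leb (f : 'rV[R]_n -> R[i]) : cmeasurable setT f ->
  cintegral (Leb R n) f = cintegral bl f.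
Proof.
move=> [mr mi]; rewrite /cintegral /Rintegral.
by rewrite !integral_Leb//; exact/measurable_EFinP.
Qed.

End lebesgue_transfer.

Section product_integrals.
Context {R : realType}.
Notation lam := (@lebesgue_measure R).

Lemma cons_row_ord0 n (p : measurableTypeR R * 'rV[R]_n) : cons_row p ord0 ord0 = p.1.
Proof.
have -> : ord0 = lshift n (ord0 : 'I_1) :> 'I_(1 + n) by exact/val_inj.
by rewrite [LHS]row_mxEl mxE.
Qed.

Lemma cons_row_lift n (p : measurableTypeR R * 'rV[R]_n) (j : 'I_n) :
  cons_row p ord0 (lift ord0 j) = p.2 ord0 j.
Proof.
have -> : lift ord0 j = rshift 1 j :> 'I_(1 + n) by exact/val_inj.
by rewrite [LHS]row_mxEr.
Qed.

Lemma ge0_integral_cons_row n (f : 'rV[R]_n.+1 -> \bar R) : measurable_fun setT f ->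
  (forall x, 0 <= f x)%E ->
  (\int[borel_lebesgue n.+1]_x f x =
   \int[lam]_t \int[borel_lebesgue n]_y f (cons_row (t, y)))%E.
Proof.
move=> mf f0.
have mfc := measurableT_comp mf (@measurable_cons_row R n).
have fc0 p : (0 <= (f \o @cons_row R n) p)%E by exact: f0.
rewrite -(fubini_tonelli1 (m1 := lam) (m2 := borel_lebesgue n) _ mfc fc0).
exact: (ge0_integral_pushforward (@measurable_cons_row R n) (lam \x borel_lebesgue n)%E).
Qed.

Lemma integrable_cons_row n (f : 'rV[R]_n.+1 -> \bar R) : measurable_fun setT f ->
  (lam \x borel_lebesgue n)%E.-integrable setT (f \o @cons_row R n) ->
  (borel_lebesgue n.+1).-integrable setT f.
Proof.
move=> mf fi.
exact: (integrable_pushforward (@measurable_cons_row R n) mf fi measurableT).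
Qed.

Lemma integral_cons_row n (f : 'rV[R]_n.+1 -> \bar R) : measurable_fun setT f ->
  (lam \x borel_lebesgue n)%E.-integrable setT (f \o @cons_row R n) ->
  (\int[borel_lebesgue n.+1]_x f x =
   \int[lam \x borel_lebesgue n]_p f (cons_row p))%E.
Proof.
move=> mf fi.
exact: (integral_pushforward (@measurable_cons_row R n) mf fi measurableT).
Qed.

Lemma measurable_prod_coord n (g : 'I_n -> R -> R) :
  (forall i, measurable_fun setT (g i)) ->
  measurable_fun setT (fun x : 'rV[R]_n => \prod_(i < n) g i (x ord0 i)).
Proof.
move=> mg.
elim: (index_enum _) => [|i s ih].
  by under eq_fun do rewrite big_nil; exact: measurable_cst.
under eq_fun do rewrite big_cons; apply: measurable_funM => //.
apply: (measurableT_comp (mg i)); exact: measurable_coord.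
Qed.

Lemma ge0_integral_prod_coord n (g : 'I_n -> R -> R) (c : 'I_n -> R) :
  (forall i, measurable_fun setT (g i)) -> (forall i t, 0 <= g i t) ->
  (forall i, \int[lam]_t (g i t)%:E = (c i)%:E)%E ->
  (\int[borel_lebesgue n]_x (\prod_(i < n) g i (x ord0 i))%:E = (\prod_(i < n) c i)%:E)%E.
Proof.
elim: n g c => [|n ih] g c mg g0 gc.
  rewrite big_ord0; under eq_integral do rewrite big_ord0.
  by rewrite integral_cst//= diracT mul1e.
rewrite ge0_integral_cons_row; last 2 first.
- by apply/measurable_EFinP; exact: measurable_prod_coord.
- by move=> x; rewrite lee_fin prodr_ge0.
pose P (y : 'rV[R]_n) := \prod_(i < n) g (lift ord0 i) (y ord0 i).
have c0 : 0 <= c ord0 by rewrite -lee_fin -gc integral_ge0// => t _; rewrite lee_fin.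
have mP : measurable_fun setT (fun y : 'rV[R]_n => (P y)%:E).
  apply/measurable_EFinP.
  exact: (measurable_prod_coord (g := fun i => g (lift ord0 i)) (fun i => mg _)).
have P0 y : (0 <= (P y)%:E)%E by rewrite lee_fin prodr_ge0.
have inner t : (\int[borel_lebesgue n]_y
    (\prod_(i < n.+1) g i (cons_row (t, y) ord0 i))%:E =
    (g ord0 t)%:E * (\prod_(i < n) c (lift ord0 i))%:E)%E.
  rewrite -(ih (fun i => g (lift ord0 i)))// -ge0_integralZl ?lee_fin//.
    apply: eq_integral => y _; rewrite big_ord_recl cons_row_ord0 EFinM.
    by congr (_ * _%:E)%E; apply: eq_bigr => i _; rewrite cons_row_lift.
  by move=> y _; exact: P0.
under eq_integral do rewrite inner.
have cp0 : (0 <= (\prod_(i < n) c (lift ord0 i))%:E)%E.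
  rewrite lee_fin prodr_ge0// => i _; rewrite -lee_fin -gc integral_ge0// => t _.
  by rewrite lee_fin.
rewrite ge0_integralZr//.
- by rewrite gc big_ord_recl EFinM.
- by apply/measurable_EFinP; exact: mg.
- by move=> t _; rewrite lee_fin.
Qed.

(** The three claims go together because Fubini in the inductive step needs the integrability of the
    product over the remaining coordinates. *)
Lemma cintegral_prod_coord n (g : 'I_n -> R -> R[i]) :
  (forall i, cintegrable lam (g i)) ->
  [/\ cmeasurable setT (fun x : 'rV[R]_n => \prod_(i < n) g i (x ord0 i)),
   cintegrable (borel_lebesgue n) (fun x => \prod_(i < n) g i (x ord0 i)) &
   cintegral (borel_lebesgue n) (fun x => \prod_(i < n) g i (x ord0 i)) =
   \prod_(i < n) cintegral lam (g i)].
Proof.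
elim: n g => [|n ih] g ig.
  have fE : (fun x : 'rV[R]_0 => \prod_(i < 0) g i (x ord0 i)) = cst 1.
    by apply/funext => x; rewrite big_ord0.
  rewrite fE big_ord0; split.
  - exact: cmeasurable_cst.
  - have ic (r : R) : (borel_lebesgue 0).-integrable setT (cst r%:E : 'rV[R]_0 -> \bar R).
      apply/integrableP; split; first exact: measurable_cst.
      rewrite (_ : (fun x => _) = cst `|r|%:E)//.
      by rewrite integral_cst//= diracT mule1 ltry.
    by split; exact: ic.
  - rewrite /cintegral /Rintegral.
    have ic (r : R) : (\int[borel_lebesgue 0]_(x in [set: 'rV[R]_0]) (cst r%:E x) = r%:E)%E.
      by rewrite integral_cst//= diracT mule1.
    by rewrite !ic.
pose G := fun x : 'rV[R]_n.+1 => \prod_(i < n.+1) g i (x ord0 i).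
pose P := fun y : 'rV[R]_n => \prod_(i < n) g (lift ord0 i) (y ord0 i).
(* The trailing 1 is the constant kernel [c] of [cintegrable_kernel]. *)
have GE p : G (cons_row p) = g ord0 p.1 * (P p.2 * 1).
  rewrite /G big_ord_recl cons_row_ord0 mulr1; congr (_ * _).
  by apply: eq_bigr => i _; rewrite cons_row_lift.
have [mP iP PE] := ih (fun i => g (lift ord0 i)) (fun i => ig _).
have mG : cmeasurable setT G.
  rewrite /G; elim: (index_enum _) => [|i s ihs].
    by under eq_fun do rewrite big_nil; exact: cmeasurable_cst.
  under eq_fun do rewrite big_cons; apply: cmeasurableM => //.
  apply: (cmeasurable_comp (cintegrable_cmeasurable (ig i))).
  exact: measurable_coord.
have c1 (p : measurableTypeR R * 'rV[R]_n) : normc (1 : R[i]) <= 1 by rewrite normc1.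
have iF := cintegrable_kernel (ig ord0) iP (cmeasurable_cst setT 1) c1.
have iGc : cintegrable (lam \x borel_lebesgue n)%E (G \o @cons_row R n).
  by rewrite (_ : G \o _ = (fun p => g ord0 p.1 * (P p.2 * 1)))//; apply/funext => p; exact: GE.
split => //.
- case: iGc => ir ii; case: mG => mr mi; split.
    by apply: integrable_cons_row => //; exact/measurable_EFinP.
  by apply: integrable_cons_row => //; exact/measurable_EFinP.
- transitivity (cintegral (lam \x borel_lebesgue n)%E (G \o @cons_row R n)).
    case: iGc => ir ii; case: mG => mr mi; apply: complex_eqP => /=; congr fine.
      by apply: integral_cons_row => //; exact/measurable_EFinP.
    by apply: integral_cons_row => //; exact/measurable_EFinP.
  rewrite (_ : G \o _ = (fun p => g ord0 p.1 * (P p.2 * 1))); last first.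
    by apply/funext => p; exact: GE.
  have s1 : cintegrable (borel_lebesgue n) (fun y => P y * 1).
    by rewrite (_ : (fun y => _) = P)//; apply/funext => y; rewrite mulr1.
  rewrite -(cFubini_prod iF (fun t => cintegrableZl (g ord0 t) s1)).
  rewrite big_ord_recl -PE -[RHS]mulrC -cintegralZl//.
  apply: eq_cintegral => t /=; rewrite cintegralZl; last exact: s1.
  by rewrite mulrC; congr (_ * _); apply: eq_cintegral => y; rewrite mulr1.
Qed.

End product_integrals.

(** Rotating by the unit number [c] that takes the integral [z] to its modulus leaves only a real
    part to bound. *)
Lemma le_normc_cintegral d (T : measurableType d) (R : realType)
    (mu : {measure set T -> \bar R}) (f : T -> R[i]) : cintegrable mu f ->
  normc (cintegral mu f) <= \int[mu]_x normc (f x).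
Proof.
move=> fi; set z := cintegral mu f.
have [z0|z0] := eqVneq z 0.
  by rewrite z0 normc0; apply: Rintegral_ge0 => x _; exact: normc_ge0.
have nz0 : normc z != 0 by rewrite normc_eq0.
pose c := conjc z * Complex (normc z)^-1 0.
have nc : normc c = 1.
  by rewrite normcM normc_conj normcR ger0_norm ?invr_ge0 ?normc_ge0// mulfV.
have cz : complex.Re (c * z) = normc z.
  have zz : complex.Re (conjc z * z) = normc z ^+ 2.
    by rewrite cReM cReJ cImJ mulNr opprK -!expr2 -normc_sqrE.
  rewrite -mulrA mulrCA cReM zz [complex.Re _]/= [complex.Im (Complex _ _)]/=.
  by rewrite mul0r subr0 expr2 mulKf.
rewrite -cz -cintegralZl//.
apply: (le_trans (Re_cintegral_le (cintegrableZl c fi))).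
rewrite le_eqVlt; apply/orP; left; apply/eqP; apply: eq_Rintegral => x _.
by rewrite normcM nc mul1r.
Qed.

(** * The L_2 contraction property of the Fourier integral *)

Section poisson_product.
Context {R : realType} (n : nat).
Notation lam := (@lebesgue_measure R).
Implicit Types (e : R) (x y w z : 'rV[R]_n).

Definition poisson_weights e w : R := \prod_(i < n) poisson_weight e (w ord0 i).

Definition poisson_kernels e x : R := \prod_(i < n) poisson_kernel e (x ord0 i).

Lemma poisson_weights_gt0 e w : 0 < poisson_weights e w.
Proof. by apply: prodr_gt0 => i _; exact: poisson_weight_gt0. Qed.

Lemma poisson_weights_le1 e w : 0 <= e -> poisson_weights e w <= 1.
Proof.
by move=> e0; apply: prodr_ile1 => i _; rewrite ltW ?poisson_weight_gt0//= poisson_weight_le1.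
Qed.

Lemma poisson_kernels_ge0 e x : 0 <= e -> 0 <= poisson_kernels e x.
Proof. by move=> e0; apply: prodr_ge0 => i _; exact: poisson_kernel_ge0. Qed.

Lemma poisson_kernelsB e x y : poisson_kernels e (x - y) = poisson_kernels e (y - x).
Proof.
apply: eq_bigr => i _; rewrite !mxE -poisson_kernelN opprB.
by congr poisson_kernel.
Qed.

(** Each factor is largest at 0. The bound degenerates as [e] tends to 0; it serves for
    integrability at fixed [e]. *)
Lemma poisson_kernels_le e x : 0 < e -> poisson_kernels e x <= (1 / (pi * e)) ^+ n.
Proof.
move=> e0; rewrite -[in leRHS](card_ord n) -prodr_const.
apply: ler_prod => i _; rewrite poisson_kernel_ge0 ?(ltW e0)//=.
rewrite /poisson_kernel.
have p0 := pi_gt0 R; move: (pi : R) p0 => p p0.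
rewrite ler_pdivrMr; last by rewrite mulr_gt0// ltr_wpDr ?sqr_ge0// exprn_gt0.
rewrite mul1r mulrC ler_pdivlMr; last exact: mulr_gt0.
rewrite (_ : e * (p * e) = p * e ^+ 2); last by ring.
by rewrite ler_pM2l// lerDl sqr_ge0.
Qed.

Lemma measurable_poisson_weights e : measurable_fun setT (poisson_weights e).
Proof.
apply: (measurable_prod_coord (g := fun=> poisson_weight e)) => _.
by apply: continuous_measurable_fun; exact: continuous_poisson_weight.
Qed.

Lemma measurable_poisson_kernels e : 0 < e -> measurable_fun setT (poisson_kernels e).
Proof.
move=> e0; apply: (measurable_prod_coord (g := fun=> poisson_kernel e)) => _.
by apply: continuous_measurable_fun; exact: continuous_poisson_kernel.
Qed.

Lemma complex_prod (u : 'I_n -> R) :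
  Complex (\prod_(i < n) u i) 0 = \prod_(i < n) Complex (u i) 0.
Proof. by rewrite -[LHS]/((\prod_(i < n) u i)%:C)%C rmorph_prod. Qed.

(** Weights and phase both factor over the coordinates, which leaves the one-dimensional
    transform. *)
Lemma poisson_weights_transform e z : 0 < e ->
  cintegrable (Leb R n) (fun w => Complex (poisson_weights e w) 0 * expi (2 * pi * dot w z)) /\
  cintegral (Leb R n) (fun w => Complex (poisson_weights e w) 0 * expi (2 * pi * dot w z)) =
  Complex (poisson_kernels e z) 0.
Proof.
move=> e0.
pose g (i : 'I_n) (t : R) := Complex (poisson_weight e t) 0 * expi (2 * pi * (t * z ord0 i)).
have ig i : cintegrable lam (g i).
  apply: (le_cintegrable _ (poisson_weight_integrable e0)).
    apply: cmeasurableM.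
      apply: cmeasurable_real; apply: continuous_measurable_fun.
      exact: continuous_poisson_weight.
    by apply: cmeasurable_expi; apply: measurable_funM => //; exact: measurable_funM.
  by move=> w; rewrite normcM normcR normc_expi mulr1 gtr0_norm ?poisson_weight_gt0.
have gE : (fun w => Complex (poisson_weights e w) 0 * expi (2 * pi * dot w z)) =
    (fun w : 'rV[R]_n => \prod_(i < n) g i (w ord0 i)).
  apply/funext => w; rewrite /poisson_weights complex_prod.
  rewrite (_ : expi _ = \prod_(i < n) expi (2 * pi * (w ord0 i * z ord0 i))).
    by rewrite -big_split.
  rewrite /dot mulr_sumr; elim/big_rec2: _ => [|i y t _ ih]; first by rewrite expi0.
  by rewrite expiD ih.
have [mG iG EG] := cintegral_prod_coord ig.
rewrite gE; split; first exact: cintegrable_Leb.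
rewrite cintegral_Leb// EG /poisson_kernels complex_prod.
by apply: eq_bigr => i _; exact: cintegral_poisson_weight.
Qed.

Lemma integral_poisson_kernels e x : 0 < e ->
  (\int[Leb R n]_y (poisson_kernels e (x - y))%:E = 1)%E.
Proof.
move=> e0.
have E y : poisson_kernels e (x - y) = \prod_(i < n) poisson_kernel e (x ord0 i - y ord0 i).
  by apply: eq_bigr => i _; rewrite !mxE.
under eq_integral do rewrite E.
pose g (i : 'I_n) (t : R) := poisson_kernel e (x ord0 i - t).
have mg i : measurable_fun setT (g i) by exact: measurable_poisson_kernel.
rewrite (ge0_integral_Leb (f := fun y => (\prod_(i < n) g i (y ord0 i))%:E)).
- rewrite (ge0_integral_prod_coord (c := fun=> 1))//.
  + by rewrite big1.
  + by move=> i t; rewrite poisson_kernel_ge0// ltW.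
  + by move=> i; exact: integral_poisson_kernel.
- by apply/measurable_EFinP; exact: measurable_prod_coord.
- by move=> y; rewrite lee_fin prodr_ge0// => i _; rewrite poisson_kernel_ge0// ltW.
Qed.

End poisson_product.

Lemma dotC {R : realType} n (x y : 'rV[R]_n) : dot x y = dot y x.
Proof. by apply: eq_bigr => i _; rewrite mulrC. Qed.

Lemma dotBr {R : realType} n (w x y : 'rV[R]_n) : dot w (x - y) = dot w x - dot w y.
Proof. by rewrite /dot -sumrB; apply: eq_bigr => i _; rewrite !mxE mulrBr. Qed.

Lemma cvg_poisson_weights {R : realType} n (w : 'rV[R]_n) :
  poisson_weights j.+1%:R^-1 w @[j --> \oo] --> (1 : R).
Proof.
pose F (j : nat) i := poisson_weight j.+1%:R^-1 (w ord0 i).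
have F1 i : F j i @[j --> \oo] --> (1 : R).
  rewrite /F /poisson_weight -[X in _ --> X]expR0.
  apply: continuous_cvg; first exact: continuous_expR.
  rewrite -[X in _ --> X](mul0r `|w ord0 i|); apply: cvgMr_tmp.
  rewrite -[X in _ --> X]oppr0; apply: cvgN.
  rewrite -[X in _ --> X](mulr0 (2 * pi)); apply: cvgMl_tmp.
  exact: cvg_harmonic.
rewrite /poisson_weights; elim: (index_enum _) => [|i s ih].
  by under eq_fun do rewrite big_nil; exact: cvg_cst.
rewrite [X in X @ _](_ : _ = (fun j => F j i * \prod_(k <- s) F j k)); last first.
  by apply/funext => j; rewrite big_cons.
by rewrite -[X in _ --> X]mulr1; apply: cvgM => //; exact: F1.
Qed.

(* In the application [T] is [euclid R n] and [pos] is [to_borel]. *)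
Section fourier1_theory.
Context {d : measure_display} {T : measurableType d} {R : realType} {n : nat}.
Variable mu : {sigma_finite_measure set T -> \bar R}.
Variable pos : T -> 'rV[R]_n.
Implicit Types (u f g : T -> R[i]) (e : R).

Hypothesis measurable_pos : measurable_fun setT pos.
Hypothesis weights_transform : forall e (z : 'rV[R]_n), 0 < e ->
  cintegrable mu (fun w => Complex (poisson_weights e (pos w)) 0 * expi (2 * pi * dot (pos w) z)) /\
  cintegral mu (fun w => Complex (poisson_weights e (pos w)) 0 * expi (2 * pi * dot (pos w) z)) =
  Complex (poisson_kernels e z) 0.
Hypothesis kernels_mass : forall e (x : 'rV[R]_n), 0 < e ->
  (\int[mu]_y (poisson_kernels e (x - pos y))%:E = 1)%E.

Let transform u w := cintegral mu (fun x => u x * expi (- (2 * pi * dot (pos x) (pos w)))).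

Let measurable_coord_pos i : measurable_fun setT (fun t => pos t ord0 i).
Proof. exact: (measurableT_comp (measurable_coord i) measurable_pos). Qed.

Lemma weights_integrable e : 0 < e ->
  mu.-integrable setT (EFin \o (fun w => poisson_weights e (pos w))).
Proof.
move=> e0; have [/cintegrable_normc + _] := weights_transform 0 e0.
apply: eq_integrable => // w _; congr EFin.
by rewrite normcM normcR normc_expi mulr1 gtr0_norm ?poisson_weights_gt0.
Qed.

Lemma measurable_dot : measurable_fun setT (fun p : T * T => dot (pos p.1) (pos p.2)).
Proof.
rewrite /dot; elim: (index_enum _) => [|i s ih].
  by under eq_fun do rewrite big_nil; exact: measurable_cst.
under eq_fun do rewrite big_cons; apply: measurable_funD => //.
have mi := measurable_coord_pos i.
apply: measurable_funM; first exact: (measurableT_comp mi measurable_fst).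
exact: (measurableT_comp mi measurable_snd).
Qed.

Lemma measurable_dotr (x : T) : measurable_fun setT (fun w : T => dot (pos w) (pos x)).
Proof. exact: (measurableT_comp measurable_dot (pair2_measurable x)). Qed.

Lemma cmeasurable_phase (a : R) :
  cmeasurable setT (fun p : T * T => expi (a * dot (pos p.1) (pos p.2))).
Proof.
by apply: cmeasurable_expi; apply: measurable_funM => //; exact: measurable_dot.
Qed.

Lemma cmeasurable_phaser (a : R) (x : T) :
  cmeasurable setT (fun w : T => expi (a * dot (pos w) (pos x))).
Proof.
by apply: cmeasurable_expi; apply: measurable_funM => //; exact: measurable_dotr.
Qed.

Lemma cintegrable_phase u a x : cintegrable mu u ->
  cintegrable mu (fun w => u w * expi (a * dot (pos w) (pos x))).
Proof.
move=> ui; apply: (le_cintegrable _ (cintegrable_normc ui)).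
  by apply: cmeasurableM; [exact: (cintegrable_cmeasurable ui)|exact: cmeasurable_phaser].
by move=> w; rewrite normcM normc_expi mulr1.
Qed.

Lemma transformE u w : transform u w =
  cintegral mu (fun x => u x * expi (- (2 * pi) * dot (pos x) (pos w))).
Proof. by apply: eq_cintegral => x; rewrite mulNr. Qed.

Lemma cmeasurable_transform u : cmeasurable setT u -> cmeasurable setT (transform u).
Proof.
move=> mu'; rewrite (_ : transform u = fun w => cintegral mu
    (fun x => u x * expi (- (2 * pi) * dot (pos w) (pos x)))); last first.
  by apply/funext => w; rewrite transformE; apply: eq_cintegral => x; rewrite dotC.
apply: (cmeasurable_cintegral_section mu (F :=
  fun p : T * T => u p.2 * expi (- (2 * pi) * dot (pos p.1) (pos p.2)))).
apply: cmeasurableM; last exact: cmeasurable_phase.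
exact: (cmeasurable_comp mu' measurable_snd).
Qed.

Lemma normc_transform_le u w : cintegrable mu u ->
  normc (transform u w) <= \int[mu]_x normc (u x).
Proof.
move=> ui; rewrite transformE.
apply: (le_trans (le_normc_cintegral (cintegrable_phase _ _ ui))).
rewrite le_eqVlt; apply/orP; left; apply/eqP; apply: eq_Rintegral => x _.
by rewrite normcM normc_expi mulr1.
Qed.

Lemma conj_transform u w : cintegrable mu u ->
  conjc (transform u w) = cintegral mu (fun x => conjc (u x) * expi (2 * pi * dot (pos w) (pos x))).
Proof.
move=> ui; rewrite transformE -cintegralJ; last exact: cintegrable_phase.
apply: eq_cintegral => x.
by rewrite cJM; congr (_ * _); rewrite conj_expi mulNr opprK dotC.
Qed.

(** Meant for phases and for Fourier integrals, which are merely bounded. *)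
Lemma cintegrable_weights e f (M : R) : 0 < e -> cmeasurable setT f ->
  (forall w, normc (f w) <= M) ->
  cintegrable mu (fun w => Complex (poisson_weights e (pos w)) 0 * f w).
Proof.
move=> e0 mf fM.
have iM : mu.-integrable setT (EFin \o (fun w : T => M * poisson_weights e (pos w))).
  exact: (integrableZl measurableT M (weights_integrable e0)).
refine (le_cintegrable (g := fun w : T => M * poisson_weights e (pos w)) _ iM _).
  apply: cmeasurableM => //; apply: cmeasurable_real.
  by apply: (measurableT_comp _ measurable_pos); exact: measurable_poisson_weights.
move=> w; rewrite normcM normcR gtr0_norm ?poisson_weights_gt0// mulrC.
by rewrite ler_wpM2r// ltW// poisson_weights_gt0.
Qed.

Lemma cmeasurable_kernels e (x : T) : 0 < e ->
  measurable_fun setT (fun y : T => poisson_kernels e (pos x - pos y)).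
Proof.
move=> e0; apply: (measurableT_comp (measurable_poisson_kernels e0)).
apply: measurable_rowP => i; under eq_fun do rewrite !mxE.
by apply: measurable_funB => //; exact: measurable_coord_pos.
Qed.

(** By Fubini the weights are integrated first, against the phase of [pos y - pos x], and produce
    the kernel: up to conjugation, damped inversion is convolution with the Poisson kernel. *)
Lemma transform_weights e u x : 0 < e -> cintegrable mu u ->
  cintegral mu (fun w => Complex (poisson_weights e (pos w)) 0 *
    (conjc (transform u w) * expi (- (2 * pi) * dot (pos w) (pos x)))) =
  cintegral mu (fun y => conjc (u y) * Complex (poisson_kernels e (pos x - pos y)) 0).
Proof.
move=> e0 ui.
pose a (w : T) := Complex (poisson_weights e (pos w)) 0 * expi (- (2 * pi) * dot (pos w) (pos x)).
have ia : cintegrable mu a.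
  apply: (@cintegrable_weights _ _ 1) => //; first exact: cmeasurable_phaser.
  by move=> w; rewrite normc_expi.
transitivity (cintegral mu (fun w => a w * cintegral mu
    (fun y => conjc (u y) * expi (2 * pi * dot (pos w) (pos y))))).
  by apply: eq_cintegral => w; rewrite conj_transform// -mulrA (mulrC (expi _)).
rewrite (cFubini_kernel (m1 := mu) (m2 := mu) (c := fun p : T * T => expi (2 * pi * dot (pos p.1) (pos p.2))) ia
  (cintegrableJ ui) (cmeasurable_phase (2 * pi))); last first.
  by move=> p; rewrite normc_expi.
apply: eq_cintegral => y; congr (_ * _).
rewrite poisson_kernelsB -(weights_transform (pos y - pos x) e0).2.
apply: eq_cintegral => w; rewrite /a -mulrA -expiD; congr (_ * expi _).
by rewrite dotBr; ring.
Qed.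

(** A second use of Fubini unfolds the other copy of [transform u]: the damped energy becomes the
    quadratic form of the Poisson kernel at [u]. *)
Lemma transform_weights_sqr e u : 0 < e -> cintegrable mu u ->
  cintegral mu (fun w => Complex (poisson_weights e (pos w)) 0 *
    (conjc (transform u w) * transform u w)) =
  cintegral mu (fun x => u x *
    cintegral mu (fun y => conjc (u y) * Complex (poisson_kernels e (pos x - pos y)) 0)).
Proof.
move=> e0 ui.
have mfu := cmeasurable_transform (cintegrable_cmeasurable ui).
pose a (w : T) := Complex (poisson_weights e (pos w)) 0 * conjc (transform u w).
have ia : cintegrable mu a.
  apply: (@cintegrable_weights _ _ (\int[mu]_x normc (u x))) => //.
    exact: cmeasurableJ.
  by move=> w; rewrite normc_conj normc_transform_le.
transitivity (cintegral mu (fun w => a w * cintegral mu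
    (fun x => u x * expi (- (2 * pi) * dot (pos w) (pos x))))).
  apply: eq_cintegral => w; rewrite mulrA; congr (_ * _).
  by rewrite transformE; apply: eq_cintegral => x; rewrite dotC.
rewrite (cFubini_kernel (m1 := mu) (m2 := mu) (c := fun p : T * T => expi (- (2 * pi) * dot (pos p.1) (pos p.2))) ia
  ui (cmeasurable_phase (- (2 * pi)))); last first.
  by move=> p; rewrite normc_expi.
apply: eq_cintegral => x; congr (_ * _).
rewrite -transform_weights//; apply: eq_cintegral => w.
by rewrite /a mulrA.
Qed.

Let kernels_mass_swap e (y : 'rV[R]_n) : 0 < e ->
  (\int[mu]_x (poisson_kernels e (pos x - y))%:E = 1)%E.
Proof.
move=> e0; rewrite -(kernels_mass y e0).
by apply: eq_integral => x _; rewrite poisson_kernelsB.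
Qed.

Lemma measurable_kernels_sub e : 0 < e ->
  measurable_fun setT (fun p : T * T => poisson_kernels e (pos p.1 - pos p.2)).
Proof.
move=> e0; apply: (measurableT_comp (measurable_poisson_kernels e0)).
apply: measurable_rowP => i; under eq_fun do rewrite !mxE.
have mi := measurable_coord_pos i.
apply: measurable_funB; first exact: (measurableT_comp mi measurable_fst).
exact: (measurableT_comp mi measurable_snd).
Qed.

Lemma cintegrable_kernels e u x : 0 < e -> cintegrable mu u ->
  cintegrable mu (fun y => conjc (u y) * Complex (poisson_kernels e (pos x - pos y)) 0).
Proof.
move=> e0 ui; pose M : R := (1 / (pi * e)) ^+ n.
have iM : mu.-integrable setT (EFin \o (fun y : T => M * normc (u y))).
  exact: (integrableZl measurableT M (cintegrable_normc ui)).
refine (le_cintegrable (g := fun y : T => M * normc (u y)) _ iM _).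
  apply: cmeasurableM; first exact/cmeasurableJ/(cintegrable_cmeasurable ui).
  by apply: cmeasurable_real; exact: cmeasurable_kernels.
move=> y; rewrite normcM normc_conj normcR ger0_norm ?poisson_kernels_ge0 ?(ltW e0)//.
by rewrite mulrC ler_wpM2r ?normc_ge0// poisson_kernels_le.
Qed.

(* [|u(x) u(y)| <= (|u(x)|^2 + |u(y)|^2) / 2], and the kernel has mass 1 in each
   variable. *)
Lemma kernels_quadratic_le e u : 0 < e -> cintegrable mu u -> L2 mu u ->
  ((complex.Re (cintegral mu (fun x => u x *
    cintegral mu (fun y => conjc (u y) * Complex (poisson_kernels e (pos x - pos y)) 0))))%:E
  <= sqn mu u)%E.
Proof.
move=> e0 ui uL; have mu' := cintegrable_cmeasurable ui.
have K0 (x : 'rV[R]_n) : 0 <= poisson_kernels e x by rewrite poisson_kernels_ge0// ltW.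
have mK := measurable_kernels_sub e0.
pose I x := cintegral mu (fun y => conjc (u y) * Complex (poisson_kernels e (pos x - pos y)) 0).
have mI : cmeasurable setT I.
  apply: (cmeasurable_cintegral_section mu (F := fun p : T * T =>
    conjc (u p.2) * Complex (poisson_kernels e (pos p.1 - pos p.2)) 0)).
  apply: cmeasurableM; last exact: cmeasurable_real.
  apply: cmeasurableJ; exact: (cmeasurable_comp mu' measurable_snd).
pose J (x : T) := (\int[mu]_y (normc (u y) * poisson_kernels e (pos x - pos y))%:E)%E.
have IJ x : ((normc (I x))%:E <= J x)%E.
  have ik := cintegrable_kernels x e0 ui.
  have := le_normc_cintegral ik; rewrite -lee_fin => /le_trans; apply.
  rewrite /Rintegral fineK; last first.
    by apply: integrable_fin_num => //; exact: (cintegrable_normc ik).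
  rewrite le_eqVlt; apply/orP; left; apply/eqP; apply: eq_integral => y _.
  by rewrite normcM normc_conj normcR ger0_norm.
(* A crude bound uniform in [x], from the maximum of the kernel; it makes [u * I] integrable. *)
have Ib : exists C, forall x, normc (I x) <= C.
  exists (\int[mu]_y (normc (u y) * (1 / (pi * e)) ^+ n)) => x.
  have ik := cintegrable_kernels x e0 ui.
  apply: (le_trans (le_normc_cintegral ik)); apply: le_Rintegral => //.
  - exact: (cintegrable_normc ik).
  - have := integrableZr measurableT ((1 / (pi * e)) ^+ n) (cintegrable_normc ui).
    exact.
  - move=> y _; rewrite normcM normc_conj normcR ger0_norm//.
    by rewrite ler_wpM2l ?normc_ge0// poisson_kernels_le.
have iuI : cintegrable mu (fun x => u x * I x).
  have [C hC] := Ib.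
  have iC : mu.-integrable setT (EFin \o (fun x => C * normc (u x))).
    exact: (integrableZl measurableT C (cintegrable_normc ui)).
  refine (le_cintegrable (g := fun x => C * normc (u x)) _ iC _).
    exact: cmeasurableM.
  by move=> x; rewrite normcM mulrC ler_wpM2r ?normc_ge0.
have := Re_cintegral_le iuI; rewrite -lee_fin => /le_trans; apply.
rewrite /Rintegral fineK; last first.
  by apply: integrable_fin_num => //; exact: (cintegrable_normc iuI).
pose A x := normc (u x) ^+ 2.
have mA : measurable_fun setT A by exact: measurable_sqr_normc.
have A0 x : 0 <= A x by exact: sqr_ge0.
have mn := measurable_normc mu'.
have mAK1 : measurable_fun setT (fun p : T * T => (A p.1 * poisson_kernels e (pos p.1 - pos p.2))%:E).
  apply/measurable_EFinP; apply: measurable_funM => //.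
  exact: (measurableT_comp mA measurable_fst).
have mAK2 : measurable_fun setT (fun p : T * T => (A p.2 * poisson_kernels e (pos p.1 - pos p.2))%:E).
  apply/measurable_EFinP; apply: measurable_funM => //.
  exact: (measurableT_comp mA measurable_snd).
have AK1_0 (p : T * T) : (0 <= (A p.1 * poisson_kernels e (pos p.1 - pos p.2))%:E)%E.
  by rewrite lee_fin mulr_ge0.
have AK2_0 (p : T * T) : (0 <= (A p.2 * poisson_kernels e (pos p.1 - pos p.2))%:E)%E.
  by rewrite lee_fin mulr_ge0.
have mKx x : measurable_fun setT (fun y : T => poisson_kernels e (pos x - pos y)).
  exact: cmeasurable_kernels.
have mKy y : measurable_fun setT (fun x : T => poisson_kernels e (pos x - pos y)).
  by under eq_fun do rewrite poisson_kernelsB; exact: cmeasurable_kernels.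
have E1 : (\int[mu]_x \int[mu]_y (A x * poisson_kernels e (pos x - pos y))%:E = sqn mu u)%E.
  apply: eq_integral => x _; under eq_integral do rewrite EFinM.
  rewrite ge0_integralZl ?lee_fin//.
  - by rewrite kernels_mass// mule1.
  - exact/measurable_EFinP.
  - by move=> y _; rewrite lee_fin.
have E2 : (\int[mu]_x \int[mu]_y (A y * poisson_kernels e (pos x - pos y))%:E = sqn mu u)%E.
  rewrite (fubini_tonelli (m1 := mu) (m2 := mu) _ mAK2 AK2_0).
  apply: eq_integral => y _; under eq_integral do rewrite /= EFinM.
  rewrite ge0_integralZl ?lee_fin//.
  - by rewrite kernels_mass_swap// mule1.
  - exact/measurable_EFinP.
  - by move=> x _; rewrite lee_fin.
have mJ1 := measurable_fun_fubini_tonelli_F (m2 := mu) _ mAK1 AK1_0.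
have mJ2 := measurable_fun_fubini_tonelli_F (m2 := mu) _ mAK2 AK2_0.
pose h x := (2^-1%:E * \int[mu]_y (A x * poisson_kernels e (pos x - pos y))%:E +
  2^-1%:E * \int[mu]_y (A y * poisson_kernels e (pos x - pos y))%:E)%E.
have h1 x : (0 <= \int[mu]_y (A x * poisson_kernels e (pos x - pos y))%:E)%E.
  by apply: integral_ge0 => y _; rewrite lee_fin mulr_ge0.
have h2 x : (0 <= \int[mu]_y (A y * poisson_kernels e (pos x - pos y))%:E)%E.
  by apply: integral_ge0 => y _; rewrite lee_fin mulr_ge0.
have half0 : (0 <= (2^-1 : R)%:E)%E by rewrite lee_fin invr_ge0.
apply: (@le_trans _ _ (\int[mu]_x h x)%E).
  apply: ge0_le_integral => //.
  - by move=> x _; rewrite lee_fin normc_ge0.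
  - exact/measurable_EFinP/measurable_normc/cmeasurableM.
  - by apply: emeasurable_funD; apply: measurable_funeM.
  move=> x _; rewrite normcM EFinM.
  apply: (le_trans (lee_wpmul2l _ (IJ x))); first by rewrite lee_fin normc_ge0.
  rewrite /J /h -ge0_integralZl ?lee_fin ?normc_ge0//; last 2 first.
  - by apply/measurable_EFinP; apply: measurable_funM.
  - by move=> y _; rewrite lee_fin mulr_ge0// normc_ge0.
  rewrite -!ge0_integralZl//; last first.
  - by move=> y _; rewrite lee_fin mulr_ge0.
  - by apply/measurable_EFinP; apply: measurable_funM.
  - by move=> y _; rewrite lee_fin mulr_ge0.
  - by apply/measurable_EFinP; apply: measurable_funM.
  rewrite -ge0_integralD//; last first.
  - by apply: measurable_funeM; apply/measurable_EFinP; apply: measurable_funM.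
  - by move=> y _; rewrite mule_ge0// lee_fin mulr_ge0.
  - by apply: measurable_funeM; apply/measurable_EFinP; apply: measurable_funM.
  - by move=> y _; rewrite mule_ge0// lee_fin mulr_ge0.
  apply: ge0_le_integral => //.
  - by move=> y _; rewrite mule_ge0// lee_fin ?mulr_ge0// normc_ge0.
  - by apply: measurable_funeM; apply/measurable_EFinP; apply: measurable_funM.
  - by apply: emeasurable_funD; apply: measurable_funeM; apply/measurable_EFinP; apply: measurable_funM.
  move=> y _; rewrite -!EFinM -EFinD lee_fin !mulrA -mulrDl ler_wpM2r//.
  have := sqr_ge0 (normc (u x) - normc (u y)); rewrite /A; lra.
rewrite ge0_integralD//; last first.
- exact: measurable_funeM.
- by move=> x _; rewrite mule_ge0.
- exact: measurable_funeM.
- by move=> x _; rewrite mule_ge0.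
rewrite !ge0_integralZl// E1 E2 -ge0_muleDl// -EFinD.
by rewrite (_ : 2^-1 + 2^-1 = 1 :> R) ?mul1e//; lra.
Qed.

Lemma sqn_transform_le u : cintegrable mu u -> L2 mu u ->
  (sqn mu (transform u) <= sqn mu u)%E.
Proof.
move=> ui uL; have mfu := cmeasurable_transform (cintegrable_cmeasurable ui).
have e0 (j : nat) : 0 < j.+1%:R^-1 :> R by rewrite invr_gt0.
apply: (@fatou_cvg _ _ _ mu (fun j w =>
  (poisson_weights j.+1%:R^-1 (pos w) * normc (transform u w) ^+ 2)%:E)).
- move=> j; apply/measurable_EFinP; apply: measurable_funM.
    by apply: (measurableT_comp _ measurable_pos); exact: measurable_poisson_weights.
  exact: measurable_sqr_normc.
- by apply/measurable_EFinP; exact: measurable_sqr_normc.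
- by move=> j w; rewrite lee_fin mulr_ge0 ?sqr_ge0// ltW// poisson_weights_gt0.
- by move=> w; rewrite lee_fin sqr_ge0.
- apply: filterE => w; apply: cvg_EFin; first exact: nearW.
  rewrite -[X in _ --> X]mul1r; apply: cvgMr_tmp; exact: cvg_poisson_weights.
- apply: nearW => j; set e := _^-1.
  have zz z : complex.Re (conjc z * z) = normc z ^+ 2 :> R.
    by rewrite cReM cReJ cImJ mulNr opprK -!expr2 -normc_sqrE.
  have ReE w : complex.Re (Complex (poisson_weights e (pos w)) 0 * (conjc (transform u w) * transform u w))
      = poisson_weights e (pos w) * normc (transform u w) ^+ 2.
    by rewrite cReM zz /= mul0r subr0.
  have ic : cintegrable mu (fun w => Complex (poisson_weights e (pos w)) 0 *
      (conjc (transform u w) * transform u w)).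
    pose M := \int[mu]_x normc (u x).
    apply: (@cintegrable_weights _ _ (M * M)); first exact: e0.
      by apply: cmeasurableM => //; exact: cmeasurableJ.
    move=> w; rewrite normcM normc_conj.
    by apply: ler_pM; rewrite ?normc_ge0 ?normc_transform_le.
  (* The damped energy equals this quadratic form, whose bound does not depend on [j]. *)
  have := kernels_quadratic_le (e0 j) ui uL.
  rewrite -transform_weights_sqr// => /(le_trans _); apply.
  rewrite /= fineK; last by apply: integrable_fin_num => //; case: ic.
  rewrite le_eqVlt; apply/orP; left; apply/eqP; apply: eq_integral => w _.
  by rewrite -ReE.
Qed.

End fourier1_theory.

Section fourier1_Leb.
Context {R : realType} {n : nat}.
Local Notation E := (euclid R n).
Local Notation mu := (Leb R n).
Implicit Types (u f g : E -> R[i]) (e : R).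

Let weights_transformL e (z : 'rV[R]_n) : 0 < e ->
  cintegrable (sLeb n) (fun w => Complex (poisson_weights e (to_borel w)) 0 * expi (2 * pi * dot (to_borel w) z)) /\
  cintegral (sLeb n) (fun w => Complex (poisson_weights e (to_borel w)) 0 * expi (2 * pi * dot (to_borel w) z)) =
  Complex (poisson_kernels e z) 0.
Proof. exact: poisson_weights_transform. Qed.

Let kernels_massL e (x : 'rV[R]_n) : 0 < e ->
  (\int[sLeb n]_y (poisson_kernels e (x - to_borel y))%:E = 1)%E.
Proof. exact: integral_poisson_kernels. Qed.

Lemma cmeasurable_fourier1 u : cmeasurable setT u -> cmeasurable setT (fourier1 u).
Proof. exact: (cmeasurable_transform (sLeb n) (@measurable_to_borel R n)). Qed.

Lemma normc_fourier1_le u w : cintegrable mu u ->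
  normc (fourier1 u w) <= \int[mu]_x normc (u x).
Proof. exact: (normc_transform_le (mu := sLeb n) (@measurable_to_borel R n)). Qed.

Lemma sqn_fourier1_le u : cintegrable mu u -> L2 mu u ->
  (sqn mu (fourier1 u) <= sqn mu u)%E.
Proof.
exact: (sqn_transform_le (mu := sLeb n) (@measurable_to_borel R n) weights_transformL kernels_massL).
Qed.

Lemma cintegrable_weights_Leb e f (M : R) : 0 < e -> cmeasurable setT f ->
  (forall w, normc (f w) <= M) ->
  cintegrable mu (fun w => Complex (poisson_weights e w) 0 * f w).
Proof.
exact: (cintegrable_weights (mu := sLeb n) (@measurable_to_borel R n) weights_transformL).
Qed.

(** [transform_weights] with its left side read as a [fourier1], for transforming back the damped
    transform of a box. *)
Lemma fourier1_weights_conv e u x : 0 < e -> cintegrable mu u ->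
  fourier1 (fun w => Complex (poisson_weights e w) 0 * conjc (fourier1 u w)) x =
  cintegral mu (fun y => conjc (u y) * Complex (poisson_kernels e (to_borel x - to_borel y)) 0).
Proof.
move=> e0 ui.
rewrite -(transform_weights (mu := sLeb n) (@measurable_to_borel R n) weights_transformL x e0 ui).
apply: eq_cintegral => w; rewrite -mulrA; congr (_ * (_ * expi _)).
by rewrite mulNr.
Qed.

End fourier1_Leb.

(** * Poisson smoothing of boxes *)

Section interval_smoothing.
Context {R : realType}.
Notation lam := (@lebesgue_measure R).
Implicit Types (e a b t : R).

(** Closed form of the convolution of the indicator of []a, b]] with [poisson_kernel e]. *)
Definition smoothed_itv e a b t : R := (atan ((b - t) / e) - atan ((a - t) / e)) / pi.

Lemma integral_smoothed_itv_def e a b t : 0 < e -> a < b ->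
  (\int[lam]_s (\1_(`]a, b]) s * poisson_kernel e (t - s))%:E = (smoothed_itv e a b t)%:E)%E.
Proof.
move=> e0 ab; rewrite /smoothed_itv -poisson_massE// /poisson_mass.
rewrite [RHS]integral_mkcond; apply: eq_integral => s _.
by rewrite patchE indicE; case: ifPn => //= _; rewrite ?mul1r ?mul0r.
Qed.

Lemma smoothed_itv_ge0 e a b t : 0 < e -> a < b -> 0 <= smoothed_itv e a b t.
Proof.
move=> e0 ab; rewrite divr_ge0 ?pi_ge0// subr_ge0; apply: le_atan.
by rewrite ler_pM2r ?invr_gt0// lerD2r ltW.
Qed.

Lemma smoothed_itv_le1 e a b t : smoothed_itv e a b t <= 1.
Proof.
rewrite ler_pdivrMr ?pi_gt0// mul1r.
have := atan_ltpi2 ((b - t) / e); have := atan_gtNpi2 ((a - t) / e).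
by move: (pi : R) => p; lra.
Qed.

Lemma measurable_smoothed_itv e a b : measurable_fun setT (smoothed_itv e a b).
Proof.
apply: continuous_measurable_fun => x.
by apply/differentiable_continuous/derivable1_diffP; exact: ex_derive.
Qed.

(** By Tonelli, smoothing preserves the integral, because the kernel has mass 1 in either
    variable. *)
Lemma integral_smoothed_itv e a b : 0 < e -> a < b ->
  (\int[lam]_t (smoothed_itv e a b t)%:E = (b - a)%:E)%E.
Proof.
move=> e0 ab.
pose F (p : measurableTypeR R * measurableTypeR R) : \bar R :=
  (\1_(`]a, b]) p.2 * poisson_kernel e (p.1 - p.2))%:E.
have F0 p : (0 <= F p)%E by rewrite lee_fin mulr_ge0// poisson_kernel_ge0// ltW.
have mF : measurable_fun setT F.
  apply/measurable_EFinP; apply: measurable_funM.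
    apply: (measurableT_comp _ measurable_snd); exact: measurable_indic.
  apply: (measurableT_comp (f := poisson_kernel e)).
    by apply: continuous_measurable_fun; exact: continuous_poisson_kernel.
  by apply: measurable_funB; [exact: measurable_fst|exact: measurable_snd].
transitivity (\int[lam]_t \int[lam]_s F (t, s))%E.
  by apply: eq_integral => t _; rewrite integral_smoothed_itv_def.
rewrite (fubini_tonelli _ mF F0).
transitivity (\int[lam]_s (\1_(`]a, b] : set R) s)%:E)%E.
  apply: eq_integral => s _; rewrite /F /=; under eq_integral do rewrite EFinM.
  rewrite ge0_integralZl//.
  - by rewrite integral_poisson_kernel_swap// mule1.
  - apply/measurable_EFinP; apply: (measurableT_comp (f := poisson_kernel e)).
      by apply: continuous_measurable_fun; exact: continuous_poisson_kernel.
    exact: measurable_funB.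
  - by move=> t _; rewrite lee_fin poisson_kernel_ge0// ltW.
by rewrite integral_indic//= setIT lebesgue_measure_itv/= lte_fin ab -EFinB.
Qed.

Lemma integral_smoothed_itv_in e a b : 0 < e -> a < b ->
  (\int[lam]_t (smoothed_itv e a b t * \1_(`]a, b]) t)%:E =
   \int[lam]_(t in `]a, b]) poisson_mass e a b t)%E.
Proof.
move=> e0 ab; rewrite [RHS]integral_mkcond; apply: eq_integral => t _.
rewrite patchE indicE; case: ifPn => //= _; rewrite ?mulr1 ?mulr0//.
by rewrite poisson_massE.
Qed.

(** The integrals are handed out as real numbers [c j], so that the limits for the separate
    coordinates can be multiplied. *)
Lemma cvg_integral_smoothed_itv a b : a < b ->
  exists c : nat -> R, c @ \oo --> b - a /\ forall j,
   (\int[lam]_t (smoothed_itv j.+1%:R^-1 a b t * \1_(`]a, b]) t)%:E = (c j)%:E)%E.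
Proof.
move=> ab; have e0 (j : nat) : 0 < j.+1%:R^-1 :> R by rewrite invr_gt0.
pose I j := (\int[lam]_(t in `]a, b]) poisson_mass j.+1%:R^-1 a b t)%E.
have cI := cvg_poisson_mass ab.
have Ifin j : I j \is a fin_num.
  rewrite /I -integral_smoothed_itv_in// ge0_fin_numE; last first.
    by apply: integral_ge0 => t _; rewrite lee_fin mulr_ge0// smoothed_itv_ge0.
  apply: (@le_lt_trans _ _ (\int[lam]_t (smoothed_itv j.+1%:R^-1 a b t)%:E)%E).
    apply: ge0_le_integral => //.
    - by move=> t _; rewrite lee_fin mulr_ge0// smoothed_itv_ge0.
    - apply/measurable_EFinP; apply: measurable_funM; first exact: measurable_smoothed_itv.
      exact: measurable_indic.
    - by apply/measurable_EFinP; exact: measurable_smoothed_itv.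
    - move=> t _; rewrite lee_fin ler_piMr ?smoothed_itv_ge0//.
  by rewrite integral_smoothed_itv// ltry.
exists (fun j => fine (I j)); split; first exact: (fine_cvg cI).
by move=> j; rewrite fineK// integral_smoothed_itv_in.
Qed.

End interval_smoothing.

Lemma integral_indicT d (T : measurableType d) (R : realType)
    (mu : {measure set T -> \bar R}) (A : set T) : measurable A ->
  (\int[mu]_x (\1_A x)%:E = mu A)%E.
Proof. by move=> mA; rewrite integral_indic// setIT. Qed.

(* [(q - 1_A)^2 <= q + 1_A - 2 q 1_A] because [0 <= q <= 1]. *)
Lemma sqn_sub_indic_le d (T : measurableType d) (R : realType)
    (mu : {measure set T -> \bar R}) (q : T -> R) (A : set T) (V c : R) :
  measurable A -> measurable_fun setT q -> (forall x, 0 <= q x) -> (forall x, q x <= 1) ->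
  (\int[mu]_x (q x)%:E = V%:E)%E -> (\int[mu]_x (\1_A x)%:E = V%:E)%E ->
  (\int[mu]_x (q x * \1_A x)%:E = c%:E)%E ->
  (sqn mu (fun x => Complex (q x) 0 - Complex (\1_A x) 0)%R <= (2 * V - 2 * c)%:E)%E.
Proof.
move=> mA mq q0 q1 qV AV qc.
have mI : measurable_fun setT (\1_A : T -> R) by exact: measurable_indic.
have -> : (sqn mu (fun x => Complex (q x) 0 - Complex (\1_A x) 0)%R =
  \int[mu]_x ((q x - \1_A x) ^+ 2)%:E)%E.
  apply: eq_integral => x _; congr EFin.
  by rewrite normc_sqrE cReD cImD cReN cImN /= oppr0 addr0 expr0n addr0.
rewrite EFinB leeBrDr//.
have -> : ((2 * c)%:E = \int[mu]_x (2 * (q x * \1_A x))%:E)%E.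
  under [RHS]eq_integral do rewrite EFinM.
  rewrite ge0_integralZl//; first by rewrite qc EFinM.
  - by apply/measurable_EFinP; exact: measurable_funM.
  - by move=> x _; rewrite lee_fin mulr_ge0.
rewrite -ge0_integralD//; last first.
- by apply/measurable_EFinP; apply: measurable_funM => //; exact: measurable_funM.
- by move=> x _; rewrite lee_fin mulr_ge0// mulr_ge0.
- by apply/measurable_EFinP; apply: measurable_funX; exact: measurable_funB.
- by move=> x _; rewrite lee_fin sqr_ge0.
have -> : ((2 * V)%:E = \int[mu]_x ((q x)%:E + (\1_A x)%:E))%E.
  rewrite ge0_integralD//; last first.
  - exact/measurable_EFinP.
  - exact/measurable_EFinP.
  - by move=> x _; rewrite lee_fin.
  by rewrite qV AV -EFinD mulr2n mulrDl mul1r.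
apply: ge0_le_integral => //.
- by move=> x _; rewrite -EFinD lee_fin addr_ge0 ?sqr_ge0// mulr_ge0// mulr_ge0.
- apply/measurable_EFinP; apply: measurable_funD.
    by apply: measurable_funX; exact: measurable_funB.
  by apply: measurable_funM => //; exact: measurable_funM.
- by apply: emeasurable_funD; exact/measurable_EFinP.
move=> x _; rewrite -!EFinD lee_fin.
have := q0 x; have := q1 x.
by rewrite indicE; case: (_ \in _); rewrite /= ?mulr1n ?mulr0n; move: (q x) => r; nra.
Qed.

Section boxes.
Context {R : realType} {n : nat}.
Local Notation E := (euclid R n).
Local Notation mu := (Leb R n).
Notation lam := (@lebesgue_measure R).
Implicit Types (a b : 'I_n -> R) (e : R).

Definition box a b : set 'rV[R]_n := [set x | forall i, x ord0 i \in `]a i, b i]].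

Lemma indic_boxE a b (x : 'rV[R]_n) :
  \1_(box a b) x = \prod_(i < n) \1_(`]a i, b i]) (x ord0 i) :> R.
Proof.
rewrite indicE; have [xab|xab] := pselect (box a b x).
  rewrite mem_set// big1// => i _.
  by rewrite indicE mem_set//; exact: xab.
rewrite memNset//; have /existsNP[i xi] := xab.
by rewrite (bigD1 i)//= indicE memNset//= mul0r.
Qed.

Lemma measurable_box a b : measurable (box a b).
Proof.
apply/(@measurable_indicP _ _ R).
rewrite (_ : \1_(box a b) = fun x => \prod_(i < n) \1_(`]a i, b i]) (x ord0 i)); last first.
  by apply/funext => x; exact: indic_boxE.
by apply: (measurable_prod_coord (g := fun i => \1_(`]a i, b i]))) => i;
  exact: measurable_indic.
Qed.

Definition boxf a b (x : E) : R[i] := Complex (\1_(box a b) (to_borel x)) 0.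

Definition box_volume a b : R := \prod_(i < n) (b i - a i).

Definition smoothed_box e a b (x : 'rV[R]_n) : R :=
  \prod_(i < n) smoothed_itv e (a i) (b i) (x ord0 i).

Variables (a b : 'I_n -> R).
Hypothesis ab : forall i, a i < b i.

Lemma measurable_smoothed_box e : measurable_fun setT (smoothed_box e a b).
Proof.
apply: (measurable_prod_coord (g := fun i => smoothed_itv e (a i) (b i))) => i.
exact: measurable_smoothed_itv.
Qed.

Lemma smoothed_box_ge0 e x : 0 < e -> 0 <= smoothed_box e a b x.
Proof. by move=> e0; apply: prodr_ge0 => i _; exact: smoothed_itv_ge0. Qed.

Lemma smoothed_box_le1 e x : 0 < e -> smoothed_box e a b x <= 1.
Proof.
by move=> e0; apply: prodr_ile1 => i _; rewrite smoothed_itv_ge0//= smoothed_itv_le1.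
Qed.

Lemma integral_box : (\int[mu]_x (\1_(box a b) x)%:E = (box_volume a b)%:E)%E.
Proof.
under eq_integral do rewrite indic_boxE.
rewrite (ge0_integral_Leb (f := fun x : 'rV[R]_n => (\prod_(i < n) \1_(`]a i, b i]) (x ord0 i))%:E)).
- apply: (ge0_integral_prod_coord (g := fun i => \1_(`]a i, b i]))) => // i.
  by rewrite integral_indic//= setIT lebesgue_measure_itv/= lte_fin ab -EFinB.
- apply/measurable_EFinP.
  by apply: (measurable_prod_coord (g := fun i => \1_(`]a i, b i]))).
- by move=> x; rewrite lee_fin prodr_ge0.
Qed.

Lemma integral_box_kernels e x : 0 < e ->
  (\int[mu]_y (\1_(box a b) y * poisson_kernels e (x - y))%:E = (smoothed_box e a b x)%:E)%E.
Proof.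
move=> e0.
pose g (i : 'I_n) t := \1_(`]a i, b i]) t * poisson_kernel e (x ord0 i - t).
have mg i : measurable_fun setT (g i).
  by apply: measurable_funM => //; exact: measurable_poisson_kernel.
have g0 i t : 0 <= g i t by rewrite mulr_ge0// poisson_kernel_ge0// ltW.
transitivity (\int[mu]_y (\prod_(i < n) g i (y ord0 i))%:E)%E.
  apply: eq_integral => y _; rewrite indic_boxE -big_split; congr EFin.
  by apply: eq_bigr => i _; rewrite !mxE.
rewrite (ge0_integral_Leb (f := fun y : 'rV[R]_n => (\prod_(i < n) g i (y ord0 i))%:E)).
- apply: ge0_integral_prod_coord => // i; exact: integral_smoothed_itv_def.
- by apply/measurable_EFinP; exact: measurable_prod_coord.
- by move=> y; rewrite lee_fin prodr_ge0.
Qed.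

Lemma integral_smoothed_box e : 0 < e ->
  (\int[mu]_x (smoothed_box e a b x)%:E = (box_volume a b)%:E)%E.
Proof.
move=> e0; rewrite (ge0_integral_Leb (f := EFin \o smoothed_box e a b)).
- apply: (ge0_integral_prod_coord (g := fun i => smoothed_itv e (a i) (b i))) => i.
  + exact: measurable_smoothed_itv.
  + by move=> t; exact: smoothed_itv_ge0.
  + exact: integral_smoothed_itv.
- by apply/measurable_EFinP; exact: measurable_smoothed_box.
- by move=> x; rewrite lee_fin smoothed_box_ge0.
Qed.

Lemma cvg_integral_smoothed_box :
  exists c : nat -> R, c @ \oo --> box_volume a b /\ forall j,
   (\int[mu]_x (smoothed_box j.+1%:R^-1 a b x * \1_(box a b) x)%:E = (c j)%:E)%E.
Proof.
have /choice[c hc] := fun i => cvg_integral_smoothed_itv (ab i).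
exists (fun j => \prod_(i < n) c i j); split.
  rewrite /box_volume; elim: (index_enum _) => [|i s ih].
    by under eq_fun do rewrite big_nil; rewrite big_nil; exact: cvg_cst.
  rewrite [X in X @ _](_ : _ = (fun j => c i j * \prod_(k <- s) c k j)); last first.
    by apply/funext => j; rewrite big_cons.
  by rewrite big_cons; apply: cvgM => //; exact: (hc i).1.
move=> j; set e := _^-1; have e0 : 0 < e by rewrite invr_gt0.
pose g (i : 'I_n) t := smoothed_itv e (a i) (b i) t * \1_(`]a i, b i]) t.
have mg i : measurable_fun setT (g i).
  by apply: measurable_funM => //; exact: measurable_smoothed_itv.
have g0 i t : 0 <= g i t by rewrite mulr_ge0// smoothed_itv_ge0.
transitivity (\int[mu]_x (\prod_(i < n) g i (x ord0 i))%:E)%E.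
  by apply: eq_integral => x _; rewrite indic_boxE -big_split.
rewrite (ge0_integral_Leb (f := fun y : 'rV[R]_n => (\prod_(i < n) g i (y ord0 i))%:E)).
- apply: ge0_integral_prod_coord => // i; exact: (hc i).2.
- by apply/measurable_EFinP; exact: measurable_prod_coord.
- by move=> y; rewrite lee_fin prodr_ge0.
Qed.

Lemma cmeasurable_boxf : cmeasurable setT (boxf a b).
Proof.
apply: cmeasurable_real; apply: (measurableT_comp _ (@measurable_to_borel R n)).
by apply/measurable_indicP; exact: measurable_box.
Qed.

Lemma conj_boxf x : conjc (boxf a b x) = boxf a b x.
Proof. by rewrite /boxf /= oppr0. Qed.

Lemma normc_boxf x : normc (boxf a b x) = \1_(box a b) x.
Proof. by rewrite normcR ger0_norm. Qed.

Lemma cintegrable_boxf : cintegrable mu (boxf a b).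
Proof.
apply: cintegrableP; first exact: cmeasurable_boxf.
by under eq_integral do rewrite normc_boxf; rewrite integral_box ltry.
Qed.

Lemma L2_boxf : L2 mu (boxf a b).
Proof.
apply/L2P; split; first exact: cmeasurable_boxf.
rewrite /sqn; under eq_integral => x _.
  rewrite normc_boxf (_ : \1_(box a b) x ^+ 2 = \1_(box a b) x); last first.
    by rewrite indicE; case: (_ \in _); rewrite /= ?expr0n ?expr1n.
  over.
by rewrite integral_box ltry.
Qed.

Lemma boxf_convE e x : 0 < e ->
  cintegral mu (fun y => conjc (boxf a b y) * Complex (poisson_kernels e (to_borel x - to_borel y)) 0)
  = Complex (smoothed_box e a b (to_borel x)) 0.
Proof.
move=> e0.
transitivity (cintegral mu (fun y : E =>
    Complex (\1_(box a b) y * poisson_kernels e (to_borel x - to_borel y)) 0)).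
  apply: eq_cintegral => y; rewrite conj_boxf.
  by apply: complex_eqP; rewrite /boxf ?cReM ?cImM /= ?mul0r ?mulr0 ?subr0 ?addr0.
apply: complex_eqP => /=; rewrite /Rintegral.
  by rewrite integral_box_kernels.
by rewrite integral0.
Qed.

(** The squared distance is at most [2 V - 2 c j], where the integral [c j] of the smoothed box over
    the box tends to the volume [V]. *)
Lemma L2cvg_smoothed_box :
  L2cvg mu (fun j x => Complex (smoothed_box j.+1%:R^-1 a b (to_borel x)) 0) (boxf a b).
Proof.
have [c [cV hc]] := cvg_integral_smoothed_box.
have e0 (j : nat) : 0 < j.+1%:R^-1 :> R by rewrite invr_gt0.
set V := box_volume a b in cV *.
have mI : measurable_fun setT (fun x : E => \1_(box a b) x : R).
  by apply: measurable_fun_euclid; apply/measurable_indicP; exact: measurable_box.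
have mQ j : measurable_fun setT (fun x : E => smoothed_box j.+1%:R^-1 a b x).
  by apply: measurable_fun_euclid; exact: measurable_smoothed_box.
have key j : (sqn mu (fun x => Complex (smoothed_box j.+1%:R^-1 a b (to_borel x)) 0 - boxf a b x)%R
   <= (2 * V - 2 * c j)%:E)%E.
  have mB := measurable_euclid (measurable_box a b).
  apply: (sqn_sub_indic_le mB (mQ j) _ _ (integral_smoothed_box (e0 j)) integral_box (hc j)).
    by move=> x; exact: smoothed_box_ge0.
  by move=> x; exact: smoothed_box_le1.
apply/L2cvgP; apply: (squeeze_cvge (f := fun=> 0%E) (h := fun j => (2 * V - 2 * c j)%:E)).
- by apply: nearW => j; rewrite sqn_ge0 key.
- exact: cvg_cst.
- apply: cvg_EFin; first exact: nearW.
  rewrite -[X in _ --> X](subrr (2 * V)); apply: cvgB; first exact: cvg_cst.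
  exact: cvgMl_tmp.
Qed.

End boxes.

(** * Density of the boxes in L_2 *)

Definition cindic {T : Type} {R : realType} (A : set T) (x : T) : R[i] :=
  Complex (\1_A x) 0.

Lemma normc_cindic {T : Type} {R : realType} (A : set T) x :
  normc (cindic A x : R[i]) = \1_A x.
Proof. by rewrite normcR ger0_norm. Qed.

Lemma cindicE {T : Type} {R : realType} (A : set T) x : cindic A x = (x \in A)%:R :> R[i].
Proof. by rewrite /cindic indicE; case: (_ \in _). Qed.

Section cindic_theory.
Context {d : measure_display} {T : measurableType d} {R : realType}.
Variable mu : {measure set T -> \bar R}.
Implicit Types A B : set T.

Lemma cmeasurable_cindic A : measurable A -> cmeasurable setT (cindic A : T -> R[i]).
Proof. by move=> mA; apply: cmeasurable_real; exact: measurable_indic. Qed.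

Lemma sqn_cindic A : measurable A -> sqn mu (cindic A) = mu A.
Proof.
move=> mA; rewrite -[in RHS](setIT A) -integral_indic//.
apply: eq_integral => x _; rewrite normc_cindic indicE.
by case: (_ \in _); rewrite /= ?expr1n ?expr0n.
Qed.

Lemma L2_cindic A : measurable A -> (mu A < +oo)%E -> L2 mu (cindic A).
Proof.
by move=> mA Aoo; apply/L2P; rewrite sqn_cindic//; split=> //; exact: cmeasurable_cindic.
Qed.

End cindic_theory.

Section closed_subspace.
Import HBNNSimple.
Context {d : measure_display} {T : measurableType d} {R : realType}.
Variable mu : {measure set T -> \bar R}.
Variable V : (T -> R[i]) -> Prop.
Hypothesis VD : forall f g, V f -> V g -> V (fun x => f x + g x).
Hypothesis VZ : forall (c : R[i]) f, V f -> V (fun x => c * f x).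
Hypothesis Vlim : forall u f, (forall j, V (u j)) -> L2 mu f -> L2cvg mu u f -> V f.
Hypothesis Vindic : forall A, measurable A -> (mu A < +oo)%E -> V (cindic A).

Lemma closed_subspace0 : V (fun=> 0).
Proof.
rewrite (_ : (fun=> 0) = cindic set0); first by apply: Vindic; rewrite ?measure0.
by apply/funext => x; rewrite cindicE in_set0.
Qed.

Lemma closed_subspace_sum (I : Type) (s : seq I) (u : I -> T -> R[i]) :
  (forall i, V (u i)) -> V (fun x => \sum_(i <- s) u i x).
Proof.
move=> Vu; elim: s => [|i s ih].
  rewrite (_ : (fun x => _) = fun=> 0); first exact: closed_subspace0.
  by apply/funext => x; rewrite big_nil.
rewrite (_ : (fun x => _) = fun x => u i x + \sum_(j <- s) u j x); first exact: VD.
by apply/funext => x; rewrite big_cons.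
Qed.

(** [r] is the limit of simple functions below it, dominated by [r] itself; each of them is a finite
    combination of indicators of level sets. *)
Lemma closed_subspace_nonneg (r : T -> R) : measurable_fun setT r ->
  (forall x, 0 <= r x) -> L2 mu (fun x => Complex (r x) 0) -> V (fun x => Complex (r x) 0).
Proof.
move=> mr r0 rL.
have mr' : measurable_fun setT (EFin \o r) by exact/measurable_EFinP.
pose g := nnsfun_approx measurableT mr'.
have r0' x : setT x -> (0 <= (EFin \o r) x)%E by rewrite lee_fin.
have gr x : g k x @[k --> \oo] --> r x.
  have := cvg_nnsfun_approx measurableT mr' r0' (I : setT x).
  by move=> /fine_cvgP[].
have gle k x : g k x <= r x.
  have c := gr x; rewrite -(cvg_lim _ c)//; apply: nondecreasing_cvgn_le.
    by move=> m n mn; have /lefP := nd_nnsfun_approx measurableT mr' mn; exact.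
  by apply/cvg_ex; exists (r x).
have g0 k x : 0 <= g k x by [].
have mg k : measurable_fun setT (g k) by [].
apply: (Vlim (u := fun k x => Complex (g k x) 0)) => //; last first.
  apply: (L2_dominated_cvg _ _ rL) => //.
  - by move=> k x; rewrite !normcR !ger0_norm.
  - apply: filterE => x.
    rewrite (_ : (fun k => _) = (fun k => `|g k x - r x|)); last first.
      by apply/funext => k; rewrite -normcR; congr normc; apply: complex_eqP;
        rewrite ?cReD ?cImD ?cReN ?cImN /= ?subr0.
    rewrite -(@normr0 R R); apply: cvg_norm.
    by rewrite -(subrr (r x)); apply: cvgB => //; exact: cvg_cst.
move=> k.
pose s := fset_set (range (g k)).
rewrite (_ : (fun x => _) = fun x => \sum_(i < #|` s|)
    Complex s`_i 0 * cindic (g k @^-1` [set s`_i]) x); last first.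
  apply/funext => x; rewrite fimfunEord -/s.
  rewrite -[LHS]/((_)%:C)%C rmorph_sum; apply: eq_bigr => i _.
  apply: complex_eqP; rewrite ?cReM ?cImM /=.
    by rewrite mul0r subr0.
  by rewrite mulr0 mul0r addr0.
apply: closed_subspace_sum => i; set y := s`_i.
(* The level set of 0 may have infinite measure, but its coefficient vanishes. *)
have [->|y0] := eqVneq y 0.
  rewrite (_ : (fun x => _) = fun=> 0); first exact: closed_subspace0.
  by apply/funext => x; rewrite -[X in X * _]/(0 : R[i]) mul0r.
apply: VZ; apply: Vindic; first exact: measurable_funPTI.
have my : measurable (g k @^-1` [set y]) by exact: measurable_funPTI.
rewrite -sqn_cindic//.
(* Chebyshev: on the level set [y] is at most [r], so the indicator is at most [r / y]. *)
apply: (@le_lt_trans _ _ (sqn mu (fun x => Complex y^-1 0 * Complex (r x) 0))).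
  apply: le_sqn; [exact: cmeasurable_cindic| |].
    by apply: cmeasurableM; [exact: cmeasurable_cst|exact: cmeasurable_real].
  move=> x; rewrite normc_cindic normcM !normcR indicE.
  have [/set_mem /= xy|_] := boolP (x \in _); last by rewrite mulr_ge0.
  rewrite (ger0_norm (r0 x)) normfV ler_pdivlMl ?normr_gt0// mulr1 -xy.
  by rewrite ger0_norm.
rewrite sqnZl; last by case: rL.
rewrite lte_mul_pinfty// ?lee_fin ?sqr_ge0//.
by case/L2P: rL.
Qed.

Lemma closed_subspace_L2 f : L2 mu f -> V f.
Proof.
move=> fL; have [[mr mi] _] := fL.
have part (h : T -> R) : measurable_fun setT h -> (forall x, `|h x| <= normc (f x)) ->
    V (fun x => Complex (h x) 0).
  move=> mh hf.
  have P (h' : T -> R) : measurable_fun setT h' -> (forall x, 0 <= h' x) ->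
      (forall x, h' x <= `|h x|) -> V (fun x => Complex (h' x) 0).
    move=> mh' h'0 h'h; apply: closed_subspace_nonneg => //.
    apply: (le_L2 _ fL); first exact: cmeasurable_real.
    by move=> x; rewrite normcR ger0_norm// (le_trans (h'h x)).
  pose hp x := Num.max (h x) 0; pose hn x := Num.max (- h x) 0.
  have Vp : V (fun x => Complex (hp x) 0).
    apply: P => [|x|x]; first exact: measurable_maxr.
      by rewrite le_max lexx orbT.
    by rewrite ge_max normr_ge0 ler_norm.
  have Vn : V (fun x => Complex (hn x) 0).
    apply: P => [|x|x]; first by apply: measurable_maxr => //; exact: measurableT_comp.
      by rewrite le_max lexx orbT.
    by rewrite ge_max normr_ge0 -normrN ler_norm.
  rewrite (_ : (fun x => _) = (fun x => Complex (hp x) 0 + (-1) * Complex (hn x) 0)).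
    by apply: VD => //; exact: VZ.
  apply/funext => x; apply: complex_eqP; rewrite mulN1r ?cReD ?cImD ?cReN ?cImN /= ?subr0//.
  by rewrite /hp /hn; case: (leP (h x) 0) => h0; case: (leP (- h x) 0) => h1; lra.
rewrite (_ : f = fun x => Complex (complex.Re (f x)) 0 + Complex 0 1 * Complex (complex.Im (f x)) 0).
  apply: VD; first by apply: part => // x; exact: normr_Re_le.
  by apply: VZ; apply: part => // x; exact: normr_Im_le.
apply/funext => x; apply: complex_eqP; rewrite ?cReD ?cImD ?cReM ?cImM /=.
  by rewrite !mul0r mulr0 subr0 addr0.
by rewrite mul0r mul1r !add0r.
Qed.

End closed_subspace.

Section cindic_convergence.
Context {d : measure_display} {T : measurableType d} {R : realType}.
Variable mu : {measure set T -> \bar R}.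
Implicit Types A B D : set T.

(** At each point the indicators are eventually constant, and that of [D] dominates them all. *)
Lemma L2cvg_cindic (A_ : nat -> set T) B D : (forall j, measurable (A_ j)) ->
  measurable B -> measurable D -> (mu D < +oo)%E ->
  (forall j, A_ j `<=` D) -> B `<=` D ->
  (forall x, exists N, forall j, (N <= j)%N -> (A_ j x <-> B x)) ->
  L2cvg mu (fun j => cindic (A_ j)) (cindic B).
Proof.
move=> mA mB mD Doo AD BD AB.
have le (X : set T) x : X `<=` D -> normc (cindic X x : R[i]) <= normc (cindic D x : R[i]).
  move=> XD; rewrite !normc_cindic !indicE ler_nat.
  have [/set_mem/XD/mem_set ->|] // := boolP (x \in X).
apply: (L2_dominated_cvg _ _ (L2_cindic mD Doo)).
- by move=> j; exact: cmeasurable_cindic.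
- exact: cmeasurable_cindic.
- by move=> j x; exact: le.
- by move=> x; exact: le.
- apply: filterE => x; apply: cvg_near_cst; have [N hN] := AB x.
  exists N => // j Nj; rewrite -[LHS]/(normc (cindic (A_ j) x - cindic B x)).
  rewrite !cindicE.
  rewrite (_ : (x \in A_ j) = (x \in B)) ?subrr ?normc0//.
  by apply/idP/idP => /set_mem/(hN j Nj)/mem_set.
Qed.

Lemma L2cvg_cindic_outer (A_ : nat -> set T) B : (forall j, measurable (A_ j)) ->
  measurable B -> (mu B < +oo)%E -> (forall j, B `<=` A_ j) ->
  (forall j, mu (A_ j) <= mu B + (j.+1%:R^-1)%:E)%E ->
  L2cvg mu (fun j => cindic (A_ j)) (cindic B).
Proof.
move=> mA mB Boo BA hA; apply/L2cvgP.
have E j : sqn mu (fun x => cindic (A_ j) x - cindic B x) = mu (A_ j `\` B).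
  rewrite -sqn_cindic; last exact: measurableD.
  apply: eq_sqn => x; congr normc; rewrite !cindicE in_setD.
  have [xB|xB] := boolP (x \in B).
    by rewrite (mem_set (BA j _ (set_mem xB))) /= subrr.
  by rewrite andbT subr0.
under eq_fun do rewrite E.
have Bfin : mu B \is a fin_num by rewrite ge0_fin_numE.
have Aoo j : (mu (A_ j) < +oo)%E.
  by apply: (le_lt_trans (hA j)); rewrite lte_add_pinfty ?ltry.
apply: (squeeze_cvge (f := fun=> 0%E) (h := fun j => ((j.+1%:R^-1)%:E : \bar R))).
- apply: nearW => j; rewrite measure_ge0 /=.
  have -> : mu (A_ j `\` B) = (mu (A_ j) - mu B)%E.
    by rewrite (measureD (mA j) mB (Aoo j)) (classical_sets.setIidr (BA j)).
  by rewrite leeBlDl//; exact: hA.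
- exact: cvg_cst.
- by apply: cvg_EFin; [exact: nearW|exact: cvg_harmonic].
Qed.

Variable V : (T -> R[i]) -> Prop.
Hypothesis VD : forall f g, V f -> V g -> V (fun x => f x + g x).
Hypothesis VZ : forall (c : R[i]) f, V f -> V (fun x => c * f x).
Hypothesis Vlim : forall u f, (forall j, V (u j)) -> L2 mu f -> L2cvg mu u f -> V f.

(** Dynkin's argument: the measurable sets whose trace on [D] has its indicator in [V] form a
    lambda-system. The finite measure of [D] provides the domination needed for increasing
    unions. *)
Lemma closed_subspace_sigma_algebra (G : set (set T)) D :
  measurable D -> (mu D < +oo)%E -> setI_closed G -> G `<=` measurable ->
  V (cindic D) -> (forall A, G A -> V (cindic (A `&` D))) ->
  forall A, <<s G >> A -> V (cindic (A `&` D)).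
Proof.
move=> mD Doo GI mG VDD GV A sGA.
suff: <<s G >> `<=` [set A | measurable A /\ V (cindic (A `&` D))].
  by move=> /(_ _ sGA)[].
apply: lambda_system_subset => //; last by move=> B GB; split; [exact: mG|exact: GV].
split => //; first by split => //; rewrite setTI.
- move=> B C CB [mB VB] [mC VC]; split; first exact: measurableD.
  rewrite (_ : cindic _ = fun x => cindic (B `&` D) x + (-1) * cindic (C `&` D) x).
    by apply: VD => //; exact: VZ.
  apply/funext => x; rewrite !cindicE (in_setI x (B `\` C) D) (in_setD x B C) !in_setI mulN1r.
  have [/set_mem/CB/mem_set ->|_] := boolP (x \in C); last by rewrite /= subr0 andbT.
  by rewrite andbF /= subrr.
- move=> F ndF VF; split; first by apply: bigcup_measurable => k _; case: (VF k).
  apply: (Vlim (u := fun k => cindic (F k `&` D))); first by move=> j; case: (VF j).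
    apply: L2_cindic.
      by apply: measurableI => //; apply: bigcup_measurable => k _; case: (VF k).
    apply: le_lt_trans Doo; apply: le_measure; rewrite ?inE//.
    by apply: measurableI => //; apply: bigcup_measurable => k _; case: (VF k).
  apply: (@L2cvg_cindic _ _ D) => //.
  + by move=> j; apply: measurableI => //; case: (VF j).
  + by apply: measurableI => //; apply: bigcup_measurable => k _; case: (VF k).
  + move=> x; have [[k _ Fkx]|nF] := pselect ((\bigcup_k F k) x).
      exists k => j kj; split=> -[_ Dx]; split => //; first by exists k.
      by move: x Fkx {Dx}; apply/subsetPset; exact: ndF.
    by exists 0%N => j _; split=> -[Fx Dx] //; case: nF; exists j.
Qed.

(** Removes the cut-off: the indicators of the traces converge, dominated by that of [A]. *)
Lemma closed_subspace_exhaust (D_ : nat -> set T) A : (forall j, measurable (D_ j)) ->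
  (forall x, exists N, forall j, (N <= j)%N -> D_ j x) ->
  measurable A -> (mu A < +oo)%E -> (forall j, V (cindic (A `&` D_ j))) -> V (cindic A).
Proof.
move=> mD_ DT mA Aoo VA.
apply: (Vlim (u := fun j => cindic (A `&` D_ j))) => //; first exact: L2_cindic.
apply: (@L2cvg_cindic _ _ A) => //.
  by move=> j; exact: measurableI.
by move=> x; have [N hN] := DT x; exists N => j /hN Dx; split=> [[]|].
Qed.

Lemma closed_subspace_outer A : measurable A -> (mu A < +oo)%E ->
  (forall e : R, 0 < e -> exists B, [/\ measurable B, A `<=` B,
    (mu B <= mu A + e%:E)%E & V (cindic B)]) -> V (cindic A).
Proof.
move=> mA Aoo hB.
have e0 (j : nat) : 0 < j.+1%:R^-1 :> R by rewrite invr_gt0.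
have /choice[B_ HB] := fun j : nat => hB _ (e0 j).
apply: (Vlim (u := fun j => cindic (B_ j))); [|exact: L2_cindic|].
  by move=> j; case: (HB j).
by apply: L2cvg_cindic_outer => // j; case: (HB j).
Qed.

End cindic_convergence.

Section box_generation.
Context {R : realType} {n : nat}.
Implicit Types a b : 'I_n -> R.

Definition boxes : set (set 'rV[R]_n) := [set A | exists a b, A = box a b].

Lemma boxI a b a' b' : box a b `&` box a' b' =
  box (fun i => Num.max (a i) (a' i)) (fun i => Num.min (b i) (b' i)).
Proof.
apply/seteqP; split=> [x [h h'] i|x h]; last split=> i.
- have := h i; have := h' i; rewrite !in_itv/= => /andP[? ?] /andP[? ?].
  by rewrite gt_max le_min; apply/andP; split; apply/andP.
- by have := h i; rewrite !in_itv/= gt_max le_min => /andP[/andP[-> _] /andP[-> _]].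
- by have := h i; rewrite !in_itv/= gt_max le_min => /andP[/andP[_ ->] /andP[_ ->]].
Qed.

Lemma boxes_setI_closed : setI_closed boxes.
Proof.
by move=> _ _ [a [b ->]] [a' [b' ->]]; rewrite boxI; do 2 eexists; reflexivity.
Qed.

Definition cube (M : nat) : set 'rV[R]_n := box (fun=> - M.+1%:R) (fun=> M.+1%:R).

Lemma in_cube (x : 'rV[R]_n) : exists N, forall M, (N <= M)%N -> cube M x.
Proof.
pose F (i : 'I_n) := Num.bound `|x ord0 i|.
pose N := \max_(i < n) F i; exists N => M NM i.
rewrite in_itv/=.
have xM : `|x ord0 i| < M.+1%:R.
  apply: (lt_le_trans (archi_boundP (normr_ge0 _))).
  by rewrite ler_nat (leq_trans (leq_bigmax (F := F) i))// (leq_trans NM).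
by move: xM; rewrite ltr_norml => /andP[-> /ltW].
Qed.

Lemma measurable_boxes : @measurable _ 'rV[R]_n `<=` <<s boxes >>.
Proof.
have coordP (i : 'I_n) : measurable_fun setT
    ((fun x : g_sigma_algebraType boxes => x ord0 i : measurableTypeR R)).
  apply: (measurability (ocitv (R := R))) => //.
  move=> _ [B [[x y] _ <-] <-]; rewrite setTI.
  (* A condition on a single coordinate is a countable union of boxes whose other sides grow. *)
  rewrite (_ : _ @^-1` _ = \bigcup_(k in [set: nat])
    box (fun j => if j == i then x else - k.+1%:R) (fun j => if j == i then y else k.+1%:R)).
    apply: bigcup_measurable => k _; apply: sub_sigma_algebra.
    by do 2 eexists; reflexivity.
  apply/seteqP; split=> [z /= zi|z [k _ /(_ i)]] /=; last by rewrite eqxx.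
  have [N hN] := in_cube z; exists N => // j.
  by case: eqP => [->//|_]; exact: hN.
apply: smallest_sub; first exact: smallest_sigma_algebra.
move=> A; rewrite -bigcup_seq/= => -[i _ [B mB <-]].
rewrite setTI.
by have := coordP i measurableT B mB; rewrite setTI.
Qed.

End box_generation.

Section euclid_closed_subspace.
Context {R : realType} {n : nat}.
Local Notation mu := (Leb R n).

(** The Caratheodory outer measure is an infimum over countable Borel covers; [B] is the union of a
    nearly optimal one. With [closed_subspace_outer] this leads from Borel sets to Lebesgue
    measurable sets. *)
Lemma Leb_outer_regular (A : set (euclid R n)) (e : R) : (mu A < +oo)%E -> 0 < e ->
  exists B : set 'rV[R]_n, [/\ measurable B, A `<=` B & (mu B <= mu A + e%:E)%E].
Proof.
move=> Aoo e0.
have Afin : mu A \is a fin_num by rewrite ge0_fin_numE.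
have [_ [F [mF AF] <-] lt] := lb_ereal_inf_adherent e0 Afin.
exists (\bigcup_k F k); split => //; first exact: bigcup_measurable.
apply: le_trans (ltW lt); rewrite LebE; last exact: bigcup_measurable.
by apply: generalized_Boole_inequality => //; exact: bigcup_measurable.
Qed.

Variable V : (euclid R n -> R[i]) -> Prop.
Hypothesis VD : forall f g, V f -> V g -> V (fun x => f x + g x).
Hypothesis VZ : forall (c : R[i]) f, V f -> V (fun x => c * f x).
Hypothesis Vlim : forall u f, (forall j, V (u j)) -> L2 mu f -> L2cvg mu u f -> V f.
Hypothesis Vbox : forall a b, (forall i, a i < b i) -> V (boxf a b).

Let Vbox_all a b : V (cindic (box a b)).
Proof.
have [ab|/existsNP[i /negP]] := pselect (forall i, a i < b i); first exact: Vbox.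
rewrite -leNgt => ba.
(* A degenerate box is empty, so its indicator is 0 times that of the unit box. *)
rewrite (_ : cindic _ = fun x => 0 * boxf (fun=> 0) (fun=> 1) x).
  by apply: VZ; apply: Vbox => _; exact: ltr01.
apply/funext => x; rewrite mul0r cindicE memNset// => /(_ i).
by rewrite in_itv/= => /andP[ax xb]; have := lt_le_trans ax (le_trans xb ba); rewrite ltxx.
Qed.

Let measurable_cube M : measurable (cube M : set (euclid R n)).
Proof. by apply: measurable_euclid; exact: measurable_box. Qed.

Let cube_lty M : (mu (cube M) < +oo)%E.
Proof.
have h (i : 'I_n) : - M.+1%:R < M.+1%:R :> R by rewrite (lt_trans (y := 0))// oppr_lt0.
by rewrite -(sqn_cindic mu (measurable_cube M)); have /L2P[_] := L2_boxf h.
Qed.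

Lemma euclid_closed_subspace f : L2 mu f -> V f.
Proof.
have Vborel (A : set 'rV[R]_n) : measurable A -> (mu A < +oo)%E -> V (cindic A).
  move=> mA Aoo.
  apply: (closed_subspace_exhaust Vlim measurable_cube in_cube (measurable_euclid mA) Aoo) => M.
  apply: (closed_subspace_sigma_algebra VD VZ Vlim (measurable_cube M) (cube_lty M)
    boxes_setI_closed).
  - by move=> _ [a [b ->]]; apply: measurable_euclid; exact: measurable_box.
  - exact: Vbox_all.
  - by move=> _ [a [b ->]]; rewrite boxI; exact: Vbox_all.
  - exact: measurable_boxes.
apply: (closed_subspace_L2 VD VZ Vlim) => A mA Aoo.
apply: (closed_subspace_outer Vlim mA Aoo) => e e0.
have [B [mB AB Be]] := Leb_outer_regular Aoo e0.
exists B; split=> //; first exact: measurable_euclid.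
apply: Vborel => //; apply: (le_lt_trans Be).
by rewrite lte_add_pinfty ?ltry.
Qed.

End euclid_closed_subspace.

(** * The Plancherel theorem *)

Section L2_limits.
Context {d : measure_display} {T : measurableType d} {R : realType}.
Variable mu : {measure set T -> \bar R}.
Implicit Types (f g : T -> R[i]) (u v : nat -> T -> R[i]).

Lemma L2cvgE u f : L2cvg mu u f <-> forall e : R, 0 < e ->
  \forall j \near \oo, (L2norm mu (fun x => u j x - f x)%R < e%:E)%E.
Proof. by apply: cvge0P => j; exact: L2norm_ge0. Qed.

Lemma L2cvgD u v f g : (forall j, L2 mu (u j)) -> (forall j, L2 mu (v j)) ->
  L2 mu f -> L2 mu g -> L2cvg mu u f -> L2cvg mu v g ->
  L2cvg mu (fun j x => u j x + v j x) (fun x => f x + g x).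
Proof.
move=> uL vL fL gL uf vg.
have d00 : (0 +? (0 : \bar R))%E by [].
have := cvgeD d00 uf vg.
rewrite adde0 => h; apply: (cvge0_le _ _ (h _)) => j; first exact: L2norm_ge0.
rewrite (_ : _ \- _ = fun x => (u j x - f x) + (v j x - g x)).
  by apply: L2norm_D; apply: L2_cmeasurable; exact: L2B.
by apply/funext => x /=; rewrite opprD addrACA.
Qed.

Lemma L2cvgZl (c : R[i]) u f : (forall j, L2 mu (u j)) -> L2 mu f ->
  L2cvg mu u f -> L2cvg mu (fun j x => c * u j x) (fun x => c * f x).
Proof.
move=> uL fL /L2cvgP uf; apply/L2cvgP.
rewrite (_ : (fun j => _) =
    fun j => ((normc c ^+ 2)%:E * sqn mu (fun x => u j x - f x)%R)%E); last first.
  apply/funext => j; rewrite -sqnZl; last by apply: L2_cmeasurable; exact: L2B.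
  by congr sqn; apply/funext => x; rewrite mulrBr.
by rewrite -(mule0 (normc c ^+ 2)%:E); apply: cvgeZl.
Qed.

Lemma L2cvgJ u f : L2cvg mu u f ->
  L2cvg mu (fun j x => conjc (u j x)) (fun x => conjc (f x)).
Proof.
move=> /L2cvgP uf; apply/L2cvgP; rewrite (_ : (fun j => _) =
    fun j => sqn mu (fun x => u j x - f x)) => //.
apply/funext => j; rewrite -[RHS]sqnJ; apply: eq_sqn => x.
by rewrite rmorphB.
Qed.

Lemma L2cvg_ae u f : (forall j, {ae mu, forall x, u j x = f x}) ->
  (forall j, L2 mu (u j)) -> L2 mu f -> L2cvg mu u f.
Proof.
move=> uf uL fL; apply/L2cvgP.
rewrite (_ : (fun j => _) = fun=> 0%E); first exact: cvg_cst.
apply/funext => j; apply: ae_sqn_eq0; first by apply: L2_cmeasurable; exact: L2B.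
by apply: filterS (uf j) => x ->; rewrite subrr.
Qed.

End L2_limits.

(* For [F := fourier1] and Lebesgue measure, [L2ext] is [is_fourier]. *)
Section isometric_extension.
Context {d : measure_display} {T : measurableType d} {R : realType}.
Variable mu : {measure set T -> \bar R}.
Variable F : (T -> R[i]) -> (T -> R[i]).
Implicit Types (c : R[i]) (f g u v : T -> R[i]).

Definition core u := cintegrable mu u /\ L2 mu u.

Hypothesis FL2 : forall u, core u -> L2 mu (F u).
Hypothesis Fle : forall u, core u -> (sqn mu (F u) <= sqn mu u)%E.
Hypothesis FD : forall u v, core u -> core v ->
  forall x, F (fun x => u x + v x) x = F u x + F v x.
Hypothesis FZl : forall c u, core u -> forall x, F (fun x => c * u x) x = c * F u x.

Definition L2ext f g : Prop := [/\ L2 mu f, L2 mu g &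
  exists u : nat -> T -> R[i],
    [/\ forall j, core (u j), L2cvg mu u f & L2cvg mu (fun j => F (u j)) g]].

Lemma L2ext_core u : core u -> L2ext u (F u).
Proof.
move=> cu; split; [by case: cu|exact: FL2|].
have [_ uL] := cu; have FuL := FL2 cu.
exists (fun=> u); split=> //; apply: L2cvg_ae => // _; exact: aeW.
Qed.

Lemma L2extD f g f' g' : L2ext f g -> L2ext f' g' ->
  L2ext (fun x => f x + f' x) (fun x => g x + g' x).
Proof.
move=> [fL gL [u [cu uf ug]]] [fL' gL' [v [cv vf vg]]].
split; [exact: L2D|exact: L2D|exists (fun j x => u j x + v j x); split].
- move=> j; have [? ?] := cu j; have [? ?] := cv j.
  by split; [exact: cintegrableD|exact: L2D].
- by apply: L2cvgD => // j; [case: (cu j)|case: (cv j)].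
- rewrite (_ : (fun j => _) = fun j x => F (u j) x + F (v j) x).
    by apply: L2cvgD => // j; exact: FL2.
  by apply/funext => j; apply/funext => x; exact: FD.
Qed.

Lemma L2extZl c f g : L2ext f g -> L2ext (fun x => c * f x) (fun x => c * g x).
Proof.
move=> [fL gL [u [cu uf ug]]].
split; [exact: L2Zl|exact: L2Zl|exists (fun j x => c * u j x); split].
- by move=> j; have [? ?] := cu j; split; [exact: cintegrableZl|exact: L2Zl].
- by apply: L2cvgZl => // j; case: (cu j).
- rewrite (_ : (fun j => _) = fun j x => c * F (u j) x).
    by apply: L2cvgZl => // j; exact: FL2.
  by apply/funext => j; apply/funext => x; exact: FZl.
Qed.

Lemma L2extB f g f' g' : L2ext f g -> L2ext f' g' ->
  L2ext (fun x => f x - f' x) (fun x => g x - g' x).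
Proof.
move=> fg /(L2extZl (-1)) /(L2extD fg).
by under eq_fun do rewrite mulN1r; under [X in L2ext _ X]eq_fun do rewrite mulN1r.
Qed.

Lemma L2ext_le f g : L2ext f g -> (L2norm mu g <= L2norm mu f)%E.
Proof.
move=> [fL gL [u [cu /L2cvgE uf /L2cvgE ug]]].
apply/lee_addgt0Pr => e e0.
have e2 : 0 < e / 2 by rewrite divr_gt0.
near \oo => j.
have h1 : (L2norm mu (fun x => u j x - f x)%R < (e / 2)%:E)%E by near: j; exact: uf.
have h2 : (L2norm mu (fun x => F (u j) x - g x)%R < (e / 2)%:E)%E by near: j; exact: ug.
have uL : L2 mu (u j) by case: (cu j).
have FuL : L2 mu (F (u j)) by exact: FL2.
have Dle (a b : T -> R[i]) : L2 mu a -> L2 mu b ->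
    (L2norm mu a <= L2norm mu (fun x => a x - b x)%R + L2norm mu b)%E.
  move=> aL bL.
  have := L2norm_D mu (L2_cmeasurable (L2B aL bL)) (L2_cmeasurable bL).
  by under [X in (L2norm mu X <= _)%E -> _]eq_fun do rewrite subrK.
apply: (le_trans (Dle _ _ gL FuL)).
rewrite L2norm_B (_ : e = e / 2 + e / 2); last by rewrite -splitr.
rewrite EFinD addeA [X in (X <= _)%E]addeC; apply: leeD; last exact: ltW.
apply: (@le_trans _ _ (L2norm mu (u j))); first by rewrite L2norm_le; exact: Fle.
apply: (le_trans (Dle _ _ uL fL)).
by rewrite [X in (X <= _)%E]addeC; apply: leeD2l; exact: ltW.
Unshelve. all: by end_near. Qed.

(** The graph is closed, by a diagonal choice: [w j] in the core lies within [1 / (j + 1)] of [u j],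
    and its image within the same distance of [v j]. *)
Lemma L2ext_lim (u v : nat -> T -> R[i]) f g :
  (forall j, L2ext (u j) (v j)) -> L2 mu f -> L2 mu g ->
  L2cvg mu u f -> L2cvg mu v g -> L2ext f g.
Proof.
move=> uv fL gL uf vg; split=> //.
have h j : exists w, [/\ core w, (L2norm mu (fun x => w x - u j x)%R < (j.+1%:R^-1)%:E)%E &
    (L2norm mu (fun x => F w x - v j x)%R < (j.+1%:R^-1)%:E)%E].
  have [_ _ [w [cw /L2cvgE wu /L2cvgE wv]]] := uv j.
  have e0 : 0 < j.+1%:R^-1 :> R by rewrite invr_gt0.
  by near \oo => k; exists (w k); split=> //; near: k; [exact: wu|exact: wv].
have /choice[w hw] := h.
have lim0 (a b : nat -> T -> R[i]) (c : T -> R[i]) : (forall j, L2 mu (a j)) -> (forall j, L2 mu (b j)) ->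
    L2 mu c -> (forall j, (L2norm mu (fun x => a j x - b j x)%R < (j.+1%:R^-1)%:E)%E) ->
    L2cvg mu b c -> L2cvg mu a c.
  move=> aL bL cL ab bc.
  have inv0 : (j.+1%:R^-1)%:E @[j --> \oo] --> (0 : \bar R).
    by apply: cvg_EFin; [exact: nearW|exact: cvg_harmonic].
  have d00 : (0 +? (0 : \bar R))%E by [].
  have := cvgeD d00 inv0 bc; rewrite adde0 => h0.
  apply: (cvge0_le _ _ (h0 _)) => j; first exact: L2norm_ge0.
  have := L2norm_triangle mu (L2_cmeasurable (aL j)) (L2_cmeasurable (bL j)) (L2_cmeasurable cL).
  by move=> /le_trans; apply; apply: leeD => //; exact: ltW.
exists w; split; first by move=> j; case: (hw j).
- apply: (lim0 _ u) => // j; first by case: (hw j) => -[].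
    by case: (uv j).
  by case: (hw j).
- apply: (lim0 _ v) => // j; first by apply: FL2; case: (hw j).
    by case: (uv j).
  by case: (hw j).
Unshelve. all: by end_near. Qed.

Lemma L2ext_ae f g f' g' : L2ext f g -> L2 mu f' -> L2 mu g' ->
  {ae mu, forall x, f x = f' x} -> {ae mu, forall x, g x = g' x} -> L2ext f' g'.
Proof.
move=> fg fL' gL' ff' gg'; have [fL gL _] := fg.
by apply: (@L2ext_lim (fun=> f) (fun=> g)) => //; exact: L2cvg_ae.
Qed.

Lemma L2ext_inj0 f g : L2ext f g -> sqn mu f = 0%E -> {ae mu, forall x, g x = 0}.
Proof.
move=> fg f0; have [_ gL _] := fg.
apply: (sqn_eq0 (L2_cmeasurable gL)); apply/eqP; rewrite eq_le sqn_ge0 andbT -f0.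
by have := L2ext_le fg; rewrite L2norm_le.
Qed.

Lemma L2ext_unique f g g' : L2ext f g -> L2ext f g' -> {ae mu, forall x, g x = g' x}.
Proof.
move=> fg fg'; have := L2ext_inj0 (L2extB fg fg') _.
have -> : sqn mu (fun x => f x - f x) = 0%E.
  by under eq_fun do rewrite subrr; apply: ae_sqn_eq0; [exact: cmeasurable_cst|exact: aeW].
by move=> /(_ erefl); apply: filterS => x /eqP; rewrite subr_eq0 => /eqP.
Qed.

(** For the Fourier transform the second clause is inversion, since conjugating before and after the
    transform gives its inverse. *)
Definition unitary_at f := exists g,
  L2ext f g /\ L2ext (fun x => conjc (g x)) (fun x => conjc (f x)).

Lemma unitary_atD f f' : unitary_at f -> unitary_at f' -> unitary_at (fun x => f x + f' x).
Proof.
move=> [g [fg gf]] [g' [fg' gf']]; exists (fun x => g x + g' x); split; first exact: L2extD.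
under eq_fun do rewrite rmorphD; under [X in L2ext _ X]eq_fun do rewrite rmorphD.
exact: L2extD.
Qed.

Lemma unitary_atZl c f : unitary_at f -> unitary_at (fun x => c * f x).
Proof.
move=> [g [fg gf]]; exists (fun x => c * g x); split; first exact: L2extZl.
under eq_fun do rewrite rmorphM; under [X in L2ext _ X]eq_fun do rewrite rmorphM.
exact: L2extZl.
Qed.

(** Contraction makes the transforms [v j] a Cauchy sequence, completeness gives [g], and both
    clauses pass to the limit because the graph is closed. *)
Lemma unitary_at_lim (u : nat -> T -> R[i]) f :
  (forall j, unitary_at (u j)) -> L2 mu f -> L2cvg mu u f ->
  unitary_at f.
Proof.
move=> /choice[v hv] fL uf.
have uL j : L2 mu (u j) by case: (hv j) => -[].
have vL j : L2 mu (v j) by case: (hv j) => -[].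
have [g [gL vg]] : exists g, L2 mu g /\ L2cvg mu v g.
  apply: L2_complete => // e e0.
  have e2 : 0 < e / 2 by rewrite divr_gt0.
  have [N _ hN] := (L2cvgE _ _ _).1 uf _ e2.
  exists N => i j iN jN.
  have [[ei _] [ej _]] := (hv i, hv j).
  apply: (le_lt_trans (L2ext_le (L2extB ei ej))).
  have := L2norm_triangle mu (L2_cmeasurable (uL i)) (L2_cmeasurable fL) (L2_cmeasurable (uL j)).
  move=> /le_lt_trans; apply.
  rewrite (_ : e = e / 2 + e / 2); last by rewrite -splitr.
  rewrite EFinD; apply: lteD; first exact: hN.
  by rewrite L2norm_B; exact: hN.
exists g; split.
  by apply: (L2ext_lim _ fL gL uf vg) => j; case: (hv j).
apply: (L2ext_lim _ (L2J gL) (L2J fL) (L2cvgJ vg) (L2cvgJ uf)) => j.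
by case: (hv j).
Qed.

Hypothesis all_unitary : forall f, L2 mu f -> unitary_at f.

(** Some image [h] of [f] satisfies inversion, and images are unique almost everywhere, so [g] does
    too. *)
Lemma L2ext_conj f g : L2ext f g -> L2ext (fun x => conjc (g x)) (fun x => conjc (f x)).
Proof.
move=> fg; have [fL gL _] := fg; have [h [fh hf]] := all_unitary fL.
apply: (L2ext_ae hf (L2J gL) (L2J fL)); last exact: aeW.
by apply: filterS (L2ext_unique fh fg) => x ->.
Qed.

(** Contraction at [f] and, through [L2ext_conj], at the conjugate of [g]. *)
Lemma L2ext_isometry f g : L2ext f g -> sqn mu g = sqn mu f.
Proof.
move=> fg; apply/eqP; rewrite eq_le -!L2norm_le L2ext_le//=.
by have := L2ext_le (L2ext_conj fg); rewrite !L2norm_le !sqnJ.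
Qed.

Lemma L2ext_onto g : L2 mu g -> exists f, L2ext f g.
Proof.
move=> gL; have [h [gh _]] := all_unitary (L2J gL).
exists (fun x => conjc (h x)); have := L2ext_conj gh.
by under [X in L2ext _ X]eq_fun do rewrite conjcK.
Qed.

Lemma L2ext_total f : L2 mu f -> exists g, L2ext f g.
Proof. by move=> /all_unitary[g [fg _]]; exists g. Qed.

Lemma L2ext_inner f g f' g' : L2ext f g -> L2ext f' g' -> inner mu g g' = inner mu f f'.
Proof.
move=> fg fg'; have [fL gL _] := fg; have [fL' gL' _] := fg'.
apply: polarization => //; [exact: L2ext_isometry|exact: L2ext_isometry|].
by move=> c; apply: L2ext_isometry; apply: L2extD => //; exact: L2extZl.
Qed.

End isometric_extension.

Section weighted_L2.
Context {d : measure_display} {T : measurableType d} {R : realType}.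
Variable mu : {measure set T -> \bar R}.
Variable weight : nat -> T -> R.
Hypothesis measurable_weight : forall j, measurable_fun setT (weight j).
Hypothesis weight_ge0 : forall j x, 0 <= weight j x.
Hypothesis weight_le1 : forall j x, weight j x <= 1.
Hypothesis cvg_weight : forall x, weight j x @[j --> \oo] --> (1 : R).
Implicit Types f : T -> R[i].

Let normc_weight f j x : normc (Complex (weight j x) 0 * f x) <= normc (f x).
Proof. by rewrite normcM normcR ger0_norm// ler_piMl// normc_ge0. Qed.

Let cmeasurable_weight f j : cmeasurable setT f ->
  cmeasurable setT (fun x => Complex (weight j x) 0 * f x).
Proof. by move=> mf; apply: cmeasurableM => //; exact: cmeasurable_real. Qed.

Lemma L2_weight f j : L2 mu f -> L2 mu (fun x => Complex (weight j x) 0 * f x).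
Proof.
move=> fL; apply: (le_L2 _ fL) => //; apply: cmeasurable_weight; exact: L2_cmeasurable fL.
Qed.

Lemma L2cvg_weight f : L2 mu f ->
  L2cvg mu (fun j x => Complex (weight j x) 0 * f x) f.
Proof.
move=> fL; have mf := L2_cmeasurable fL.
apply: (L2_dominated_cvg _ mf fL) => //; first by move=> j; exact: cmeasurable_weight.
apply: aeW => x.
rewrite (_ : (fun j => _) = fun j => `|weight j x - 1| * normc (f x)).
  rewrite -[X in _ --> X](mul0r (normc (f x))); apply: cvgMr_tmp.
  rewrite -(@normr0 R R); apply: cvg_norm.
  by rewrite -(subrr (1 : R)); apply: cvgB; [exact: cvg_weight|exact: cvg_cst].
apply/funext => j; rewrite -normcR -normcM; congr normc.
rewrite (_ : Complex (weight j x - 1) 0 = Complex (weight j x) 0 - 1) ?mulrBl ?mul1r//.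
by apply: complex_eqP; rewrite ?cReD ?cImD ?cReN ?cImN /= ?subr0.
Qed.

End weighted_L2.

Section plancherel.
Context {R : realType} {n : nat}.
Local Notation E := (euclid R n).
Local Notation mu := (Leb R n).
Implicit Types (u v f g : E -> R[i]) (e : R).

Let cintegrable_fourier1 u w : cintegrable mu u ->
  cintegrable mu (fun x => u x * expi (- (2 * pi * dot x w))).
Proof.
move=> ui; have := cintegrable_phase (mu := sLeb n) (@measurable_to_borel R n) (- (2 * pi)) w ui.
by under [X in cintegrable _ X -> _]eq_fun do rewrite mulNr.
Qed.

Lemma fourier1D u v w : cintegrable mu u -> cintegrable mu v ->
  fourier1 (fun x => u x + v x) w = fourier1 u w + fourier1 v w.
Proof. by move=> ui vi; apply: cintegralMDl; exact: cintegrable_fourier1. Qed.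

Lemma fourier1Zl c u w : cintegrable mu u ->
  fourier1 (fun x => c * u x) w = c * fourier1 u w.
Proof. by move=> ui; apply: cintegralMZl; exact: cintegrable_fourier1. Qed.

Let core_fourier1_L2 u : core mu u -> L2 mu (fourier1 u).
Proof.
move=> [ui uL]; apply/L2P; split.
  by apply: cmeasurable_fourier1; exact: L2_cmeasurable uL.
by apply: (le_lt_trans (sqn_fourier1_le ui uL)); case/L2P: uL.
Qed.

Let core_fourier1_le u : core mu u -> (sqn mu (fourier1 u) <= sqn mu u)%E.
Proof. by case; exact: sqn_fourier1_le. Qed.

Let core_fourier1D u v : core mu u -> core mu v ->
  forall w, fourier1 (fun x => u x + v x) w = fourier1 u w + fourier1 v w.
Proof. by move=> [ui _] [vi _] w; exact: fourier1D. Qed.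

Let core_fourier1Zl c u : core mu u ->
  forall w, fourier1 (fun x => c * u x) w = c * fourier1 u w.
Proof. by move=> [ui _] w; exact: fourier1Zl. Qed.

(* Damping the transform of a box by the Poisson weights and transforming back
   gives the box convolved with the Poisson kernel, which tends to the box. *)
Lemma unitary_at_boxf a b : (forall i : 'I_n, a i < b i) ->
  unitary_at mu fourier1 (boxf a b : E -> R[i]).
Proof.
move=> ab; have fi := cintegrable_boxf ab; have fL := L2_boxf ab.
have cf : core mu (boxf a b) by [].
have gL := core_fourier1_L2 cf.
exists (fourier1 (boxf a b)); split; first exact: (L2ext_core core_fourier1_L2).
have mw j : measurable_fun setT (fun w : E => poisson_weights j.+1%:R^-1 w : R).
  by apply: measurable_fun_euclid; apply: measurable_poisson_weights.
have e0 (j : nat) : 0 < j.+1%:R^-1 :> R by rewrite invr_gt0.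
have w0 (j : nat) (w : E) : 0 <= poisson_weights j.+1%:R^-1 w :> R.
  exact/ltW/poisson_weights_gt0.
have w1 (j : nat) (w : E) : poisson_weights j.+1%:R^-1 w <= 1 :> R.
  exact/poisson_weights_le1/ltW.
have gJL := L2J gL; have mgJ := L2_cmeasurable gJL.
have gM w : normc (conjc (fourier1 (boxf a b) w)) <= \int[mu]_x normc (boxf a b x).
  by rewrite normc_conj; exact: normc_fourier1_le.
split; [exact: gJL|exact: L2J|].
exists (fun j w => Complex (poisson_weights j.+1%:R^-1 w) 0 * conjc (fourier1 (boxf a b) w)).
split.
- move=> j; split; last exact: (L2_weight mw w0 w1).
  exact: (cintegrable_weights_Leb (e0 j) mgJ gM).
- by apply: (L2cvg_weight mw w0 w1) => // w; exact: cvg_poisson_weights.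
- rewrite (_ : (fun j => _) =
    fun j x => Complex (smoothed_box j.+1%:R^-1 a b (to_borel x)) 0).
    rewrite (_ : (fun x => conjc _) = boxf a b); first exact: L2cvg_smoothed_box.
    by apply/funext => x; exact: conj_boxf.
  apply/funext => j; apply/funext => x.
  by rewrite fourier1_weights_conv// boxf_convE.
Qed.

Theorem plancherel f : L2 mu f -> unitary_at mu fourier1 f.
Proof.
apply: euclid_closed_subspace.
- exact: (unitary_atD core_fourier1_L2 core_fourier1D).
- exact: (unitary_atZl core_fourier1_L2 core_fourier1Zl).
- exact: (unitary_at_lim core_fourier1_L2 core_fourier1_le core_fourier1D core_fourier1Zl).
- exact: unitary_at_boxf.
Qed.

Lemma is_fourier_total f : L2 mu f -> exists g, is_fourier f g.
Proof. exact: (L2ext_total plancherel). Qed.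

Lemma is_fourier_onto g : L2 mu g -> exists f, is_fourier f g.
Proof. 
exact: (L2ext_onto core_fourier1_L2 core_fourier1_le core_fourier1D core_fourier1Zl plancherel).
Qed.

Lemma is_fourierD f g f' g' : is_fourier f g -> is_fourier f' g' ->
  is_fourier (fun x => f x + f' x) (fun x => g x + g' x).
Proof. exact: (L2extD core_fourier1_L2 core_fourier1D). Qed.

Lemma is_fourierZl c f g : is_fourier f g -> is_fourier (fun x => c * f x) (fun x => c * g x).
Proof. exact: (L2extZl core_fourier1_L2 core_fourier1Zl). Qed.

Lemma is_fourier_isometry f g : is_fourier f g -> sqn mu g = sqn mu f.
Proof.
exact: (L2ext_isometry core_fourier1_L2 core_fourier1_le core_fourier1D core_fourier1Zl plancherel).
Qed.

Lemma is_fourier_ae f g g' : is_fourier f g -> L2 mu g' ->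
  {ae mu, forall w, g w = g' w} -> is_fourier f g'.
Proof.
move=> fg gL' gg'; have [fL _ _] := fg.
exact: (L2ext_ae core_fourier1_L2 fg fL gL' (aeW mu (fun x => erefl (f x))) gg').
Qed.

Lemma is_fourier_inner f g f' g' : is_fourier f g -> is_fourier f' g' ->
  inner mu g g' = inner mu f f'.
Proof.
exact: (L2ext_inner core_fourier1_L2 core_fourier1_le core_fourier1D core_fourier1Zl plancherel).
Qed.

End plancherel.

(** * Frames and multipliers *)

Section L2_sums.
Context {d : measure_display} {T : measurableType d} {R : realType}.
Variable mu : {measure set T -> \bar R}.

Lemma L2norm_sum (J : Type) (s : seq J) (g : J -> T -> R[i]) :
  (forall j, L2 mu (g j)) ->
  (L2norm mu (fun x => \sum_(j <- s) g j x)%R <= \sum_(j <- s) L2norm mu (g j))%E.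
Proof.
move=> gL; elim: s => [|j s ih].
  rewrite big_nil; under eq_fun do rewrite big_nil.
  by rewrite L2normE (ae_sqn_eq0 (cmeasurable_cst setT 0)) ?sqrte0//; exact: aeW.
rewrite big_cons; under eq_fun do rewrite big_cons.
apply: le_trans (L2norm_D mu (L2_cmeasurable (gL j)) (L2_cmeasurable (L2_sum s gL))) _.
exact: leeD.
Qed.

Lemma has_L2sumP (I : choiceType) (u : I -> T -> R[i]) f :
  has_L2sum mu u f <-> forall e : R, 0 < e ->
    \forall A \near summability.totally,
      (L2norm mu (fun x => \sum_(i <- (A : {fset I})) u i x - f x)%R < e%:E)%E.
Proof.
pose FF := @summability.totally_filter I.
by apply: cvge0P => A; exact: L2norm_ge0.
Qed.

End L2_sums.

Section slices.
Context {I : choiceType} {N : nat}.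
Local Open Scope fset_scope.
Implicit Types A : {fset I * 'I_N}.

Definition slice (n : 'I_N) A : {fset I} := [fset p.1 | p in A & p.2 == n].

(** The slice contains [B] as soon as [A] contains all pairs [(k, n)] with [k] in [B]. *)
Lemma slice_totally n : slice n A @[A --> summability.totally] --> summability.totally.
Proof.
move=> P [B _ BP]; exists [fset (k, n) | k in B] => // A /= BA; apply: BP => /=.
apply/fsubsetP => k kB; apply/imfsetP; exists (k, n) => //=.
rewrite !inE eqxx andbT; apply: (fsubsetP BA).
by apply/imfsetP; exists k.
Qed.

Lemma big_slice (V : nmodType) (u : I -> 'I_N -> V) A :
  (\sum_(p <- A) u p.1 p.2 = \sum_(n < N) \sum_(k <- slice n A) u k n)%R.
Proof.
rewrite (partition_big (fun p : I * 'I_N => p.2) xpredT)//=; apply: eq_bigr => n _.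
rewrite big_imfset/=; last first.
  by move=> [k i] [k' i'] /andP[_ /eqP/= ->] /andP[_ /eqP/= ->] ->.
by rewrite [RHS]big_filter; apply: eq_bigr => p /eqP->.
Qed.

End slices.

Section frame_sums.
Context {d : measure_display} {T : measurableType d} {R : realType}.
Variable mu : {measure set T -> \bar R}.
Context {I : choiceType} {N : nat}.
Variables (u : I -> 'I_N -> T -> R[i]) (S : 'I_N -> T -> R[i]).

(** A finite set of pairs is eventually large in all of its finitely many slices at once, and the
    total error is at most the sum of the errors of the slices. *)
Lemma has_L2sum_pair f : (forall k n, L2 mu (u k n)) -> (forall n, L2 mu (S n)) ->
  L2 mu f -> (forall n, has_L2sum mu (fun k => u k n) (S n)) ->
  {ae mu, forall x, f x = \sum_(n < N) S n x} ->
  has_L2sum mu (fun p : I * 'I_N => u p.1 p.2) f.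
Proof.
move=> uL SL fL uS fS; apply/has_L2sumP => e e0.
have FF : Filter (@summability.totally (I * 'I_N)%type).
  exact: (@filter_filter _ _ (@summability.totally_filter _)).
(* [N.+1] rather than [N] covers [N = 0] and keeps the sum of the [N] errors strictly below [e]. *)
have e1 : 0 < e / N.+1%:R by rewrite divr_gt0.
have near_slice n : \forall A \near summability.totally,
    (L2norm mu (fun x => \sum_(k <- slice n A) u k n x - S n x)%R < (e / N.+1%:R)%:E)%E.
  exact: (@slice_totally _ _ n _ ((has_L2sumP _ _ _).1 (uS n) _ e1)).
have h := filter_forall FF near_slice; apply: (@filterS _ _ FF _ _ _ h) => A hA.
have DL n : L2 mu (fun x => \sum_(k <- slice n A) u k n x - S n x)%R.
  by apply: L2B => //; exact: L2_sum.
have -> : L2norm mu (fun x => \sum_(p <- A) u p.1 p.2 x - f x)%R =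
    L2norm mu (fun x => \sum_(n < N) (\sum_(k <- slice n A) u k n x - S n x))%R.
  rewrite !L2normE; congr sqrte; apply: ae_eq_sqn.
  - have uA := L2_sum A (u := fun p => u p.1 p.2) (fun p => uL p.1 p.2).
    exact: L2_cmeasurable (L2B uA fL).
  - exact: L2_cmeasurable (L2_sum _ DL).
  - apply: filterS fS => x ->; rewrite sumrB; congr (_ - _).
    exact: (big_slice (fun k n => u k n x)).
apply: (le_lt_trans (L2norm_sum _ DL)).
apply: (@le_lt_trans _ _ (\sum_(n < N) (e / N.+1%:R)%:E)%E).
  by apply: lee_sum => n _; exact: ltW.
rewrite sumEFin lte_fin sumr_const card_ord -[X in X < _]mulr_natr mulrAC ltr_pdivrMr//.
by rewrite ltr_pM2l// ltr_nat.
Qed.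

Lemma esum_pair (a : I -> 'I_N -> \bar R) : (forall k n, 0 <= a k n)%E ->
  (\esum_(p in [set: I * 'I_N]) a p.1 p.2 = \sum_(n < N) \esum_(k in [set: I]) a k n)%E.
Proof.
move=> a0; rewrite -esum_sum//.
rewrite (_ : [set: I * 'I_N] = [set: I] `*`` (fun=> [set: 'I_N])); last first.
  by apply/seteqP; split.
rewrite -(esum_esum (a := a))//; apply: eq_esum => k _.
rewrite esum_fset//; last exact: finite_finset.
rewrite -set_true.
rewrite -(@bigfs _ _ _ _ (index_enum 'I_N) xpredT) ?index_enum_uniq// => n _.
by rewrite mem_index_enum.
Qed.

End frame_sums.

(* [U] is the graph of a unitary operator of L_2; it will be [is_fourier]. *)
Section multiplier_frame.
Context {d : measure_display} {T : measurableType d} {R : realType}.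
Variable mu : {measure set T -> \bar R}.
Variable U : (T -> R[i]) -> (T -> R[i]) -> Prop.
Implicit Types f g : T -> R[i].

Hypothesis U_L2 : forall f g, U f g -> L2 mu f /\ L2 mu g.
Hypothesis UD : forall f g f' g', U f g -> U f' g' ->
  U (fun x => f x + f' x) (fun x => g x + g' x).
Hypothesis UZl : forall c f g, U f g -> U (fun x => c * f x) (fun x => c * g x).
Hypothesis U_isometry : forall f g, U f g -> sqn mu g = sqn mu f.
Hypothesis U_inner : forall f g f' g', U f g -> U f' g' -> inner mu g g' = inner mu f f'.
Hypothesis U_total : forall f, L2 mu f -> exists g, U f g.
Hypothesis U_onto : forall g, L2 mu g -> exists f, U f g.

Context {I : choiceType} {N : nat}.
Variable M : 'I_N -> T -> R[i].
Hypothesis cmeasurable_M : forall n, cmeasurable setT (M n).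
Hypothesis sum_M : forall x, \sum_(n < N) normc (M n x) ^+ 2 = 1.
Variables (phi Phi : I -> T -> R[i]) (psi : I -> 'I_N -> T -> R[i]).
Hypothesis phi_frame : parseval_frame mu phi.
Hypothesis phiU : forall k, U (phi k) (Phi k).
Hypothesis psiU : forall k n, U (psi k n) (fun x => M n x * Phi k x).

Let U_sum (J : Type) (s : seq J) (c : J -> R[i]) (u v : J -> T -> R[i]) :
  (forall j, U (u j) (v j)) ->
  U (fun x => \sum_(j <- s) c j * u j x) (fun x => \sum_(j <- s) c j * v j x).
Proof.
move=> uv; elim: s => [|j s ih].
  (* For the empty sum: any image of the zero function, scaled by 0, shows that [U] relates 0 to
     itself. *)
  have [g /(UZl 0)] := U_total (L2_0 mu).
  have E (w : J -> T -> R[i]) (k : T -> R[i]) :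
      (fun x => 0 * k x) = (fun x => \sum_(j <- [::]) c j * w j x).
    by apply/funext => x; rewrite big_nil mul0r.
  by rewrite (E u) (E v).
under eq_fun do rewrite big_cons; under [X in U _ X]eq_fun do rewrite big_cons.
by apply: UD => //; exact: UZl.
Qed.

Let UB f g f' g' : U f g -> U f' g' -> U (fun x => f x - f' x) (fun x => g x - g' x).
Proof.
move=> fg /(UZl (-1)) /(UD fg).
by under eq_fun do rewrite mulN1r; under [X in U _ X]eq_fun do rewrite mulN1r.
Qed.

Let normc_M n x : normc (M n x) <= 1.
Proof.
rewrite -(@expr_le1 _ 2)// ?normc_ge0// -(sum_M x) (bigD1 n)//= lerDl.
by apply: sumr_ge0 => k _; exact: sqr_ge0.
Qed.

Let normc_Mle n (g : T -> R[i]) x : normc (M n x * g x) <= normc (g x).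
Proof. by rewrite normcM ler_piMl// normc_ge0. Qed.

Let L2_M n g : L2 mu g -> L2 mu (fun x => M n x * g x).
Proof.
move=> gL; apply: (le_L2 _ gL); last exact: normc_Mle.
by apply: cmeasurableM => //; exact: L2_cmeasurable gL.
Qed.

Let L2_MJ n g : L2 mu g -> L2 mu (fun x => conjc (M n x) * g x).
Proof.
move=> gL; apply: (le_L2 _ gL).
  by apply: cmeasurableM; [exact: cmeasurableJ|exact: L2_cmeasurable gL].
by move=> x; rewrite normcM normc_conj -normcM; exact: normc_Mle.
Qed.

Let conj_mulE z : z * conjc z = Complex (normc z ^+ 2) 0 :> R[i].
Proof.
by apply: complex_eqP; rewrite ?cReM ?cImM cReJ cImJ /= ?normc_sqrE; ring.
Qed.

Let sum_sqn_MJ F : L2 mu F ->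
  (\sum_(n < N) sqn mu (fun x => conjc (M n x) * F x)%R = sqn mu F)%E.
Proof.
move=> FL; rewrite /sqn -ge0_integral_sum//; last first.
- by move=> n x _; rewrite lee_fin sqr_ge0.
- move=> n; apply/measurable_EFinP/measurable_sqr_normc.
  exact: L2_cmeasurable (L2_MJ n FL).
apply: eq_integral => x _; rewrite sumEFin; congr EFin.
under eq_bigr do rewrite normcM normc_conj exprMn.
by rewrite -mulr_suml sum_M mul1r.
Qed.

Lemma multiplier_frame_decomposition f : L2 mu f -> exists S : 'I_N -> T -> R[i],
  [/\ forall n, L2 mu (S n),
    forall n, has_L2sum mu (fun k x => inner mu f (psi k n) * psi k n x) (S n),
    {ae mu, forall x, f x = \sum_(n < N) S n x} &
    (\sum_(n < N) \esum_(k in [set: I]) ((normc (inner mu f (psi k n))) ^+ 2)%:E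
      = L2norm mu f ^+ 2)%E].
Proof.
move=> fL; have [F fF] := U_total fL; have [_ FL] := U_L2 fF.
have /choice[h hU] n : exists g, U g (fun x => conjc (M n x) * F x).
  exact/U_onto/L2_MJ.
have /choice[S SU] n : exists g, U g (fun x => M n x * (conjc (M n x) * F x)).
  exact/U_onto/L2_M/L2_MJ.
have hL n : L2 mu (h n) := (U_L2 (hU n)).1.
have SL n : L2 mu (S n) := (U_L2 (SU n)).1.
have innerE k n : inner mu f (psi k n) = inner mu (h n) (phi k).
  rewrite -(U_inner fF (psiU k n)) -(U_inner (hU n) (phiU k)).
  by apply: eq_cintegral => x; rewrite rmorphM mulrCA mulrA.
exists S; split => //.
- move=> n; apply/has_L2sumP => e e0.
  have := (has_L2sumP _ _ _).1 (phi_frame.2 _ (hL n)).1 _ e0.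
  have FF : Filter (@summability.totally I).
    exact: (@filter_filter _ _ (@summability.totally_filter _)).
  apply: (@filterS _ _ FF) => A; apply: le_lt_trans; rewrite L2norm_le.
  (* On the transform side the first error is [M n] times the second, so the expansion over [psi]
     inherits the convergence of the expansion of [h n] over [phi]. *)
  have lhs := UB (U_sum A (fun k => inner mu f (psi k n)) (psiU^~ n)) (SU n).
  have rhs := UB (U_sum A (fun k => inner mu (h n) (phi k)) phiU) (hU n).
  rewrite -(U_isometry lhs) -(U_isometry rhs).
  have [_ rL] := U_L2 rhs; have [_ lL] := U_L2 lhs.
  apply: le_sqn; [exact: L2_cmeasurable lL|exact: L2_cmeasurable rL|] => x.
  pose r := \sum_(k <- A) inner mu (h n) (phi k) * Phi k x - conjc (M n x) * F x.
  rewrite [X in normc X <= _](_ : _ = M n x * r); first exact: (normc_Mle n (fun=> r) x).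
  rewrite /r mulrBr mulr_sumr; congr (_ - _).
  by apply: eq_bigr => k _; rewrite innerE mulrCA.
- have SU' := UB fF (U_sum (index_enum 'I_N) (fun=> 1) SU).
  have D0 : sqn mu (fun x => F x - \sum_(n < N) 1 * (M n x * (conjc (M n x) * F x))) = 0%E.
    rewrite (_ : (fun x => _) = fun=> 0).
      by apply: ae_sqn_eq0; [exact: cmeasurable_cst|exact: aeW].
    apply/funext => x; under eq_bigr do rewrite mul1r mulrA conj_mulE.
    rewrite -mulr_suml -[X in X * _]/(\sum_(n < N) (real_complex R (normc (M n x) ^+ 2))).
    by rewrite -rmorph_sum sum_M mul1r subrr.
  rewrite (U_isometry SU') in D0.
  have := sqn_eq0 (L2_cmeasurable (U_L2 SU').1) D0; apply: filterS => x /eqP.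
  by rewrite subr_eq0 => /eqP ->; apply: eq_bigr => n _; rewrite mul1r.
- rewrite L2norm_sqr -(U_isometry fF) -(sum_sqn_MJ FL); apply: eq_bigr => n _.
  rewrite (U_isometry (hU n)) -L2norm_sqr -(phi_frame.2 _ (hL n)).2.
  by apply: eq_esum => k _; rewrite innerE.
Qed.

Lemma multiplier_parseval_frame : parseval_frame mu (fun p : I * 'I_N => psi p.1 p.2).
Proof.
split=> [p|f fL]; first exact: (U_L2 (psiU p.1 p.2)).1.
have psiL k n : L2 mu (psi k n) := (U_L2 (psiU k n)).1.
have [S [SL Ssum fS Snorm]] := multiplier_frame_decomposition fL; split.
  apply: (@has_L2sum_pair _ _ _ _ _ _ (fun k n x => inner mu f (psi k n) * psi k n x) S) => //.
  by move=> k n; exact: L2Zl.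
rewrite -Snorm; apply: (esum_pair (a := fun k n => (normc (inner mu f (psi k n)) ^+ 2)%:E)).
by move=> k n; rewrite lee_fin sqr_ge0.
Qed.

End multiplier_frame.

Lemma measurable_fun_setC1 d d' (T : measurableType d) (T' : measurableType d')
    (f g : T -> T') (a : T) : measurable [set a] -> measurable_fun [set~ a] f ->
  (forall x, x != a -> g x = f x) -> measurable_fun setT g.
Proof.
move=> ma mf fg; rewrite (_ : setT = [set a] `|` [set~ a]).
  apply/measurable_funU => //; first exact: measurableC.
  split; first exact: measurable_fun_set1.
  apply: (eq_measurable_fun f) => // x; rewrite inE => /eqP xa.
  by rewrite fg.
by rewrite setUv.
Qed.

Section origin.
Context {R : realType} {n : nat}.
Local Notation mu := (Leb R n).

Lemma measurable_origin : measurable ([set 0] : set 'rV[R]_n).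
Proof.
rewrite (_ : [set 0] = \bigcap_(i in [set: 'I_n]) [set x : 'rV[R]_n | x ord0 i = 0]).
  apply: fin_bigcap_measurable => [|i _]; first exact: finite_finset.
  have := measurable_coord i measurableT (@measurable_set1 R 0).
  by rewrite setTI.
apply/seteqP; split=> [x -> i _|x x0] /=; first by rewrite mxE.
by apply/rowP => i; rewrite mxE x0.
Qed.

(** The half-open cube with sides []-t, 0]] contains the origin and has volume [t^n], which is small
    because the dimension is positive. *)
Lemma ae_neq_origin : (0 < n)%N -> {ae mu, forall w, w != (0 : 'rV[R]_n)}.
Proof.
move=> n_gt0; exists [set 0]; split; first exact: measurable_euclid measurable_origin.
  apply/eqP; rewrite eq_le measure_ge0 andbT; apply/lee_addgt0Pr => e e0.
  rewrite add0e.
  (* The bound [t <= 1] ensures [t^n <= t], and [t <= e]. *)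
  pose t := Num.min e 1.
  have t0 : 0 < t by rewrite lt_min e0 ltr01.
  have h (i : 'I_n) : - t < 0 by rewrite oppr_lt0.
  have boxE : mu (box (fun=> - t) (fun=> 0)) = (t ^+ n)%:E.
    rewrite -(integral_indicT mu (measurable_euclid (measurable_box _ _))) (integral_box h).
    rewrite /box_volume (eq_bigr (fun=> t)) => [|i _]; last by rewrite sub0r opprK.
    by rewrite prodr_const card_ord.
  apply: (@le_trans _ _ (mu (box (fun=> - t) (fun=> 0)))).
    apply: le_measure; rewrite ?inE.
    - exact: measurable_euclid measurable_origin.
    - exact: measurable_euclid (measurable_box _ _).
    - by move=> x -> i; rewrite mxE in_itv/= oppr_lt0 t0 lexx.
  rewrite boxE lee_fin (@le_trans _ _ t)//; last by rewrite ge_min lexx.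
  rewrite -(prednK n_gt0) exprS ler_piMr// ?(ltW t0)//.
  by apply: exprn_ile1; rewrite ?(ltW t0)// ge_min lexx orbT.
by move=> w /= /negP; rewrite negbK => /eqP.
Qed.

End origin.

Section euclid_multiplier.
Context {R : realType} {n : nat}.
Local Notation mu := (Leb R n).
Implicit Types f g : euclid R n -> R[i].

Lemma is_fourier_fourier f : L2 mu f -> is_fourier f (fourier f).
Proof. 
by move=> /is_fourier_total fg; exact: (@xgetPex _ (fun=> 0) [set g | is_fourier f g] fg). Qed.

Lemma is_fourier_inv_fourier g : L2 mu g -> is_fourier (inv_fourier g) g.
Proof. 
by move=> /is_fourier_onto fg; exact: (@xgetPex _ (fun=> 0) [set f | is_fourier f g] fg). Qed.

Lemma is_fourier_L2 f g : is_fourier f g -> L2 mu f /\ L2 mu g.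
Proof. by case. Qed.

End euclid_multiplier.

(** In dimension 0 the origin is the whole space and has mass 1, while admissibility leaves the
    multipliers unconstrained there; hence [d_gt0]. The second conclusion gives the iterated form of
    the sums, with [S n] the sum over [k] and the final equality almost everywhere because functions
    represent classes. *)
Theorem theorem2p4 (R : realType) (d : nat) (d_gt0 : (0 < d)%N)
    (N : nat) (m : 'I_N -> euclid R d -> R[i]) (adm : admissible m)
    (phi : int -> euclid R d -> R[i]) (pf : parseval_frame (Leb R d) phi) :
  let psi (k : int) (n : 'I_N) := multiplier_transform m (phi k) n in
  parseval_frame (Leb R d) (fun p : int * 'I_N => psi p.1 p.2) /\
  forall f : euclid R d -> R[i], L2 (Leb R d) f ->
    (\sum_(n < N) \esum_(k in [set: int])
        ((normc (inner (Leb R d) f (psi k n))) ^+ 2)%:E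
      = L2norm (Leb R d) f ^+ 2)%E /\
    exists S : 'I_N -> euclid R d -> R[i],
      (forall n, L2 (Leb R d) (S n) /\
         has_L2sum (Leb R d)
           (fun k x => inner (Leb R d) f (psi k n) * psi k n x) (S n)) /\
      {ae Leb R d, forall x, f x = \sum_(n < N) S n x}.
Proof.
move=> psi.
(* Any nonzero vector would do; the value of [m] there is the one [m'] takes at the origin. *)
pose w1 : 'rV[R]_d := const_mx 1.
have w1_neq0 : w1 != 0.
  apply/eqP => /rowP /(_ (Ordinal d_gt0)); rewrite !mxE => /eqP.
  by rewrite oner_eq0.
(* The multipliers are unconstrained at the null set {0}; [m'] redefines them there
   so that the squares sum to 1 everywhere. *)
pose m' n (w : euclid R d) := m n (if w == 0 :> 'rV[R]_d then w1 else w).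
have m'E n (w : euclid R d) : (w : 'rV[R]_d) != 0 -> m' n w = m n w.
  by move=> w0; rewrite /m' (negbTE w0).
have sum_m' w : \sum_(n < N) normc (m' n w) ^+ 2 = 1.
  by rewrite /m'; case: ifPn => w0; apply: adm.2.
have mm' n : cmeasurable setT (m' n).
  have [[mr mi] _] := adm.1 n.
  have m0 : measurable ([set 0] : set (euclid R d)) := measurable_euclid measurable_origin.
  split; [apply: (measurable_fun_setC1 m0 mr)|apply: (measurable_fun_setC1 m0 mi)] => w w0;
    by rewrite m'E.
have mm n : cmeasurable setT (m n).
  have [[mr mi] _] := adm.1 n.
  have m0 : measurable ([set 0] : set (euclid R d)) := measurable_euclid measurable_origin.
  by split; [apply: (measurable_fun_setC1 m0 mr)|apply: (measurable_fun_setC1 m0 mi)].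
have m0 : {ae Leb R d, forall w : euclid R d, (w : 'rV[R]_d) != 0}.
  exact: ae_neq_origin.
have phiF k : is_fourier (phi k) (fourier (phi k)) := is_fourier_fourier (pf.1 k).
have m'F_L2 k n : L2 (Leb R d) (fun w => m' n w * fourier (phi k) w).
  have [_ FL] := is_fourier_L2 (phiF k).
  apply: (le_L2 _ FL); first by apply: cmeasurableM; [|exact: L2_cmeasurable FL].
  move=> w; rewrite normcM ler_piMl ?normc_ge0//.
  rewrite -(@expr_le1 _ 2)// ?normc_ge0// -(sum_m' w) (bigD1 n)//= lerDl.
  by apply: sumr_ge0 => i _; exact: sqr_ge0.
(* [psi k n] is a representative chosen for the multiplier [m n]; equality almost everywhere lets
   the same function serve for [m' n]. *)
have psiF k n : is_fourier (psi k n) (fun w => m' n w * fourier (phi k) w).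
  have [_ FL] := is_fourier_L2 (phiF k).
  have m'm : {ae Leb R d, forall w, m' n w * fourier (phi k) w = m n w * fourier (phi k) w}.
    by apply: filterS m0 => w w0; rewrite m'E.
  have mm_ae : {ae Leb R d, forall w, m n w * fourier (phi k) w = m' n w * fourier (phi k) w}.
    by apply: filterS m0 => w w0; rewrite m'E.
  have mF : cmeasurable setT (fun w => m n w * fourier (phi k) w).
    by apply: cmeasurableM; [exact: mm|exact: L2_cmeasurable FL].
  have mFL := ae_eq_L2 (m'F_L2 k n) mF m'm.
  exact: is_fourier_ae (is_fourier_inv_fourier mFL) (m'F_L2 k n) mm_ae.
split.
  exact: (multiplier_parseval_frame is_fourier_L2 is_fourierD is_fourierZl is_fourier_isometry
    is_fourier_inner is_fourier_total is_fourier_onto mm' sum_m' pf phiF psiF).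
move=> f fL.
have [S [SL Ssum fS Snorm]] := multiplier_frame_decomposition is_fourier_L2 is_fourierD
  is_fourierZl is_fourier_isometry is_fourier_inner is_fourier_total is_fourier_onto
  mm' sum_m' pf phiF psiF fL.
by split=> //; exists S; split.
Qed.
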